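(* Let $\Phi=[\phi_1,\dots,\phi_N]$ be a sequence of nonzero vectors generating the lattice $\mathbb{Z}^r\subset\mathbb{R}^r$ and lying in an open half-space. Let $W\subset\mathbb{R}^r$ be a wall of $\Phi$, determined by a primitive vector $E$ of the dual lattice of $\mathbb{Z}^r$, i.e. $W=\{a\in\mathbb{R}^r:\langle a,E\rangle=0\}$, and let $\mathfrak{c}_1,\mathfrak{c}_2$ be two chambers of $\Phi$ adjacent along $W$ and lying on the two sides of $W$, with $\langle E,\mathfrak{c}_1\rangle>0$. Let $\Phi_0=\Phi\cap W$ (the subsequence of elements of $\Phi$ lying in $W$) and let $\mathfrak{c}_{12}$ be the chamber of $\Phi_0$ in $W$ whose closure contains $\overline{\mathfrak{c}_1}\cap\overline{\mathfrak{c}_2}$. (1) Let $v_{12}=v(\Phi_0,\mathfrak{c}_{12})$ be the polynomial function on $W$ associated to $\mathfrak{c}_{12}$, and let $V_{12}$ be any polynomial function on $\mathbb{R}^r$ extending $v_{12}$. Then for all $a\in\mathbb{R}^r$ $$v(\Phi,\mathfrak{c}_1)(a)-v(\Phi,\mathfrak{c}_2)(a)=\mathrm{Res}_{z=0}\left(V_{12}(\partial_x)\cdot\frac{e^{\langle a,x+zE\rangle}}{\prod_{\phi\in\Phi\setminus\Phi_0}\langle\phi,x+zE\rangle}\right)_{x=0}.$$ (2) Suppose $\Phi$ is unimodular. Let $k_{12}=k(\Phi_0,\mathfrak{c}_{12})$ be the polynomial function on $W$ associated to $\mathfrak{c}_{12}$, and let $K_{12}$ be any polynomial function on $\mathbb{R}^r$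 extending $k_{12}$. Then for all $a\in\mathbb{R}^r$ $$k(\Phi,\mathfrak{c}_1)(a)-k(\Phi,\mathfrak{c}_2)(a)=\mathrm{Res}_{z=0}\left(K_{12}(\partial_x)\cdot\frac{e^{\langle a,x+zE\rangle}}{\prod_{\phi\in\Phi\setminus\Phi_0}(1-e^{-\langle\phi,x+zE\rangle})}\right)_{x=0}.$$
   Context: Setting. $V=\mathbb{R}^r$, $U=V^*$ (variable $x\in U$, $a\in V$), $\langle\cdot,\cdot\rangle$ is the pairing. $\mathrm{Res}_{z=0}$ is the coefficient of $z^{-1}$ in the Laurent expansion at $z=0$. For a polynomial function $P$ on $V$, $P(\partial_x)$ is the constant coefficient differential operator acting on functions of $x\in U$ with $P(\partial_x)e^{\langle a,x\rangle}=P(a)e^{\langle a,x\rangle}$; in the formulas it is applied in $x$, then $x$ is set to $0$, giving a meromorphic function of $z$ near $0$. Polytopes. For a sequence $\Phi$ generating a space, $P(\Phi,a)=\{t\in\mathbb{R}_{\ge0}^N:\sum_i t_i\phi_i=a\}$. $k(\Phi)(a)=|P(\Phi,a)\cap\mathbb{Z}^N|$. $\mathrm{vol}(\Phi)(a)$ is the volume of $P(\Phi,a)$ in the affine space $\{t\in\mathbb{R}^N:\sum_i t_i\phi_i=a\}$ for the quotient measure $dt/da$, where $dt$ is Lebesgue measure on $\mathbb{R}^N$ and $da$ is the Lebesgue measure giving covolume $1$ to $\mathbb{Z}^r$; for $\Phi_0$ in $W$, $da$ is replaced by the Lebesgue measure $dw$ on $W$ giving covolume $1$ to $W\cap\mathbb{Z}^r$.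 Chambers. $C(\nu)$ is the closed convex cone generated by $\nu$. $C(\Phi)_{\mathrm{sing}}$ is the union of the cones $C(\nu)$ over subsets $\nu\subset\Phi$ of cardinality $<\dim V$; chambers are the connected components of $V\setminus C(\Phi)_{\mathrm{sing}}$. The exterior of $C(\Phi)$ is a chamber $\mathfrak{c}_{\mathrm{ext}}$; the others, contained in $C(\Phi)$, are called interior. The same definitions apply to $\Phi_0$ in $W$. A wall of $\Phi$ is a hyperplane generated by $r-1$ linearly independent elements of $\Phi$. ''Adjacent along $W$ and on the two sides of $W$, with $\langle E,\mathfrak{c}_1\rangle>0$'' means: $\langle a,E\rangle>0$ for $a\in\mathfrak{c}_1$; either $\langle a,E\rangle<0$ for all $a\in\mathfrak{c}_2$ or $\mathfrak{c}_2=\mathfrak{c}_{\mathrm{ext}}$; and $\overline{\mathfrak{c}_1}\cap\overline{\mathfrak{c}_2}$ is contained in $W$ up to its part of empty relative interior, more precisely $\overline{\mathfrak{c}_1}\cap\overline{\mathfrak{c}_2}\cap W$ has non-empty interior in $W$ (when $\mathfrak{c}_2=\mathfrak{c}_{\mathrm{ext}}$, read $\overline{\mathfrak{c}_1}\cap\overline{\mathfrak{c}_2}$ as $\overline{\mathfrak{c}_1}\cap\overline{\mathfrak{c}_2}\cap W$). Polynomials. For an interior chamber $\mathfrak{c}$, $v(\Phi,\mathfrak{c})$ is the unique polynomial function on $V$ equal to $\mathrm{vol}(\Phi)$ on $\overline{\mathfrak{c}}$. $\Phi$ is unimodular if every subset of $\Phi$ that is a basis of $V$ is a $\mathbb{Z}$-basis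 of the lattice $\mathbb{Z}\Phi$ generated by $\Phi$; then $\Phi_0$ is unimodular for $W\cap\mathbb{Z}^r$, and $k(\Phi,\mathfrak{c})$ is the unique polynomial function on $V$ equal to $k(\Phi)$ on $\overline{\mathfrak{c}}\cap\mathbb{Z}^r$ (similarly for $\Phi_0$, $W$, $W\cap\mathbb{Z}^r$). By convention $v(\Phi,\mathfrak{c}_{\mathrm{ext}})=0$ and $k(\Phi,\mathfrak{c}_{\mathrm{ext}})=0$. *)

(* Defs.v *)
From HB Require Import structures.
From mathcomp Require Import all_boot all_order all_algebra.
From mathcomp Require Import finmap.
From mathcomp Require Import all_classical all_reals all_analysis.
(* Not imported: its notations clash with those of mathcomp-analysis. *)
From mathcomp Require mpoly.

Set Implicit Arguments.
Unset Strict Implicit.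
Unset Printing Implicit Defensive.

Import Order.TTheory GRing.Theory Num.Theory.
Import numFieldNormedType.Exports.

Local Open Scope classical_set_scope.
Local Open Scope ring_scope.

(* V = R^r is the space of row vectors and U = V^* the space of column
   vectors. *)
Definition pairing (R : realType) r (a : 'rV[R]_r) (x : 'cV[R]_r) : R :=
  (a *m x) 0 0.

Definition Zpoints (R : realType) n : set 'rV[R]_n :=
  [set x | forall i, x 0 i \is a Num.int].

Definition Zspan (R : realType) r (s : seq 'rV[R]_r) : set 'rV[R]_r :=
  [set x | inIntSpan (in_tuple s) x].

Definition Zbasis (R : realType) r (L : set 'rV[R]_r) (s : seq 'rV[R]_r) :=
  L = Zspan s /\
  forall c : 'I_(size s) -> int,
    \sum_(i < size s) s`_i *~ c i = 0 -> forall i, c i = 0.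

Definition dual_lattice (R : realType) r : set 'cV[R]_r :=
  [set x | forall a, Zpoints a -> pairing a x \is a Num.int].

Definition primitive (R : realType) r (E : 'cV[R]_r) :=
  dual_lattice E /\
  forall (d : nat) (F : 'cV[R]_r), dual_lattice F -> E = F *+ d -> d = 1%N.

(* The notions below apply to any sequence Psi of vectors of R^r, seen as a
   generating sequence of the subspace <<Psi>>; the lattice of <<Psi>> is its
   intersection with Z^r. *)
Definition spanned (R : realType) r (Psi : seq 'rV[R]_r) : set 'rV[R]_r :=
  [set a | a \in <<Psi>>%VS].

Definition mx_of_seq (R : realType) r (Psi : seq 'rV[R]_r) :
  'M[R]_(size Psi, r) := \matrix_(i < size Psi) Psi`_i.

(* t *m mx_of_seq Psi is the combination of Psi with coefficients t. *)
Definition polytope (R : realType) r (Psi : seq 'rV[R]_r) (a : 'rV[R]_r) :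
  set 'rV[R]_(size Psi) :=
  [set t : 'rV[R]_(size Psi) | (forall i, 0 <= t 0 i) /\
     t *m mx_of_seq Psi = a].

Arguments polytope {R r} Psi a _.

Definition count_polytope (R : realType) r (Psi : seq 'rV[R]_r)
    (a : 'rV[R]_r) : nat :=
  #|` fset_set (polytope Psi a `&` @Zpoints R (size Psi)) |%fset.

(* Lebesgue measure on R^m, as the iterated product of the one-dimensional
   one: this is the Lebesgue measure of A for every Borel set A. *)
Fixpoint lebesgue_vol (R : realType) (m : nat) : set 'rV[R]_m -> \bar R :=
  match m with
  | 0 => fun A => (\1_A 0)%:E
  | m'.+1 => fun A =>
      (\int[@lebesgue_measure R]_x
         lebesgue_vol [set s : 'rV[R]_m' |
           A (row_mx (x%:M : 'rV[R]_1) s : 'rV[R]_m'.+1)])%E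
  end.

(* Linear coordinates on R^N adapted to the map t |-> t *m mx_of_seq Psi: the
   rows of p.2 lie in its kernel, the rows of p.1 lift a basis of the lattice
   of <<Psi>>, and together they form a basis of R^N. *)
Definition fiber_frame_mx (R : realType) r (Psi : seq 'rV[R]_r)
    (p : 'M[R]_(\dim <<Psi>>, size Psi) *
         'M[R]_(size Psi - \dim <<Psi>>, size Psi)) : 'M[R]_(size Psi) :=
  castmx (subnKC (dim_span Psi), erefl) (col_mx p.1 p.2).

Definition fiber_frame (R : realType) r (Psi : seq 'rV[R]_r)
    (p : 'M[R]_(\dim <<Psi>>, size Psi) *
         'M[R]_(size Psi - \dim <<Psi>>, size Psi)) :=
  [/\ p.2 *m mx_of_seq Psi = 0,
      Zbasis (spanned Psi `&` @Zpoints R r)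
        [seq row i (p.1 *m mx_of_seq Psi) | i <- enum 'I_(\dim <<Psi>>)] &
      fiber_frame_mx p \in unitmx].

(* With t = b *m p.1 + s *m p.2 one has dt = |\det| db ds, and b are the
   coordinates of the image of t in a basis of the lattice, so that db is the
   Lebesgue measure giving covolume 1 to this lattice. Hence the quotient
   measure on a fiber is |\det| ds; it does not depend on the frame p, nor on
   the point a *m pinvmx _ chosen as the origin of the fiber over a. *)
Definition vol (R : realType) r (Psi : seq 'rV[R]_r) (a : 'rV[R]_r) : \bar R :=
  let p := xget (0, 0) [set p | @fiber_frame R r Psi p] in
  let A := [set s : 'rV[R]_(size Psi - \dim <<Psi>>) |
    polytope Psi a (a *m pinvmx (mx_of_seq Psi) + s *m p.2)] in
  (`|\det (fiber_frame_mx p)|%:E * lebesgue_vol A)%E.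

Definition cone (R : realType) r (nu : seq 'rV[R]_r) : set 'rV[R]_r :=
  [set a | exists2 t : 'rV[R]_(size nu),
     (forall i, 0 <= t 0 i) & a = t *m mx_of_seq nu].

Definition singular (R : realType) r (Psi : seq 'rV[R]_r) : set 'rV[R]_r :=
  \bigcup_(nu in [set nu | subseq nu Psi /\ (size nu < \dim <<Psi>>)%N])
    cone nu.

Definition chamber (R : realType) r (Psi : seq 'rV[R]_r)
    (c : set 'rV[R]_r) :=
  exists2 x, (spanned Psi `\` singular Psi) x &
    c = connected_component (spanned Psi `\` singular Psi) x.

Definition exterior (R : realType) r (Psi : seq 'rV[R]_r) : set 'rV[R]_r :=
  spanned Psi `\` cone Psi.

Definition wall (R : realType) r (Phi : seq 'rV[R]_r) (W : set 'rV[R]_r) :=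
  exists nu : seq 'rV[R]_r,
    [/\ subseq nu Phi, (size nu).+1 = r, free nu & W = spanned nu].

(* The condition c1 <> c2 only matters for r = 1, where the exterior chamber
   is a half-line and could otherwise play both roles. *)
Definition adjacent_along (R : realType) r (Phi : seq 'rV[R]_r)
    (W : set 'rV[R]_r) (E : 'cV[R]_r) (c1 c2 : set 'rV[R]_r) :=
  [/\ c1 <> c2,
      forall a, c1 a -> 0 < pairing a E,
      (forall a, c2 a -> pairing a E < 0) \/ c2 = exterior Phi &
      exists O : set 'rV[R]_r,
        [/\ open O, O `&` W !=set0 &
            O `&` W `<=` closure c1 `&` closure c2]].

Definition mpoly_eval (R : realType) r (p : mpoly.mpoly r R) (a : 'rV[R]_r) :
  R := mpoly.meval (fun i => a 0 i) p.

Definition polynomial_on (R : realType) r (S : set 'rV[R]_r)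
    (f : 'rV[R]_r -> R) :=
  exists p : mpoly.mpoly r R, forall a, S a -> f a = mpoly_eval p a.

(* f restricts on <<Psi>> to the polynomial function v(Psi, c). *)
Definition vol_polynomial (R : realType) r (Psi : seq 'rV[R]_r)
    (c : set 'rV[R]_r) (f : 'rV[R]_r -> R) :=
  [/\ polynomial_on (spanned Psi) f,
      c = exterior Psi -> forall a, spanned Psi a -> f a = 0 &
      c <> exterior Psi -> forall a, closure c a -> (f a)%:E = vol Psi a].

(* f restricts on <<Psi>> to the polynomial function k(Psi, c). *)
Definition count_polynomial (R : realType) r (Psi : seq 'rV[R]_r)
    (c : set 'rV[R]_r) (f : 'rV[R]_r -> R) :=
  [/\ polynomial_on (spanned Psi) f,
      c = exterior Psi -> forall a, spanned Psi a -> f a = 0 &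
      c <> exterior Psi -> forall a, closure c a -> Zpoints a ->
        f a = (count_polytope Psi a)%:R].

Definition unimodular (R : realType) r (Phi : seq 'rV[R]_r) :=
  forall nu : seq 'rV[R]_r, subseq nu Phi -> basis_of <<Phi>>%VS nu ->
    Zbasis (Zspan Phi) nu.

Definition partial_deriv (R : realType) r (i : 'I_r) (f : 'cV[R]_r -> R) :
  'cV[R]_r -> R := fun x => 'D_(delta_mx i 0 : 'cV[R]_r) f x.

Definition mpartial_deriv (R : realType) r (m : mpoly.multinom r)
    (f : 'cV[R]_r -> R) : 'cV[R]_r -> R :=
  foldr (fun i g => iter (mpoly.fun_of_multinom m i) (partial_deriv i) g) f (enum 'I_r).

(* P(\partial_x) f *)
Definition diffop (R : realType) r (P : mpoly.mpoly r R)
    (f : 'cV[R]_r -> R) : 'cV[R]_r -> R :=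
  fun x => \sum_(m <- mpoly.msupp P) mpoly.mcoeff m P * mpartial_deriv m f x.

(* f has a Laurent expansion \sum_k b_k z^(k - m - 1) at 0, with coefficient
   b_m = c at z^-1. *)
Definition residue0 (R : realType) (f : R -> R) (c : R) :=
  exists (m : nat) (b : nat -> R), c = b m /\
    \forall z \near 0^', pseries b z @ \oo --> z ^+ m.+1 * f z.

(* Main.v *)
Require Import Defs.
From HB Require Import structures.
From mathcomp Require Import all_boot all_order all_algebra.
From mathcomp Require Import finmap.
From mathcomp Require Import all_classical all_reals all_analysis.
From mathcomp Require Import perm measurable_realfun.
From mathcomp Require Import zify ring lra.
From mathcomp Require mpoly.

Set Implicit Arguments.
Unset Strict Implicit.
Unset Printing Implicit Defensive.

Import Order.TTheory GRing.Theory Num.Theory.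
Import numFieldNormedType.Exports.

Local Open Scope classical_set_scope.
Local Open Scope ring_scope.

(** Write l(a) for the level <a,E>, Phi0 for the vectors of Phi in the wall and
    s for the others, and F u for the volume (or number of lattice points) of
    the polytopes of u followed by Phi0, for u a list of vectors of s. The
    claim is that the two polynomials describing F s on either side of the wall
    differ by a residue that only involves F of the empty list near the wall.

    The residue. If kappa is 1 / u or 1 / (1 - e^-u), its derivative is
    c kappa - kappa^2 with c = 0 or 1. Hence the derivatives in x of
    e^<a,x> prod kappa(<phi,x>) are combinations of such products with repeated
    factors ([symbol], [partial_derivs_symbol]), and at x = 0 their residues
    are explicit polynomials in a. This gives a polynomial D u, [vol_residue]
    or [count_residue], whose values are the residues of the statement
    ([vol_residue0], [count_residue0]). It satisfies the recursion of F:
    removing a vector phi from u is differentiating along phi for volumes,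
    taking the difference along phi for lattice points. On the wall it reduces
    to the given polynomial for a single vector, up to the factor lev phi, and
    vanishes for longer lists (for lattice points, it vanishes on a range of
    integral levels at or next to the wall).

    The comparison. Let H u be D u above the wall and 0 below it; for lattice
    points the cut is shifted within the range of zeros. By the recursion,
    F u - H u is obtained from F [:: phi] - H [:: phi] by averaging along the
    other vectors of u. Near a generic point w0 of the wall the latter function
    is constant along phi, both terms being determined by the projection to
    the wall along phi. The iterated differences of F s - H s along s therefore
    vanish near the ray of w0 ([avg_iter_diff_eq0]). Above the wall this
    function is the polynomial for c1 minus D s, below it is the polynomial
    for c2; as in an extrapolation, two polynomials so related are equal
    ([polynomials_agree]). This proves [vol_crossing] and [count_crossing].

    It remains to provide their hypotheses. For volumes, adding a vector that
    depends on the sequence integrates the volume along this vector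
    ([vol_dependent]), and adding a vector to a sequence spanning the wall
    projects to the wall ([vol_transversal]); both come from a linear
    substitution in iterated integrals ([iter_int_unitmx]), which also shows
    that the volume is independent of the coordinates. For lattice points the
    recursion separates the solutions whose first coordinate is zero
    ([count_polytope_step]), and unimodularity makes all levels of s equal to
    1 or -1 ([unimodular_unit_lev]). A generic point of the wall, around which
    c1 and c2 fill the two half-balls, is found by avoiding the finitely many
    subspaces spanned by subsequences ([generic_ball], [wall_ball]). *)

(** * The pairing and the supremum norm *)

Section Pairing.
Variables (R : realType) (r : nat).
Implicit Types (a b : 'rV[R]_r) (x y : 'cV[R]_r).

Lemma pairingE a x : pairing a x = \sum_i a 0 i * x i 0.
Proof. by rewrite /pairing mxE. Qed.

Lemma pairingDl a b x : pairing (a + b) x = pairing a x + pairing b x.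
Proof. by rewrite /pairing mulmxDl mxE. Qed.

Lemma pairingZl (k : R) a x : pairing (k *: a) x = k * pairing a x.
Proof. by rewrite /pairing -scalemxAl mxE. Qed.

Lemma pairingNl a x : pairing (- a) x = - pairing a x.
Proof. by rewrite -scaleN1r pairingZl mulN1r. Qed.

Lemma pairingBl a b x : pairing (a - b) x = pairing a x - pairing b x.
Proof. by rewrite pairingDl pairingNl. Qed.

Lemma pairing0l x : pairing 0 x = 0.
Proof. by rewrite /pairing mul0mx mxE. Qed.

Lemma pairing_suml (I : Type) (s : seq I) (P : pred I) (F : I -> 'rV[R]_r) x :
  pairing (\sum_(i <- s | P i) F i) x = \sum_(i <- s | P i) pairing (F i) x.
Proof. by rewrite /pairing mulmx_suml summxE. Qed.

Lemma pairingDr a x y : pairing a (x + y) = pairing a x + pairing a y.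
Proof. by rewrite /pairing mulmxDr mxE. Qed.

Lemma pairingZr (k : R) a x : pairing a (k *: x) = k * pairing a x.
Proof. by rewrite /pairing -scalemxAr mxE. Qed.

Lemma coord_norm_le a i : `|a 0 i| <= `|a|.
Proof.
have -> : `|a| = mx_norm a by [].
rewrite mx_normrE; exact: (le_bigmax_cond 0 (fun ij => `|a ij.1 ij.2|) (j := (0, i))).
Qed.

Lemma norm_le_coord a (e : R) : 0 <= e -> (forall i, `|a 0 i| <= e) -> `|a| <= e.
Proof.
move=> e0 h; have -> : `|a| = mx_norm a by [].
rewrite mx_normrE; apply/bigmax_leP; split => // -[i j] _ /=.
by rewrite (ord1 i).
Qed.

Definition l1norm x : R := \sum_i `|x i 0|.

Lemma l1norm_ge0 x : 0 <= l1norm x.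
Proof. by apply: sumr_ge0. Qed.

Lemma pairing_le a x : `|pairing a x| <= l1norm x * `|a|.
Proof.
rewrite pairingE (le_trans (ler_norm_sum _ _ _))//.
rewrite /l1norm mulr_suml ler_sum// => i _.
by rewrite normrM mulrC ler_wpM2l// coord_norm_le.
Qed.

Lemma ZpointsD a b : Zpoints a -> Zpoints b -> Zpoints (a + b).
Proof. by move=> ha hb i; rewrite mxE rpredD. Qed.

Lemma ZpointsN a : Zpoints a -> Zpoints (- a).
Proof. by move=> ha i; rewrite mxE rpredN. Qed.

Lemma ZpointsB a b : Zpoints a -> Zpoints b -> Zpoints (a - b).
Proof. by move=> ha hb; apply: ZpointsD => //; exact: ZpointsN. Qed.

Lemma Zpoints0 : Zpoints (0 : 'rV[R]_r).
Proof. by move=> i; rewrite mxE. Qed.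

Lemma ZpointsZ (k : R) a : k \is a Num.int -> Zpoints a -> Zpoints (k *: a).
Proof. by move=> hk ha i; rewrite mxE rpredM. Qed.

Lemma Zpoints_sum (I : Type) (s : seq I) (P : pred I) (F : I -> 'rV[R]_r) :
  (forall i, P i -> Zpoints (F i)) -> Zpoints (\sum_(i <- s | P i) F i).
Proof.
move=> h; elim/big_rec: _ => [|i x Pi hx]; first exact: Zpoints0.
by apply: ZpointsD => //; exact: h.
Qed.

End Pairing.

(** * Functions that are polynomial on every line *)

Section LinePoly.
Variables (R : realType) (r : nat).
Implicit Types (a b v : 'rV[R]_r) (f g : 'rV[R]_r -> R).

(** A uniform bound on the degrees along lines is all that the identity
    principle [line_poly_grid] uses, so that coefficients in several variables
    never have to be handled. *)
Definition line_poly (d : nat) f :=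
  forall a v, exists q : {poly R},
    (size q <= d.+1)%N /\ forall t, f (a + t *: v) = q.[t].

Lemma line_polyW d d' f : (d <= d')%N -> line_poly d f -> line_poly d' f.
Proof.
move=> dd' h a v; have [q [sq hq]] := h a v.
by exists q; split => //; rewrite (leq_trans sq).
Qed.

Lemma line_poly_ext d f g : f =1 g -> line_poly d f -> line_poly d g.
Proof.
move=> fg h a v; have [q [sq hq]] := h a v.
by exists q; split => // t; rewrite -fg hq.
Qed.

Lemma line_poly_cst d (c : R) : line_poly d (fun=> c).
Proof.
move=> a v; exists c%:P; split; last by move=> t; rewrite hornerC.
by rewrite (leq_trans (size_polyC_leq1 _)).
Qed.

Lemma line_polyD d f g : line_poly d f -> line_poly d g ->
  line_poly d (fun a => f a + g a).
Proof.
move=> hf hg a v; have [p [sp hp]] := hf a v; have [q [sq hq]] := hg a v.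
exists (p + q); split; last by move=> t; rewrite hp hq hornerD.
by rewrite (leq_trans (size_polyD _ _))// geq_max sp sq.
Qed.

Lemma line_polyM d e f g : line_poly d f -> line_poly e g ->
  line_poly (d + e) (fun a => f a * g a).
Proof.
move=> hf hg a v; have [p [sp hp]] := hf a v; have [q [sq hq]] := hg a v.
exists (p * q); split; last by move=> t; rewrite hp hq hornerM.
rewrite (leq_trans (size_polyMleq _ _))//.
have := leq_add sp sq; rewrite addSn addnS.
by case: (size p + size q)%N.
Qed.

Lemma line_polyZ d (c : R) f : line_poly d f -> line_poly d (fun a => c * f a).
Proof. by move=> hf; exact: (line_polyM (line_poly_cst 0 c) hf). Qed.

Lemma line_polyN d f : line_poly d f -> line_poly d (fun a => - f a).
Proof.
by move=> /(line_polyZ (-1)); apply: line_poly_ext => a; rewrite mulN1r.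
Qed.

Lemma line_polyB d f g : line_poly d f -> line_poly d g ->
  line_poly d (fun a => f a - g a).
Proof. by move=> hf hg; apply: line_polyD => //; exact: line_polyN. Qed.

Lemma line_poly_shift d b f : line_poly d f -> line_poly d (fun a => f (a + b)).
Proof.
move=> hf a v; have [p [sp hp]] := hf (a + b) v.
by exists p; split => // t; rewrite -hp addrAC.
Qed.

Lemma line_poly_pairing (x : 'cV[R]_r) : line_poly 1 (fun a => pairing a x).
Proof.
move=> a v; exists ((pairing a x)%:P + (pairing v x) *: 'X); split.
  rewrite (leq_trans (size_polyD _ _))// geq_max.
  rewrite (leq_trans (size_polyC_leq1 _))//=.
  by rewrite (leq_trans (size_scale_leq _ _))// size_polyX.
by move=> t; rewrite pairingDl pairingZl hornerD hornerC hornerZ hornerX mulrC.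
Qed.

Lemma line_poly_coord i : line_poly 1 (fun a => a 0 i).
Proof.
apply: line_poly_ext (line_poly_pairing (delta_mx i 0)) => a.
rewrite pairingE (bigD1 i)//= mxE !eqxx mulr1 big1 ?addr0// => j ji.
by rewrite mxE (negbTE ji) mulr0.
Qed.

Definition is_line_poly f := exists d, line_poly d f.

Lemma is_line_poly_ext f g : f =1 g -> is_line_poly f -> is_line_poly g.
Proof. by move=> fg [d h]; exists d; exact: line_poly_ext h. Qed.

Lemma is_line_polyD f g : is_line_poly f -> is_line_poly g ->
  is_line_poly (fun a => f a + g a).
Proof.
move=> [d hf] [e hg]; exists (maxn d e).
by apply: line_polyD; [apply: line_polyW hf|apply: line_polyW hg];
  rewrite leq_max leqnn ?orbT.
Qed.

Lemma is_line_polyM f g : is_line_poly f -> is_line_poly g ->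
  is_line_poly (fun a => f a * g a).
Proof. by move=> [d hf] [e hg]; exists (d + e)%N; exact: line_polyM. Qed.

Lemma is_line_poly_cst (c : R) : is_line_poly (fun=> c).
Proof. by exists 0%N; exact: line_poly_cst. Qed.

Lemma is_line_poly_sum (I : Type) (s : seq I) (F : I -> 'rV[R]_r -> R) :
  (forall i, is_line_poly (F i)) -> is_line_poly (fun a => \sum_(i <- s) F i a).
Proof.
move=> h; elim: s => [|i s IH].
  by apply: is_line_poly_ext (is_line_poly_cst 0) => a; rewrite big_nil.
by apply: is_line_poly_ext (is_line_polyD (h i) IH) => a; rewrite big_cons.
Qed.

Lemma is_line_poly_prod (I : Type) (s : seq I) (F : I -> 'rV[R]_r -> R) :
  (forall i, is_line_poly (F i)) -> is_line_poly (fun a => \prod_(i <- s) F i a).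
Proof.
move=> h; elim: s => [|i s IH].
  by apply: is_line_poly_ext (is_line_poly_cst 1) => a; rewrite big_nil.
by apply: is_line_poly_ext (is_line_polyM (h i) IH) => a; rewrite big_cons.
Qed.

Lemma is_line_polyX f n : is_line_poly f -> is_line_poly (fun a => f a ^+ n).
Proof.
move=> hf; apply: is_line_poly_ext (is_line_poly_prod (iota 0 n) (fun=> hf)) => a.
by rewrite big_const_seq count_predT size_iota iter_mulr_1.
Qed.

Lemma is_line_poly_mpoly (p : mpoly.mpoly r R) : is_line_poly (mpoly_eval p).
Proof.
apply: (@is_line_poly_ext (fun a => \sum_(m <- mpoly.msupp p)
   mpoly.mcoeff m p * \prod_i a 0 i ^+ (mpoly.fun_of_multinom m i))).
  by move=> a; rewrite /mpoly_eval mpoly.mevalE.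
apply: is_line_poly_sum => m; apply: is_line_polyM; first exact: is_line_poly_cst.
apply: is_line_poly_prod => i; apply: is_line_polyX.
by exists 1%N; exact: line_poly_coord.
Qed.

(** A function of degree at most d on lines is determined on a line by d + 1
    of its points; letting the coordinates run free one after the other, the
    vanishing spreads from the points of a cube of side d to the whole space. *)
Lemma line_poly_grid d f b : line_poly d f ->
  (forall k : 'I_r -> nat, (forall i, k i <= d)%N ->
     f (b + \row_i (k i)%:R) = 0) ->
  forall a, f a = 0.
Proof.
move=> hf h0.
have key (j : nat) : forall u : 'rV[R]_r,
    (forall i : 'I_r, (j <= i)%N -> exists2 k : nat, (k <= d)%N & u 0 i = k%:R) ->
    f (b + u) = 0.
  elim: j => [|j IH] u hu.
    have /choice[k hk] (i : 'I_r) : exists k : nat, (k <= d)%N /\ u 0 i = k%:R.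
      by have [k k1 k2] := hu i (leq0n _); exists k.
    have -> : u = \row_i (k i)%:R by apply/rowP => i; rewrite mxE; case: (hk i).
    by apply: h0 => i; case: (hk i).
  case: (ltnP j r) => jr; last first.
    by apply: IH => i ji; have := ltn_ord i; rewrite ltnNge (leq_trans jr ji).
  pose jj := Ordinal jr.
  pose u0 : 'rV[R]_r := u - u 0 jj *: delta_mx 0 jj.
  have u0E i : u0 0 i = if i == jj then 0 else u 0 i.
    rewrite !mxE eqxx /=; case: eqP => [->|_]; first by rewrite mulr1 subrr.
    by rewrite mulr0 subr0.
  have [q [sq hq]] := hf (b + u0) (delta_mx 0 jj).
  have rq (k : nat) : (k <= d)%N -> q.[k%:R] = 0.
    move=> kd; rewrite -hq -addrA; apply: IH => i ji.
    rewrite mxE u0E !mxE eqxx /=; case: eqP => [_|/eqP ne].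
      by exists k => //; rewrite add0r mulr1.
    rewrite mulr0 addr0; apply: hu; rewrite ltn_neqAle ji andbT.
    by apply: contra ne => /eqP ji'; apply/eqP/val_inj.
  have q0 : q = 0.
    apply/eqP; apply/negPn/negP => qn0.
    have := @max_poly_roots _ q [seq (i%:R : R) | i <- iota 0 d.+1] qn0.
    rewrite size_map size_iota ltnNge sq; case/(_ _ _)/negP => //.
      by apply/allP => x /mapP[i]; rewrite mem_iota => /andP[_ id] ->; apply/eqP/rq.
    rewrite map_inj_uniq ?iota_uniq// => m n /eqP.
    by rewrite eqr_nat => /eqP.
  have -> : b + u = (b + u0) + u 0 jj *: delta_mx 0 jj by rewrite -addrA subrK.
  by rewrite hq q0 horner0.
move=> a; rewrite -[a](subrK b) addrC; apply: (key r) => i.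
by rewrite leqNgt ltn_ord.
Qed.

(** Every cube of side d + 1, wherever it is placed, contains a cube of side d
    with integral vertices. *)
Lemma line_poly_lattice_cube d f (p : 'rV[R]_r) : line_poly d f ->
  (forall a, Zpoints a -> `|a - p| <= d.+1%:R -> f a = 0) ->
  forall a, f a = 0.
Proof.
move=> hf h; apply: (line_poly_grid (b := \row_i (Num.floor (p 0 i) + 1)%:~R) hf).
move=> k kd; apply: h.
  apply: ZpointsD => i; rewrite !mxE; first exact: intr_int.
  by rewrite -mulrz_nat intr_int.
apply: norm_le_coord => // i; rewrite !mxE.
have /andP[h1 h2] := Num.Theory.floor_itv (p 0 i).
have kd' : (k i)%:R <= d%:R :> R by rewrite ler_nat.
have k0 : 0 <= (k i)%:R :> R by [].
rewrite ler_norml -natr1; move: h1 h2; rewrite !intrD; set fl := _%:~R.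
by move=> h1 h2; apply/andP; split; lra.
Qed.

End LinePoly.

(** * Iterated differences and the comparison across a hyperplane *)

Section Differences.
Variables (R : realType) (r : nat).
Implicit Types (a b p phi : 'rV[R]_r) (f g : 'rV[R]_r -> R) (s : seq 'rV[R]_r).

Fixpoint iter_diff (h : R) s g a : R :=
  if s is phi :: s' then iter_diff h s' g a - iter_diff h s' g (a - h *: phi)
  else g a.

Definition total_norm s : R := \sum_(phi <- s) `|phi|.

Lemma total_norm_cons phi s : total_norm (phi :: s) = `|phi| + total_norm s.
Proof. by rewrite /total_norm big_cons. Qed.

Lemma total_norm_ge0 s : 0 <= total_norm s.
Proof. by apply: sumr_ge0. Qed.

Lemma iter_diffB h s f g a :
  iter_diff h s (fun x => f x - g x) a = iter_diff h s f a - iter_diff h s g a.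
Proof.
elim: s a => [|phi s IH] a //=; rewrite !IH.
by lra.
Qed.

Lemma iter_diff_shift h s g b a :
  iter_diff h s (fun x => g (x - b)) a = iter_diff h s g (a - b).
Proof. by elim: s a => [|phi s IH] a //=; rewrite !IH addrAC. Qed.

Lemma line_poly_iter_diff d h s g :
  line_poly d g -> line_poly d (iter_diff h s g).
Proof.
move=> hg; elim: s => [|phi s IH] //=.
by apply: line_polyB => //; exact: line_poly_shift.
Qed.

End Differences.

Section AcrossHyperplane.
Variables (R : realType) (r : nat) (E : 'cV[R]_r).
Implicit Types (a b p phi : 'rV[R]_r) (f g : 'rV[R]_r -> R) (s : seq 'rV[R]_r).

Let lev a := pairing a E.

(** Moving by h times such a vector changes the level by at least h; this
    isolates a single corner of a parallelepiped above the hyperplane. *)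
Definition off_wall phi := [/\ Zpoints phi & lev phi <= -1 \/ 1 <= lev phi].

Definition neg_part s := \sum_(phi <- s | lev phi < 0) phi.

Lemma neg_part_cons phi s :
  neg_part (phi :: s) = (if lev phi < 0 then phi else 0) + neg_part s.
Proof. by rewrite /neg_part big_cons; case: ifP => //; rewrite add0r. Qed.

Section Corner.
Variables (h : nat) (g : 'rV[R]_r -> R) (p : 'rV[R]_r) (rho : R).
Hypothesis g0 : forall c, Zpoints c -> `|c - p| < rho -> lev c < 0 -> g c = 0.

Let hR : R := h%:R.

Lemma near_step phi s b : `|b - p| + hR * total_norm (phi :: s) < rho ->
  [/\ `|b - p| + hR * total_norm s < rho,
      `|(b + hR *: phi) - p| + hR * total_norm s < rho &
      `|(b - hR *: phi) - p| + hR * total_norm s < rho].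
Proof.
rewrite total_norm_cons mulrDr addrA => hb.
have hn : 0 <= hR * `|phi| by rewrite mulr_ge0// ler0n.
have nE : `|hR *: phi| = hR * `|phi| by rewrite normrZ ger0_norm// ler0n.
split; apply: le_lt_trans hb; rewrite lerD2r; first by rewrite lerDl.
  by rewrite addrAC -nE ler_normD.
by rewrite addrAC -nE ler_normB.
Qed.

Lemma Zpoints_step phi b : Zpoints phi -> Zpoints b ->
  Zpoints (b + hR *: phi) /\ Zpoints (b - hR *: phi).
Proof.
move=> hp hb; have : Zpoints (hR *: phi) by apply: ZpointsZ => //; exact: natr_int.
by split; [exact: ZpointsD|exact: ZpointsB].
Qed.

(** Shifted by the vectors of negative level, the parallelepiped has b as its
    highest corner. *)
Lemma corner_zero s b : (forall phi, phi \in s -> off_wall phi) ->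
  Zpoints b -> lev b < 0 -> `|b - p| + hR * total_norm s < rho ->
  iter_diff hR s g (b + hR *: neg_part s) = 0.
Proof.
elim: s b => [|phi s IH] b hs Zb lb nb.
  rewrite /neg_part big_nil scaler0 addr0 /=; apply: g0 => //.
  by move: nb; rewrite /total_norm big_nil mulr0 addr0.
have [Zphi lphi] := hs _ (mem_head _ _).
have hs' x : x \in s -> off_wall x by move=> xs; apply: hs; rewrite inE xs orbT.
have [n1 n2 n3] := near_step nb; have [Z1 Z2] := Zpoints_step Zphi Zb.
have h0 : 0 <= hR by exact: ler0n.
rewrite /= neg_part_cons scalerDr; case: ifPn => lp.
  rewrite addrA IH//; last first.
    rewrite /lev pairingDl pairingZl -/(lev b) -/(lev phi).
    by have := mulr_ge0_le0 h0 (ltW lp); lra.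
  by rewrite (addrAC _ _ (- _)) addrK IH// subr0.
rewrite scaler0 add0r IH// addrAC IH ?subr0//.
rewrite /lev pairingBl pairingZl -/(lev b) -/(lev phi).
by rewrite -leNgt in lp; have := mulr_ge0 h0 lp; lra.
Qed.

(** When b lies less than one step above level 0, all other corners lie below
    level 0. *)
Lemma corner_single s b : (forall phi, phi \in s -> off_wall phi) ->
  Zpoints b -> lev b < hR -> `|b - p| + hR * total_norm s < rho ->
  iter_diff hR s g (b + hR *: neg_part s) = 0 -> g b = 0.
Proof.
elim: s b => [|phi s IH] b hs Zb lb nb.
  by rewrite /neg_part big_nil scaler0 addr0.
have [Zphi lphi] := hs _ (mem_head _ _).
have hs' x : x \in s -> off_wall x by move=> xs; apply: hs; rewrite inE xs orbT.
have [n1 n2 n3] := near_step nb; have [Z1 Z2] := Zpoints_step Zphi Zb.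
have h0 : 0 <= hR by exact: ler0n.
rewrite /= neg_part_cons scalerDr; case: ifPn => lp.
  rewrite addrA (corner_zero hs' Z1)//; last first.
    rewrite /lev pairingDl pairingZl -/(lev b) -/(lev phi).
    have : hR * (lev phi + 1) <= 0 by apply: mulr_ge0_le0 => //; case: lphi; lra.
    by rewrite mulrDr mulr1; lra.
  rewrite (addrAC _ _ (- _)) addrK sub0r => /eqP; rewrite oppr_eq0 => /eqP.
  exact: IH.
rewrite scaler0 add0r addrAC (corner_zero hs' Z2)//; last first.
  rewrite /lev pairingBl pairingZl -/(lev b) -/(lev phi).
  rewrite -leNgt in lp.
  have : 0 <= hR * (lev phi - 1) by apply: mulr_ge0 => //; case: lphi; lra.
  by rewrite mulrBr mulr1; lra.
by rewrite subr0; exact: IH.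
Qed.

Lemma iter_diff_below s a : (forall phi, phi \in s -> Zpoints phi) ->
  Zpoints a -> lev a + l1norm E * (hR * total_norm s) < 0 ->
  `|a - p| + hR * total_norm s < rho -> iter_diff hR s g a = 0.
Proof.
elim: s a => [|phi s IH] a Zs Za.
  by rewrite /total_norm !big_nil !mulr0 !addr0 => ? ?; exact: g0.
rewrite total_norm_cons 2!mulrDr => la na /=.
have Zt x : x \in s -> Zpoints x by move=> xs; apply: Zs; rewrite inE xs orbT.
have K0 := l1norm_ge0 E.
have p0 : 0 <= hR * `|phi| by rewrite mulr_ge0// ler0n.
have nphi : `|hR *: phi| = hR * `|phi| by rewrite normrZ ger0_norm// ler0n.
have Kp := mulr_ge0 K0 p0.
have := pairing_le (hR *: phi) E; rewrite nphi ler_norml => /andP[h3 _].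
have h4 := ler_normB (a - p) (hR *: phi); rewrite nphi in h4.
rewrite !IH ?subrr//; try by lra.
- exact: (Zpoints_step (Zs _ (mem_head _ _)) Za).2.
- by rewrite /lev pairingBl -/(lev a); lra.
- by rewrite addrAC; lra.
Qed.

End Corner.

(** Let F agree with one polynomial above the hyperplane and with another one
    below it, on lattice points near the ray through w0. If the iterated
    differences of F vanish there, the two polynomials coincide: below the
    hyperplane, the iterated difference of the second one is a polynomial with
    too many zeros, hence zero; and in a parallelepiped with a single corner
    above the hyperplane, only the difference of the two polynomials at this
    corner survives. *)
Lemma polynomials_agree (s : seq 'rV[R]_r) (F q1 q2 : 'rV[R]_r -> R) w0
    (eps : R) (v : 'rV[R]_r) :
  (forall phi, phi \in s -> off_wall phi) -> lev w0 = 0 -> 0 < eps -> lev v = 1 ->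
  (forall (L : R) a, 0 < L -> Zpoints a -> `|a - L *: w0| < L * eps ->
     0 < lev a -> F a = q1 a) ->
  (forall (L : R) a, 0 < L -> Zpoints a -> `|a - L *: w0| < L * eps ->
     lev a < 0 -> F a = q2 a) ->
  (forall (L : R) (h : nat) a, 0 < L -> Zpoints a ->
     `|a - L *: w0| + h%:R * total_norm s < L * eps ->
     iter_diff h%:R s F a = 0) ->
  is_line_poly q1 -> is_line_poly q2 -> forall a, q1 a = q2 a.
Proof.
move=> hs lw0 eps0 lv hq1 hq2 hF lp1 [d2 lp2].
set K := l1norm E; have K0 : 0 <= K := l1norm_ge0 E.
set S := total_norm s; have S0 : 0 <= S := total_norm_ge0 s.
have levL (L : R) : lev (L *: w0) = 0 by rewrite /lev pairingZl -/(lev w0) lw0 mulr0.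
(* a point near L w0 + M v, with L large compared to everything else *)
have big (M T : R) : exists2 L : R, 0 < L & M * `|v| + T < L * eps.
  exists (Num.max 1 ((M * `|v| + T + 1) / eps)); first by rewrite lt_max ltr01.
  have : (M * `|v| + T + 1) / eps <= Num.max 1 ((M * `|v| + T + 1) / eps).
    by rewrite le_max lexx orbT.
  by rewrite ler_pdivrMr//; lra.
have nearL (L M c : R) a : `|a - (L *: w0 + M *: v)| <= c ->
    `|a - L *: w0| <= `|M| * `|v| + c /\ `|lev a - M| <= K * c.
  move=> ha; split.
    rewrite (_ : a - _ = M *: v + (a - (L *: w0 + M *: v))).
      by rewrite (le_trans (ler_normD _ _))// normrZ lerD2l.
    by rewrite opprD [RHS]addrC addrA subrK.
  have -> : lev a - M = lev (a - (L *: w0 + M *: v)).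
    by rewrite /lev pairingBl pairingDl -/(lev (L *: w0)) levL pairingZl
      -/(lev v) lv mulr1 add0r.
  by rewrite (le_trans (pairing_le _ _))// ler_wpM2l.
have Tq2 (h : nat) a : iter_diff h%:R s q2 a = 0.
  pose c : R := d2.+1%:R; pose M : R := - (K * c + K * (h%:R * S) + 1).
  have [L L0 hL] := big `|M| (c + h%:R * S).
  move: a; apply: (line_poly_lattice_cube (p := L *: w0 + M *: v)
    (line_poly_iter_diff _ _ lp2)) => a Za /nearL [na la].
  have nn : `|a - L *: w0| + h%:R * S < L * eps by lra.
  have la' : lev a + K * (h%:R * S) < 0.
    by move: la; rewrite ler_norml => /andP[_]; rewrite /M /c; lra.
  have : iter_diff h%:R s (fun x => F x - q2 x) a = 0.
    apply: (iter_diff_below (p := L *: w0) (rho := L * eps)) => //.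
      by move=> x Zx nx lx; rewrite (hq2 L x)// subrr.
    by move=> phi /hs [].
  by rewrite iter_diffB (hF L)// sub0r => /eqP; rewrite oppr_eq0 => /eqP.
have [d lpd] : is_line_poly (fun a => q1 a - q2 a).
  by case: lp1 => d1 lp1; exists (maxn d1 d2); apply: line_polyB;
    [apply: line_polyW lp1|apply: line_polyW lp2]; rewrite leq_max leqnn ?orbT.
pose c : R := d.+1%:R; pose M : R := K * c + 1.
have c0 : 0 <= c by exact: ler0n.
pose h := Num.truncn (M + K * c + 1).
have hh : M + K * c < h.+1%:R.
  have Mc0 : 0 <= M + K * c + 1 by rewrite /M; have := mulr_ge0 K0 c0; lra.
  by have /andP[_] := Num.Theory.truncn_itv Mc0; rewrite -/h; lra.
pose T := total_norm s + `|neg_part s|.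
have [L L0 hL] := big `|M| (c + h.+1%:R * T + h.+1%:R * T).
have T0 : 0 <= h.+1%:R * T by rewrite mulr_ge0// addr_ge0.
have q12 : forall a, q1 a - q2 a = 0.
  apply: (line_poly_lattice_cube (p := L *: w0 + M *: v) lpd) => b Zb /nearL[nb lb].
  have /andP[lb1 lb2] : 0 < lev b < h.+1%:R.
    move: lb; rewrite ler_norml => /andP[h1 h2].
    by apply/andP; split; move: hh h1 h2; rewrite /M /c; lra.
  have hS : h.+1%:R * total_norm s <= h.+1%:R * T by rewrite ler_wpM2l// lerDl.
  have hN : h.+1%:R * `|neg_part s| <= h.+1%:R * T by rewrite ler_wpM2l// lerDr.
  rewrite -(hq1 L b)//; last by lra.
  apply: (@corner_single h.+1 (fun x => F x - q2 x) (L *: w0) (L * eps) _ s b) => //.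
  - by move=> x Zx nx lx; rewrite (hq2 L x)// subrr.
  - by rewrite -/c in nb; lra.
  have ZN : Zpoints (neg_part s).
    rewrite /neg_part big_seq_cond; apply: Zpoints_sum => phi /andP[phis _].
    by case: (hs _ phis).
  rewrite iter_diffB Tq2 (hF L)// ?subr0//.
    by apply: ZpointsD => //; apply: ZpointsZ => //; exact: natr_int.
  have := ler_normD (b - L *: w0) (h.+1%:R *: neg_part s).
  rewrite normrZ normr_nat addrAC => nn; rewrite -/c in nb.
  lra.
by move=> a; apply/eqP; rewrite -subr_eq0 q12.
Qed.

End AcrossHyperplane.

(** * Functions obtained from one another by averaging along vectors *)

Section Averaging.
Variables (R : realType) (r : nat).
Notation V := ('rV[R]_r).
Variables (h : R) (M : (V -> R) -> Prop) (A : V -> (V -> R) -> V -> R).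
Hypothesis MB : forall g psi, M g -> M (fun a => g a - g (a - h *: psi)).
Hypothesis AB : forall phi psi g a, M g ->
  A phi (fun x => g x - g (x - h *: psi)) a = A phi g a - A phi g (a - h *: psi).
Hypothesis A0 : forall phi g a,
  (forall t, 0 <= t <= h -> g (a - t *: phi) = 0) -> A phi g a = 0.

Lemma iter_diff_avg s phi g : M g ->
  M (iter_diff h s g) /\
  forall a, iter_diff h s (A phi g) a = A phi (iter_diff h s g) a.
Proof.
move=> Mg; elim: s => [|psi s [Ms IH]] //=.
by split=> [|a]; [exact: MB|rewrite !IH AB].
Qed.

Variables (F : seq V -> V -> R) (P : V -> Prop).
Hypothesis MF : forall phi s, (forall x, x \in phi :: s -> P x) -> M (F (phi :: s)).
Hypothesis F_step : forall phi psi s a, (forall x, x \in [:: phi, psi & s] -> P x) ->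
  F [:: phi, psi & s] a - F [:: phi, psi & s] (a - h *: phi) =
  A phi (F (psi :: s)) a.

(** If one difference of F [:: phi] vanishes locally, then so does the iterated
    difference of F s along s: the differences along the other vectors turn
    F s into an average of F [:: phi], and averaging commutes with
    differences. *)
Lemma avg_iter_diff_eq0 (p : V) (rho : R) :
  (forall phi a, P phi -> `|a - p| + h * `|phi| < rho ->
     F [:: phi] a - F [:: phi] (a - h *: phi) = 0) ->
  forall s a, s != [::] -> (forall x, x \in s -> P x) ->
    `|a - p| + h * total_norm s < rho -> iter_diff h s (F s) a = 0.
Proof.
move=> F_base; elim => [//|phi [|psi s] IH] a _ Ps na.
  apply: F_base; first exact: Ps (mem_head _ _).
  by move: na; rewrite total_norm_cons /total_norm big_nil addr0.
have Ps' x : x \in psi :: s -> P x by move=> xs; apply: Ps; rewrite inE xs orbT.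
rewrite [LHS](_ : _ = iter_diff h (psi :: s) (A phi (F (psi :: s))) a); last first.
  rewrite -[LHS]/(iter_diff h (psi :: s) _ a - iter_diff h (psi :: s) _ (a - _)).
  rewrite -iter_diff_shift -iter_diffB; congr iter_diff.
  by apply/funext => x; exact: F_step.
rewrite (iter_diff_avg _ _ (MF Ps')).2; apply: A0 => t /andP[t0 th].
apply: IH => //; apply: le_lt_trans na.
rewrite [X in _ <= _ + _ * X]total_norm_cons mulrDr addrA lerD2r addrAC.
rewrite (le_trans (ler_normB _ _))// lerD2l normrZ ger0_norm//.
by rewrite ler_wpM2r.
Qed.

End Averaging.

(** * Symbols of iterated derivatives *)

Section Symbols.
Variables (R : realType) (r : nat).
Notation V := ('rV[R]_r).
Implicit Types (a phi : V) (s : seq V) (w : seq 'I_r) (c : R).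

(** If kappa' = c kappa - kappa^2, the derivative in the i-th coordinate of
      e^<a,x> kappa(<phi_1,x>) ... kappa(<phi_n,x>)
    is a combination of such products, in which one of the factors may be
    repeated. [symbol] iterates this rule, the value of the product over the
    list s being [val s]; the head of w is the first derivative taken. *)
Fixpoint symbol c a (val : seq V -> R) w s : R :=
  if w is i :: w' then
    a 0 i * symbol c a val w' s +
    \sum_(phi <- s) phi 0 i * (c * symbol c a val w' s
                               - symbol c a val w' (phi :: s))
  else val s.

Lemma symbol_perm c a val w s s' :
  (forall s1 s2, perm_eq s1 s2 -> val s1 = val s2) ->
  perm_eq s s' -> symbol c a val w s = symbol c a val w s'.
Proof.
move=> hval; elim: w s s' => [|i w IH] s s' ss' /=; first exact: hval.
rewrite (IH _ _ ss') (perm_big _ ss') /=; congr (_ + _).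
by apply: eq_bigr => phi _; rewrite (IH (phi :: s) (phi :: s'))// perm_cons.
Qed.

(** Differentiation repeats factors but introduces no new ones, so that a
    vanishing property stable under repetition passes to the symbol. *)
Lemma symbol_ind (Q : seq V -> Prop) c a val w s :
  (forall phi s', phi \in s' -> Q s' -> Q (phi :: s')) ->
  (forall s', Q s' -> val s' = 0) -> Q s -> symbol c a val w s = 0.
Proof.
move=> Qc h; elim: w s => [|i w IH] s Qs /=; first exact: h.
rewrite (IH _ Qs) mulr0 add0r big_seq big1 // => phi phis.
by rewrite IH ?mulr0 ?subrr ?mulr0//; exact: Qc.
Qed.

(** At the values where the rule is stationary (kappa = c), only the derivatives
    of the exponential survive. *)
Lemma symbol_stationary (Q : seq V -> Prop) a val w s k :
  (forall phi s', phi \in s' -> Q s' -> Q (phi :: s')) ->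
  (forall s', Q s' -> val s' = k) -> Q s ->
  symbol 1 a val w s = k * \prod_(i <- w) a 0 i.
Proof.
move=> Qc h; elim: w s => [|i w IH] s Qs /=; first by rewrite big_nil mulr1 h.
rewrite big_cons big_seq big1 ?addr0; first by rewrite IH// mulrCA.
by move=> phi phis; rewrite !IH ?mul1r ?subrr ?mulr0//; exact: Qc.
Qed.

(** With two factors or more all values vanish, and differentiation never
    removes a factor. *)
Lemma symbol_single a val w phi k :
  val [:: phi] = k -> (forall s, (1 < size s)%N -> val s = 0) ->
  symbol 0 a val w [:: phi] = k * \prod_(i <- w) a 0 i.
Proof.
move=> h1 h2; elim: w => [|i w IH] /=; first by rewrite big_nil mulr1.
have z : symbol 0 a val w [:: phi; phi] = 0.
  by apply: (@symbol_ind (fun s => 1 < size s)%N) => // ? [].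
by rewrite big_seq1 big_cons IH z mul0r subrr mulr0 addr0 mulrCA.
Qed.

Lemma is_line_poly_symbol c (val : seq V -> V -> R) w s :
  (forall s', is_line_poly (val s')) ->
  is_line_poly (fun a => symbol c a (val^~ a) w s).
Proof.
move=> h; elim: w s => [|i w IH] s /=; first exact: h.
apply: is_line_polyD.
  by apply: is_line_polyM => //; exists 1%N; exact: line_poly_coord.
apply: is_line_poly_sum => phi; apply: is_line_polyM; first exact: is_line_poly_cst.
apply: is_line_polyD; first by apply: is_line_polyM => //; exact: is_line_poly_cst.
apply: is_line_poly_ext (is_line_polyM (is_line_poly_cst _ (-1)) (IH (phi :: s))).
by move=> a; rewrite mulN1r.
Qed.

(** Removing a factor: the finite difference in a along phi of the product with
    the factor kappa(<phi,x>) = 1 / (1 - e^-<phi,x>). *)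
Lemma symbol_diff (P : V -> Prop) (val : seq V -> V -> R) w phi s a :
  (forall s1 s2 a', perm_eq s1 s2 -> val s1 a' = val s2 a') ->
  (forall psi s' a', (forall x, x \in psi :: s' -> P x) ->
     val (psi :: s') a' - val (psi :: s') (a' - psi) = val s' a') ->
  (forall x, x \in phi :: s -> P x) ->
  symbol 1 a (val^~ a) w (phi :: s) - symbol 1 (a - phi) (val^~ (a - phi)) w (phi :: s)
  = symbol 1 a (val^~ a) w s.
Proof.
move=> hp hd; elim: w s => [|i w IH] s Ps /=; first exact: hd.
rewrite !big_cons !mxE.
set A1 := symbol 1 a _ w (phi :: s); set A2 := symbol 1 _ _ w (phi :: s).
set B1 := symbol 1 a _ w (phi :: phi :: s).
set B2 := symbol 1 _ _ w (phi :: phi :: s).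
set A0 := symbol 1 a _ w s.
have e1 : A1 - A2 = A0 by exact: IH.
have e2 : B1 - B2 = A1.
  by apply: IH => x; rewrite in_cons => /predU1P[->|/Ps//]; apply: Ps (mem_head _ _).
set S1 := \sum_(j <- s) _; set S2 := \sum_(j <- s) _; set S0 := \sum_(j <- s) _.
have e3 : S1 - S2 = S0.
  rewrite -sumrB; apply: eq_big_seq => j js /=.
  have sw b : symbol 1 b (val^~ b) w [:: j, phi & s] =
              symbol 1 b (val^~ b) w [:: phi, j & s].
    apply: symbol_perm; first by move=> s1 s2; exact: hp.
    by rewrite -(cat1s j) -(cat1s phi) perm_catCA.
  have <- := IH (j :: s) _; last first.
    move=> x; rewrite !in_cons => /or3P[/eqP->|/eqP->|xs]; apply: Ps.
    - exact: mem_head.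
    - by rewrite inE js orbT.
    - by rewrite inE xs orbT.
  rewrite !sw -/A0 -e1 !mul1r; ring.
move: e1 e2 e3; rewrite !mul1r; clear.
move=> <- e2 <-; rewrite -[A1 in X in _ = X]addr0.
have -> : B1 = A1 + B2 by rewrite -e2; ring.
ring.
Qed.

Lemma is_derive_sum_seq (I : eqType) (s : seq I) (F : I -> R -> R) (d : I -> R) (t : R) :
  (forall j, j \in s -> is_derive t (1 : R) (F j) (d j)) ->
  is_derive t (1 : R) (fun t => \sum_(j <- s) F j t) (\sum_(j <- s) d j).
Proof.
elim: s => [|j s IH] h.
  under eq_fun do rewrite big_nil.
  by rewrite big_nil; exact: is_derive_cst.
under eq_fun do rewrite big_cons.
rewrite big_cons; apply: is_deriveD; first exact: h (mem_head _ _).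
by apply: IH => k ks; apply: h; rewrite inE ks orbT.
Qed.

Lemma is_derive_bigsum (I : Type) (s : seq I) (F : I -> R -> R) (d : I -> R) (t : R) :
  (forall j, is_derive t (1 : R) (F j) (d j)) ->
  is_derive t (1 : R) (fun t => \sum_(j <- s) F j t) (\sum_(j <- s) d j).
Proof.
move=> h; elim: s => [|j s IH].
  under eq_fun do rewrite big_nil.
  by rewrite big_nil; exact: is_derive_cst.
under eq_fun do rewrite big_cons.
by rewrite big_cons; exact: is_deriveD.
Qed.

(** The same for kappa(<phi,x>) = 1 / <phi,x>, the finite difference becoming a
    derivative. *)
Lemma symbol_derive (P : V -> Prop) (val : seq V -> V -> R) w phi s a t :
  (forall s1 s2 a', perm_eq s1 s2 -> val s1 a' = val s2 a') ->
  (forall psi s' a' t', (forall x, x \in psi :: s' -> P x) ->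
     is_derive (t' : R) 1 (fun t => val (psi :: s') (a' + t *: psi))
               (val s' (a' + t' *: psi))) ->
  (forall x, x \in phi :: s -> P x) ->
  is_derive (t : R) 1
    (fun t => symbol 0 (a + t *: phi) (val^~ (a + t *: phi)) w (phi :: s))
    (symbol 0 (a + t *: phi) (val^~ (a + t *: phi)) w s).
Proof.
move=> hp hd; elim: w s => [|i w IH] s Ps /=; first exact: hd.
under eq_fun do rewrite big_cons.
pose G s' t := symbol 0 (a + t *: phi) (val^~ (a + t *: phi)) w s'.
have sw j b : symbol 0 b (val^~ b) w [:: j, phi & s] =
            symbol 0 b (val^~ b) w [:: phi, j & s].
  apply: symbol_perm; first by move=> s1 s2; exact: hp.
  by rewrite -(cat1s j) -(cat1s phi) perm_catCA.
rewrite (_ : (fun t => _) = (fun t => (a 0 i + t * phi 0 i) * G (phi :: s) t +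
    (- (phi 0 i) * G [:: phi, phi & s] t +
     \sum_(j <- s) - (j 0 i) * G [:: phi, j & s] t))); last first.
  apply/funext => u; rewrite !mxE /G; congr (_ + (_ + _)).
    by rewrite mul0r sub0r mulrN mulNr.
  by apply: eq_bigr => j _; rewrite mul0r sub0r mulrN mulNr sw.
have d1 : is_derive t 1 (G (phi :: s)) (G s t) by exact: IH.
have d2 : is_derive t 1 (G [:: phi, phi & s]) (G (phi :: s) t).
  by apply: IH => x; rewrite in_cons => /predU1P[->|/Ps//]; apply: Ps (mem_head _ _).
have d3 j : j \in s -> is_derive t 1 (G [:: phi, j & s]) (G (j :: s) t).
  move=> js; apply: IH.
  move=> x; rewrite !in_cons => /or3P[/eqP->|/eqP->|xs]; apply: Ps.
  - exact: mem_head.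
  - by rewrite inE js orbT.
  - by rewrite inE xs orbT.
have d4 : is_derive t 1 (fun t => \sum_(j <- s) - (j 0 i) * G [:: phi, j & s] t)
    (\sum_(j <- s) - (j 0 i) * G (j :: s) t).
  by apply: is_derive_sum_seq => j js; exact: (is_deriveZ (- (j 0 i)) (d3 j js)).
have dlin : is_derive t 1 (fun t : R => a 0 i + t * phi 0 i) (phi 0 i).
  have H := is_deriveD (is_derive_cst (a 0 i) t (1 : R))
    (is_deriveM (is_derive_id t (1 : R)) (is_derive_cst (phi 0 i) t (1 : R))).
  by apply: (is_derive_eq H); rewrite /GRing.scale /= mulr0 !add0r mulr1.
have H := is_deriveD (is_deriveM dlin d1) (is_deriveD (is_deriveZ (- phi 0 i) d2) d4).
apply: (is_derive_eq H); rewrite /GRing.scale /= /G !mxE.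
rewrite [X in _ = _ + X](_ : _ = \sum_(j <- s) - (j 0 i) *
   symbol 0 (a + t *: phi) (val^~ (a + t *: phi)) w (j :: s)); last first.
  by apply: eq_bigr => j _; rewrite mul0r sub0r mulrN mulNr.
ring.
Qed.

End Symbols.

(** * Residue polynomials *)

Section Residue.
Variables (R : realType) (r : nat) (E : 'cV[R]_r) (Q : mpoly.mpoly r R).
Notation V := ('rV[R]_r).
Implicit Types (a phi : V) (s : seq V) (w : seq 'I_r).

Let lev a := pairing a E.

(** The order in which [mpartial_deriv] takes the partial derivatives. *)
Definition deriv_word (m : mpoly.multinom r) : seq 'I_r :=
  rev (flatten [seq nseq (mpoly.fun_of_multinom m i) i | i <- enum 'I_r]).

Lemma prod_deriv_word (m : mpoly.multinom r) (f : 'I_r -> R) :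
  \prod_(i <- deriv_word m) f i = \prod_i f i ^+ mpoly.fun_of_multinom m i.
Proof.
rewrite /deriv_word (perm_big (flatten
  [seq nseq (mpoly.fun_of_multinom m i) i | i <- enum 'I_r])) ?perm_rev//=.
rewrite big_flatten big_map -big_enum /=; apply: eq_bigr => i _.
by rewrite big_nseq iter_mulr_1.
Qed.

Lemma mpoly_evalE a : mpoly_eval Q a =
  \sum_(m <- mpoly.msupp Q) mpoly.mcoeff m Q * \prod_(i <- deriv_word m) a 0 i.
Proof.
rewrite /mpoly_eval mpoly.mevalE; apply: eq_bigr => m _.
by rewrite prod_deriv_word.
Qed.

(** The residue on the right-hand side, [rho s l] being the residue at 0 of
    e^(l z) prod_(phi <- s) kappa(<phi,E> z). *)
Definition residue_poly (c : R) (rho : seq V -> R -> R) s a : R :=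
  \sum_(m <- mpoly.msupp Q) mpoly.mcoeff m Q *
    symbol c a (fun s' => rho s' (lev a)) (deriv_word m) s.

Lemma is_line_poly_residue c rho s :
  (forall s', is_line_poly (fun a => rho s' (lev a))) ->
  is_line_poly (residue_poly c rho s).
Proof.
move=> h; apply: is_line_poly_sum => m.
apply: is_line_polyM; first exact: is_line_poly_cst.
exact: (is_line_poly_symbol c (val := fun s' a => rho s' (lev a))).
Qed.

Definition unit_lev phi := lev phi = 1 \/ lev phi = -1.

Definition neg_count s : nat := count (fun phi => lev phi < 0) s.

(** This is (-1)^q times the binomial coefficient of l - q + n - 1 over n - 1,
    the residue at 0 of e^((l-q)z) / (1 - e^-z)^n being that coefficient. *)
Definition count_rho s (l : R) : R :=
  if s is [::] then 0 else
  (-1) ^+ neg_count s *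
  (\prod_(k < (size s).-1) (l - (neg_count s)%:R + k.+1%:R) / ((size s).-1)`!%:R).

Lemma count_rho_perm s1 s2 l : perm_eq s1 s2 -> count_rho s1 l = count_rho s2 l.
Proof.
move=> p; rewrite /count_rho /neg_count (perm_size p) (seq.permP p).
by have := perm_size p; case: (s1) => [|? ?]; case: (s2).
Qed.

Lemma prod_shift (x : R) n :
  \prod_(k < n.+1) (x + k.+1%:R) - \prod_(k < n.+1) (x - 1 + k.+1%:R) =
  n.+1%:R * \prod_(k < n) (x + k.+1%:R).
Proof.
rewrite big_ord_recr /= (big_ord_recl n) /=.
rewrite [X in _ - _ * X](_ : _ = \prod_(k < n) (x + k.+1%:R)).
  by rewrite -(natr1 n); ring.
by apply: eq_bigr => k _; rewrite /bump leq0n add1n -(natr1 k.+1); ring.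
Qed.

Lemma count_rho_diff phi s l : unit_lev phi ->
  count_rho (phi :: s) l - count_rho (phi :: s) (l - lev phi) = count_rho s l.
Proof.
move=> up; rewrite /count_rho /= /neg_count /=.
case: s => [|psi s] /=; first by rewrite !big_ord0 subrr.
rewrite -/(neg_count s); set n := size s.
set q := ((lev psi < 0)%R + neg_count s)%N.
have fn : n.+1`!%:R != 0 :> R by rewrite pnatr_eq0 -lt0n fact_gt0.
have nn : n.+1%:R != 0 :> R by rewrite pnatr_eq0.
have fE : n.+1`!%:R = n.+1%:R * n`!%:R :> R by rewrite factS natrM.
have fn' : n`!%:R != 0 :> R by rewrite pnatr_eq0 -lt0n fact_gt0.
have main (x : R) : \prod_(k < n.+1) (x + k.+1%:R) / n.+1`!%:R -
    \prod_(k < n.+1) (x - 1 + k.+1%:R) / n.+1`!%:R =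
    \prod_(k < n) (x + k.+1%:R) / n`!%:R.
  rewrite -mulrBl prod_shift fE invfM mulrACA mulfV// mul1r; ring.
case: up => -> .
  rewrite ltr10 /= add0n -mulrBr; congr (_ * _).
  by rewrite -main; congr (_ - _ / _); apply: eq_bigr => k _; ring.
rewrite ltrN10 /= add1n exprS -mulrBr opprK mulN1r mulNr -mulrN opprB.
congr (_ * _); rewrite -main; congr (_ / _ - _ / _); apply: eq_bigr => k _.
  by rewrite -(natr1 q); ring.
by rewrite -(natr1 q); ring.
Qed.

(** These are the zeros of the binomial coefficient. *)
Lemma count_rho_eq0 s (j : int) : 1 - ((size s)%:Z - (neg_count s)%:Z) <= j ->
  j <= (neg_count s)%:Z - 1 -> count_rho s j%:~R = 0.
Proof.
case: s => [//|phi s]; rewrite /count_rho -/(size s) => h1 h2.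
have qs : (neg_count (phi :: s) <= (size s).+1)%N by exact: count_size.
pose k := absz ((neg_count (phi :: s))%:Z - 1 - j)%R.
have kE : k%:Z = (neg_count (phi :: s))%:Z - 1 - j.
  by rewrite /k gez0_abs// subr_ge0.
have ks : (k < size s)%N.
  rewrite -ltz_nat kE; move: h1 h2 qs; rewrite /= -lez_nat; lia.
rewrite (bigD1 (Ordinal ks)) //= mulrA.
suff -> : (j%:~R - (neg_count (phi :: s))%:R + k.+1%:R : R) = 0.
  by rewrite !mul0r mulr0 ?mul0r.
have : (k.+1%:Z)%:~R = ((neg_count (phi :: s))%:Z - j)%:~R :> R.
  by congr (_%:~R); rewrite -addn1 PoszD kE; ring.
rewrite intrB -!pmulrn => ->; ring.
Qed.

Lemma prod_succ n : \prod_(k < n) k.+1%:R = n`!%:R :> R.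
Proof.
elim: n => [|n IH]; first by rewrite big_ord0.
by rewrite big_ord_recr /= IH factS natrM mulrC.
Qed.

Lemma count_rho_pos s : s != [::] -> neg_count s = 0%N -> count_rho s 0 = 1.
Proof.
case: s => // phi s _ q0; rewrite /count_rho q0 expr0 mul1r /=.
under eq_bigr do rewrite subrr add0r.
by rewrite prod_succ mulfV// pnatr_eq0 -lt0n fact_gt0.
Qed.

Lemma count_rho_neg s : s != [::] -> neg_count s = size s -> count_rho s 0 = -1.
Proof.
case: s => // phi s _ q0; rewrite /count_rho q0 /=.
have -> : \prod_(k < size s) (0 - (size s).+1%:R + k.+1%:R) =
    (-1) ^+ size s * (size s)`!%:R :> R.
  rewrite (reindex_inj rev_ord_inj) /=.
  rewrite (eq_bigr (fun k : 'I_(size s) => -1 * (k.+1%:R : R))); last first.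
    move=> k _; rewrite subnSK// natrB 1?ltnW// -(natr1 (size s)) -(natr1 k).
    by ring.
  rewrite big_split /= big_const_ord iter_mulr_1 prod_succ.
  by [].
rewrite -mulrA mulfV ?pnatr_eq0 -?lt0n ?fact_gt0// mulr1 exprS mulN1r mulNr.
by rewrite -expr2 sqrr_sign.
Qed.

Definition count_residue := residue_poly 1 count_rho.

Lemma is_line_poly_count_residue s : is_line_poly (count_residue s).
Proof.
apply: is_line_poly_residue => s'; rewrite /count_rho; case: s' => [|phi s'].
  exact: is_line_poly_cst.
apply: is_line_polyM; first exact: is_line_poly_cst.
apply: is_line_polyM; last exact: is_line_poly_cst.
apply: is_line_poly_prod => k; apply: is_line_polyD; last exact: is_line_poly_cst.
apply: is_line_polyD; last exact: is_line_poly_cst.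
by exists 1%N; exact: line_poly_pairing.
Qed.

Lemma count_residue_diff phi s a : (forall x, x \in phi :: s -> unit_lev x) ->
  count_residue (phi :: s) a - count_residue (phi :: s) (a - phi) =
  count_residue s a.
Proof.
move=> us; rewrite /count_residue /residue_poly -sumrB; apply: eq_bigr => m _.
rewrite -mulrBr; congr (_ * _).
apply: (symbol_diff (P := unit_lev) (val := fun s' a => count_rho s' (lev a))) => //.
  by move=> s1 s2 a' p; rewrite (count_rho_perm _ p).
move=> psi s' a' h; rewrite {2}/lev pairingBl -/(lev a') -/(lev psi).
by rewrite count_rho_diff//; exact: h (mem_head _ _).
Qed.

Lemma count_residue_eq0 s a (j : int) : lev a = j%:~R ->
  1 - ((size s)%:Z - (neg_count s)%:Z) <= j -> j <= (neg_count s)%:Z - 1 ->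
  count_residue s a = 0.
Proof.
move=> la h1 h2; rewrite /count_residue /residue_poly big1 // => m _.
rewrite (@symbol_ind _ _ (fun s => 1 - ((size s)%:Z - (neg_count s)%:Z) <= j /\
  j <= (neg_count s)%:Z - 1)) ?mulr0//; last first.
  by move=> s' [? ?]; rewrite la count_rho_eq0.
move=> phi s' _ /=; rewrite /neg_count /=.
have := count_size (fun phi => lev phi < 0) s'.
set q := count _ _; set n := size s'; case: (lev phi < 0) => /= qn; lia.
Qed.

Lemma count_residue_pos s a : s != [::] -> neg_count s = 0%N -> lev a = 0 ->
  count_residue s a = mpoly_eval Q a.
Proof.
move=> s0 q0 la; rewrite mpoly_evalE; apply: eq_bigr => m _; congr (_ * _).
rewrite (@symbol_stationary _ _ (fun s => s != [::] /\ neg_count s = 0%N) _ _ _ _ 1).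
- by rewrite mul1r.
- move=> phi s' ps [_ q]; split=> //; rewrite /neg_count /= -/(neg_count s') q addn0.
  move/eqP: q; rewrite -leqn0 leqNgt -has_count => /hasPn/(_ _ ps)/=.
  by case: ltP.
- by move=> s' [? ?]; rewrite la count_rho_pos.
- by [].
Qed.

Lemma count_residue_neg s a : s != [::] -> neg_count s = size s -> lev a = 0 ->
  count_residue s a = - mpoly_eval Q a.
Proof.
move=> s0 q0 la; rewrite mpoly_evalE -mulN1r mulr_sumr; apply: eq_bigr => m _.
rewrite mulrCA; congr (_ * _).
apply: (@symbol_stationary _ _ (fun s => s != [::] /\ neg_count s = size s)) => //.
- move=> phi s' ps [_ /eqP]; rewrite /neg_count -all_count => /allP q.
  split => //=; rewrite q//= add1n; congr _.+1; apply/eqP; rewrite -all_count.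
  exact/allP.
- by move=> s' [? ?]; rewrite la count_rho_neg.
Qed.

End Residue.

(** * The crossing formula for lattice points *)

Section CountCrossing.
Variables (R : realType) (r : nat) (E : 'cV[R]_r) (Q : mpoly.mpoly r R).
Notation V := ('rV[R]_r).
Implicit Types (a phi : V) (s : seq V).

Let lev a := pairing a E.
Let D := count_residue E Q.
Let q s := neg_count E s.

Hypothesis E_dual : dual_lattice E.

Definition wall_proj phi a := a - (lev a / lev phi) *: phi.

Lemma lev_wall_proj phi a : lev phi != 0 -> lev (wall_proj phi a) = 0.
Proof.
move=> p0; rewrite /lev /wall_proj pairingBl pairingZl -/(lev a) -/(lev phi).
by rewrite divfK// subrr.
Qed.

Lemma wall_proj_shift phi a (t : R) : lev phi != 0 ->
  wall_proj phi (a - t *: phi) = wall_proj phi a.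
Proof.
move=> p0; rewrite /wall_proj /lev pairingBl pairingZl -/(lev a) -/(lev phi).
by rewrite mulrBl mulfK// scalerBl opprB addrA subrK.
Qed.

Lemma wall_proj_near phi a w0 (L eps S : R) : off_wall E phi -> `|phi| <= S ->
  lev w0 = 0 -> `|a - L *: w0| < L * (eps / (1 + l1norm E * S)) ->
  `|wall_proj phi a - L *: w0| < L * eps.
Proof.
move=> [_ lp] pS lw0; set K := l1norm E; set b := a - L *: w0 => nb.
have K0 : 0 <= K := l1norm_ge0 E.
have S0 : 0 <= S by rewrite (le_trans _ pS).
have lb : lev a = lev b.
  by rewrite /b /lev pairingBl pairingZl -/(lev w0) lw0 mulr0 subr0.
have c0 : 0 < 1 + K * S by have := mulr_ge0 K0 S0; lra.
rewrite -/(lev phi) in lp.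
have lphi : 1 <= `|lev phi| by rewrite ler_normr; case: lp => lp; apply/orP; [right|left]; move: lp; lra.
have -> : wall_proj phi a - L *: w0 = b - (lev b / lev phi) *: phi.
  by rewrite /wall_proj lb /b addrAC.
apply: (@le_lt_trans _ _ (`|b| * (1 + K * S))); last first.
  by move: nb; rewrite mulrA ltr_pdivlMr.
rewrite (le_trans (ler_normB _ _))// mulrDr mulr1 lerD2l normrZ mulrA.
apply: ler_pM => //; rewrite normf_div ler_pdivrMr; last by lra.
rewrite (le_trans (pairing_le _ _))// mulrC -/K ler_peMr//.
exact: mulr_ge0.
Qed.

(** The polynomial D s is cut off at level q, the number of vectors of negative
    level. With p the number of vectors of positive level, D s vanishes on the
    integral levels from 1 - p to q - 1, so that the cut may be moved across
    them; this is why finite differences commute with the cut. *)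
Let H s a := if `[< Zpoints a >] && ((q s)%:R <= lev a) then D s a else 0.

Let unit_off phi := Zpoints phi /\ unit_lev E phi.

Lemma int_lev a : Zpoints a -> exists j : int, lev a = j%:~R.
Proof. by move=> /E_dual /intrP[j jE]; exists j. Qed.

Lemma Zpoints_diffE phi a : Zpoints phi -> Zpoints (a - phi) <-> Zpoints a.
Proof.
move=> Zp; split=> Za; last exact: ZpointsB.
by rewrite -[a](subrK phi); exact: ZpointsD.
Qed.

Lemma sum_from_diff phi s a : s != [::] ->
  (forall x, x \in phi :: s -> unit_off x) ->
  H (phi :: s) a - H (phi :: s) (a - phi) = H s a.
Proof.
move=> s0 us; have [Zphi uphi] := us _ (mem_head _ _).
rewrite /H; case: (asboolP (Zpoints a)) => Za; last first.
  by rewrite asboolF ?subr0// => /(Zpoints_diffE _ Zphi).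
rewrite asboolT ?andTb; last exact/(Zpoints_diffE _ Zphi).
have [j jE] := int_lev Za.
have dD : D (phi :: s) a - D (phi :: s) (a - phi) = D s a.
  by apply: count_residue_diff => x /us [].
have qn : (q s <= size s)%N by exact: count_size.
have n0 : (0 < size s)%N by case: (s) s0.
have l2 : lev (a - phi) = lev a - lev phi by rewrite /lev pairingBl.
have z1 : 1 - ((size (phi :: s))%:Z - (q (phi :: s))%:Z) <= j ->
    j <= (q (phi :: s))%:Z - 1 -> D (phi :: s) a = 0.
  by apply: count_residue_eq0; exact: jE.
have z2 (i : int) : lev phi = i%:~R -> 1 - ((size (phi :: s))%:Z - (q (phi :: s))%:Z) <= j - i ->
    j - i <= (q (phi :: s))%:Z - 1 -> D (phi :: s) (a - phi) = 0.
  by move=> iE; apply: count_residue_eq0; rewrite -/(lev _) l2 jE iE intrB.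
have qz (k : nat) (i : int) : (k%:R <= i%:~R :> R) = (k%:Z <= i).
  by rewrite pmulrn ler_int.
case: uphi => uE; rewrite -/(lev phi) in uE.
  have qE : q (phi :: s) = q s by rewrite /q /neg_count /= -/(lev phi) uE ltr10.
  rewrite (_ : lev (a - phi) = (j - 1)%:~R); last by rewrite l2 uE jE intrB.
  rewrite jE qE !qz.
  move: dD (z1) (z2 1 uE); rewrite qE /= => <-.
  case: (lerP (q s)%:Z j) => h1; case: (lerP (q s)%:Z (j - 1)) => h2 //; try lia.
    move=> _ ->; rewrite ?subr0//; lia.
  by move=> _ _; rewrite subrr.
have qE : q (phi :: s) = (q s).+1 by rewrite /q /neg_count /= -/(lev phi) uE ltrN10 add1n.
rewrite (_ : lev (a - phi) = (j - - 1)%:~R); last by rewrite l2 uE jE intrB.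
rewrite jE qE !qz.
move: dD (z1) (z2 (-1) uE); rewrite qE /= => <-.
case: (lerP (q s)%:Z j) => h1; case: (lerP (q s).+1%:Z (j - - 1)) => h2; try lia;
  case: (lerP (q s).+1%:Z j) => h3 //; try lia.
- by move=> -> //; lia.
- by move=> _ _; rewrite subrr.
Qed.

Definition sum_avg (h : nat) phi (g : V -> R) a := \sum_(i < h) g (a - i%:R *: phi).

Lemma diff_telescope (g G : V -> R) phi (h : nat) a :
  (forall b, G b - G (b - phi) = g b) ->
  G a - G (a - h%:R *: phi) = sum_avg h phi g a.
Proof.
move=> dG; rewrite /sum_avg; elim: h => [|h IH]; first by rewrite big_ord0 scale0r subr0 subrr.
rewrite big_ord_recr /= -IH -dG.
have -> : a - h.+1%:R *: phi = a - h%:R *: phi - phi.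
  by rewrite -[h.+1%:R]natr1 scalerDl scale1r opprD addrA.
by rewrite [RHS]addrA subrK.
Qed.

(** Both F s and the cut-off polynomial H s satisfy the same difference
    equations. Their difference is, on single vectors, locally constant along
    the vector: it is then annihilated near w0 by iterated differences, while
    it agrees with P1 - D s above the wall and with P2 below it. *)
Theorem count_crossing (F : seq V -> V -> R) (s : seq V) (P1 P2 : V -> R)
    (w0 v : V) (eps : R) :
  s != [::] -> (forall phi, phi \in s -> unit_off phi) ->
  (forall phi s' a, (forall x, x \in phi :: s' -> x \in s) ->
     F (phi :: s') a - F (phi :: s') (a - phi) = F s' a) ->
  (forall phi a, phi \in s -> F [:: phi] a =
     if `[< Zpoints a >] && (0 <= lev a / lev phi)
     then F [::] (wall_proj phi a) else 0) ->
  lev w0 = 0 -> 0 < eps -> lev v = 1 ->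
  (forall (L : R) w, 0 < L -> Zpoints w -> lev w = 0 ->
     `|w - L *: w0| < L * eps -> F [::] w = mpoly_eval Q w) ->
  (forall (L : R) a, 0 < L -> Zpoints a -> `|a - L *: w0| < L * eps ->
     0 < lev a -> F s a = P1 a) ->
  (forall (L : R) a, 0 < L -> Zpoints a -> `|a - L *: w0| < L * eps ->
     lev a < 0 -> F s a = P2 a) ->
  is_line_poly P1 -> is_line_poly P2 ->
  forall a, P1 a - P2 a = count_residue E Q s a.
Proof.
move=> s0 us F_diff F_single lw0 eps0 lv F_nil F1 F2 lp1 lp2 a.
set K := l1norm E; have K0 : 0 <= K := l1norm_ge0 E.
set S := total_norm s; have S0 : 0 <= S := total_norm_ge0 s.
have nS phi : phi \in s -> `|phi| <= S.
  by move=> ps; rewrite /S /total_norm (big_rem phi)//= lerDl sumr_ge0.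
have KS : 1 <= 1 + K * S by rewrite lerDl mulr_ge0.
have off phi : phi \in s -> off_wall E phi.
  by move=> /us[Zp up]; split => //; case: up => ->; [right|left].
have ln0 phi : phi \in s -> lev phi != 0.
  by move=> /us[_ []]; rewrite -/(lev phi) => ->; rewrite ?oppr_eq0 oner_eq0.
pose e := eps / (1 + K * S).
have e0 : 0 < e by rewrite divr_gt0//; lra.
have ee : e <= eps by rewrite ler_pdivrMr ?ler_peMr//; lra.
have nearW (L : R) b : 0 < L -> `|b - L *: w0| < L * e -> `|b - L *: w0| < L * eps.
  by move=> L0 /lt_le_trans; apply; rewrite ler_pM2l.
apply/eqP; rewrite subr_eq addrC -subr_eq; apply/eqP; move: a.
apply: (polynomials_agree (F := fun a => F s a - H s a) off lw0 e0 lv) => //.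
- move=> L a L0 Za /(nearW _ _ L0) na; rewrite -/(lev a) => la; rewrite (F1 L)// /H asboolT//=.
  case: ifPn => // ql; congr (_ - _); apply/esym.
  have [j jE] := int_lev Za.
  have qn : (q s <= size s)%N by exact: count_size.
  move: la ql; rewrite jE ltr0z pmulrn ler_int -ltNge => la ql.
  by apply: (count_residue_eq0 Q jE); rewrite -/(q s); clear -qn la ql; lia.
- move=> L a L0 Za /(nearW _ _ L0) na; rewrite -/(lev a) => la; rewrite (F2 L)// /H.
  by rewrite [(_ <= lev a)]lt_geF ?andbF ?subr0// (lt_le_trans la).
- move=> L h a L0 Za.
  move=> na; apply: (@avg_iter_diff_eq0 R r h%:R (fun=> True) (sum_avg h) _ _ _
    (fun s a => F s a - H s a) (fun x => x \in s) _ _ (L *: w0) (L * e)) => //.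
  + by move=> phi psi g b _; rewrite /sum_avg -sumrB; apply: eq_bigr => i _; rewrite addrAC.
  + move=> phi g b g0; rewrite /sum_avg big1// => i _.
    by rewrite g0// ler0n ler_nat ltnW.
  + move=> phi psi s' b hs'; apply: (@diff_telescope
      (fun x => F (psi :: s') x - H (psi :: s') x)
      (fun x => F [:: phi, psi & s'] x - H [:: phi, psi & s'] x)) => x.
    rewrite -[in RHS](F_diff phi)//.
    rewrite -(@sum_from_diff phi (psi :: s'))//; last by move=> y /hs' /us.
    ring.
  + move=> phi b ps nb; have lp0 := ln0 _ ps; have [Zphi uphi] := us _ ps.
    have nb1 : `|b - L *: w0| < L * e.
      by apply: le_lt_trans nb; rewrite lerDl mulr_ge0.
    have nb2 : `|b - h%:R *: phi - L *: w0| < L * e.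
      apply: le_lt_trans nb; rewrite addrAC (le_trans (ler_normB _ _))//.
      by rewrite normrZ normr_nat.
    (* near w0, the difference is constant along phi: it is 0 or the value at
       the projection to the wall along phi *)
    suff key x : `|x - L *: w0| < L * e -> F [:: phi] x - H [:: phi] x =
        if `[< Zpoints x >] && (lev phi < 0) then mpoly_eval Q (wall_proj phi x) else 0.
      rewrite !key// wall_proj_shift//.
      have -> : `[< Zpoints (b - h%:R *: phi) >] = `[< Zpoints b >].
        apply/asbool_equiv_eq; apply: Zpoints_diffE; apply: ZpointsZ => //.
      by rewrite subrr.
    move=> nx; rewrite F_single// /H; case: asboolP => [Zx|_]; last by rewrite /= subrr.
    rewrite !andTb.
    have nw := wall_proj_near (off _ ps) (nS _ ps) lw0 nx.
    have [j jE] := int_lev Zx.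
    have Zw : Zpoints (wall_proj phi x).
      apply: ZpointsB => //; apply: ZpointsZ => //; rewrite jE.
      case: uphi => uE; rewrite -/(lev phi) in uE; rewrite uE.
        by rewrite divr1 intr_int.
      by rewrite invrN1 mulrN1 rpredN intr_int.
    have lw := lev_wall_proj x lp0.
    have Dinv (k : nat) y : D [:: phi] (y - k%:R *: phi) = D [:: phi] y.
      apply/eqP; rewrite eq_sym -subr_eq0; apply/eqP.
      rewrite (@diff_telescope (fun=> 0)) /sum_avg ?big1// => z.
      rewrite count_residue_diff; last by move=> ?; rewrite inE => /eqP->.
      rewrite /count_residue /residue_poly big1// => m _.
      rewrite (@symbol_ind _ _ (fun s => s = [::])) ?mulr0// => [? ? + s_nil|? -> //].
      by rewrite s_nil.
    have Dw : D [:: phi] x = D [:: phi] (wall_proj phi x).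
      have : exists k : int, wall_proj phi x = x - k%:~R *: phi.
        case: uphi => uE; rewrite -/(lev phi) in uE; rewrite /wall_proj jE uE.
          by exists j; rewrite divr1.
        by exists (- j); rewrite invrN1 mulrN1 intrN.
      move=> [[k|k] ->]; first by rewrite -pmulrn Dinv.
      rewrite NegzE intrN scaleNr opprK -pmulrn.
      by rewrite -(Dinv k.+1 (x + _)) addrK.
    rewrite Dw (F_nil L)//.
    case: uphi => uE; rewrite -/(lev phi) in uE.
      have qE : q [:: phi] = 0%N by rewrite /q /neg_count /= -/(lev phi) uE ltr10.
      by rewrite uE divr1 ltr10 qE /D count_residue_pos//; case: ifP; rewrite subrr.
    have qE : q [:: phi] = 1%N by rewrite /q /neg_count /= -/(lev phi) uE ltrN10.
    rewrite uE invrN1 mulrN1 oppr_ge0 ltrN10 qE /D count_residue_neg//.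
    rewrite jE lerz0 (ler_int _ 1).
    by rewrite -gtz0_ge1 ltNge; case: (j <= 0); rewrite /= ?subr0 ?sub0r ?opprK.
- apply: is_line_polyD => //; apply: is_line_poly_ext
    (is_line_polyM (is_line_poly_cst _ (-1)) (is_line_poly_count_residue E Q s)) => x.
  by rewrite mulN1r.
Qed.

End CountCrossing.

(** * The crossing formula for volumes *)

Section OneSided.
Variable R : realType.
Notation mu := (@lebesgue_measure R).
Implicit Types (G g : R -> R) (P : R -> bool).

Lemma Rintegral_derive G g (u v : R) : u <= v ->
  (forall x, is_derive x (1 : R) G (- g x)) -> continuous g ->
  \int[mu]_(x in `[u, v]) g x = G u - G v.
Proof.
move=> uv dG cg; move: uv; rewrite le_eqVlt => /predU1P[->|uv].
  by rewrite set_itv1 Rintegral_set1 subrr.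
have dGN x : is_derive x (1 : R) (- G) (g x).
  by have := is_deriveN (dG x); rewrite opprK.
have cG x : (- G) @ x --> (- G) x.
  apply: differentiable_continuous; apply/derivable1_diffP.
  by have [] := dGN x.
rewrite /Rintegral (@continuous_FTC2 _ g (- G) u v uv) /=.
- by rewrite opprK addrC.
- exact: continuous_subspaceT.
- split.
  + by move=> x _; have [] := dGN x.
  + exact: cvg_at_right_filter.
  + exact: cvg_at_left_filter.
- by move=> x _; rewrite derive1E; have [_] := dGN x.
Qed.

Lemma continuous_integrable_itv g (u v : R) : continuous g ->
  mu.-integrable `[u, v] (EFin \o g).
Proof.
move=> cg; apply: continuous_compact_integrable; first exact: segment_compact.
exact: continuous_subspaceT.
Qed.

Lemma cut_measurable P (theta : R) :
  (forall x, x != theta -> P x = (x < theta)) -> measurable [set x | P x].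
Proof.
move=> hP; have -> : [set x | P x] = [set` if P theta then `]-oo, theta] else `]-oo, theta[].
  apply/seteqP; split => x /=; have [->|xt] := eqVneq x theta.
  - by move=> ->; rewrite in_itv /= lexx.
  - by rewrite hP// => h; case: ifP => _; rewrite /= in_itv /= ?ltW.
  - by case: ifP; rewrite /= in_itv /= ?ltxx.
  - by case: ifP => _; rewrite /= in_itv /= hP// lt_neqAle xt.
by case: ifP.
Qed.

Lemma cut_integrable P (theta h : R) g : continuous g ->
  (forall x, x != theta -> P x = (x < theta)) \/
  (forall x, x != theta -> P x = (theta < x)) ->
  mu.-integrable `[0, h] (EFin \o (fun x => if P x then g x else 0)).
Proof.
move=> cg hP.
have mP : measurable [set x | P x].
  case: hP => [/cut_measurable//|hP].
  rewrite (_ : [set x | P x] = ~` [set x | ~~ P x]); last first.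
    by apply/seteqP; split => x /=; case: (P x).
  apply: measurableC; apply: (@cut_measurable (fun x => ~~ P x) theta) => x xt.
  by rewrite hP// -leNgt le_eqVlt (negbTE xt).
have -> : EFin \o (fun x => if P x then g x else 0) = (EFin \o g) \_ [set x | P x].
  apply/funext => x; rewrite /patch /=.
  by rewrite (_ : (x \in _) = P x); [case: (P x)|apply/idP/idP; rewrite inE].
apply/integrable_restrict => //.
apply: integrableS (continuous_integrable_itv 0 h cg) => //.
by apply: measurableI.
Qed.

(** A function that is differentiable, vanishes at theta and is cut off on one
    side of theta remains the primitive of its derivative, cut off likewise. *)
Lemma Rintegral_cut P (theta h : R) G g : 0 <= h ->
  (forall x, is_derive x (1 : R) G (- g x)) -> continuous g -> G theta = 0 ->
  (forall x, x != theta -> P x = (x < theta)) \/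
  (forall x, x != theta -> P x = (theta < x)) ->
  \int[mu]_(x in `[0, h]) (if P x then g x else 0) =
  (if P 0 then G 0 else 0) - (if P h then G h else 0).
Proof.
move=> h0 dG cg Gt.
wlog: P / forall x, x != theta -> P x = (x < theta).
  move=> wl; case => hP; first by apply: wl => //; left.
  have hN x : x != theta -> ~~ P x = (x < theta).
    by move=> xt; rewrite hP// -leNgt le_eqVlt (negbTE xt).
  have := wl (fun x => ~~ P x) hN (or_introl hN).
  have -> : \int[mu]_(x in `[0, h]) (if P x then g x else 0) =
            \int[mu]_(x in `[0, h]) (g x - (if ~~ P x then g x else 0)).
    by apply: eq_Rintegral => x _; case: (P x); rewrite ?subr0 ?subrr.
  rewrite RintegralB//; last 2 first.
  - exact: continuous_integrable_itv.
  - by apply: (@cut_integrable (fun x => ~~ P x) theta) => //; left.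
  move=> ->; rewrite (Rintegral_derive h0 dG cg).
  by case: (P 0); case: (P h) => /=; ring.
move=> hP _.
have mP := cut_measurable hP.
have -> : \int[mu]_(x in `[0, h]) (if P x then g x else 0) =
          \int[mu]_(x in `[0, h] `&` [set x | P x]) g x.
  rewrite Rintegral_mkcondr; apply: eq_Rintegral => x _.
  by rewrite /patch (_ : (x \in _) = P x)//; apply/idP/idP; rewrite inE.
have [tlt0|tgt0|t0] := ltgtP theta 0.
- have nP x : 0 <= x -> P x = false.
    move=> x0; rewrite hP; last by rewrite gt_eqF// (lt_le_trans tlt0).
    by apply/negbTE; rewrite -leNgt (le_trans _ x0)// ltW.
  rewrite !nP//= subrr (_ : _ `&` _ = set0) ?Rintegral_set0//.
  apply/seteqP; split => x //=; rewrite in_itv /= => -[/andP[x0 _]].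
  by rewrite nP.
- have P0 : P 0 by rewrite hP ?lt_eqF.
  rewrite P0; have [ht|ht] := ltP h theta.
    rewrite [P h]hP ?ht ?lt_eqF// -(Rintegral_derive h0 dG cg).
    congr Rintegral; apply/seteqP; split => x /=; first by case.
    rewrite in_itv /= => /andP[x0 xh]; rewrite x0 xh; split => //.
    by have xt := le_lt_trans xh ht; rewrite hP ?lt_eqF.
  have -> : (if P h then G h else 0) = 0.
    have [hE|ne] := eqVneq h theta; last by rewrite hP// ltNge ht.
    by rewrite hE Gt if_same.
  rewrite [RHS](_ : _ = G 0 - G theta); last by rewrite Gt.
  rewrite -(Rintegral_derive (ltW tgt0) dG cg).
  have [Pt|Pt] := boolP (P theta).
    congr Rintegral; apply/seteqP; split => x /=; rewrite !in_itv /=.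
      move=> [/andP[-> _]]; have [->|xt] := eqVneq x theta; first by rewrite lexx.
      by rewrite hP//= => /ltW.
    move=> /andP[x0 xt]; rewrite x0 (le_trans xt ht); split=> //.
    have [->//|ne] := eqVneq x theta.
    by rewrite hP// lt_neqAle ne.
  rewrite -Rintegral_itv_bndo_bndc; last first.
    apply: integrableS (continuous_integrable_itv 0 theta cg) => //.
    by apply: subset_itvl; rewrite bnd_simp.
  congr Rintegral; apply/seteqP; split => x /=; rewrite !in_itv /=.
    move=> [/andP[-> _]]; have [->|xt] := eqVneq x theta.
      by rewrite (negbTE Pt).
    by rewrite hP.
  move=> /andP[x0 xt]; rewrite x0 (le_trans (ltW xt) ht); split=> //.
  by rewrite hP// lt_eqF.
- have -> : (if P 0 then G 0 else 0) = 0 by rewrite -[in G 0]t0 Gt if_same.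
  have -> : (if P h then G h else 0) = 0.
    have [hE|hn0] := eqVneq h theta; first by rewrite hE Gt if_same.
    by rewrite hP// ltNge t0 h0.
  rewrite subrr; have [P0|P0] := boolP (P 0).
    rewrite (_ : _ `&` _ = [set 0]) ?Rintegral_set1//.
    apply/seteqP; split => x /=; rewrite in_itv /=; last by move=> ->; rewrite lexx.
    move=> [/andP[x0 _]]; have [//|xn0] := eqVneq x 0.
    by rewrite hP ?t0// ltNge x0.
  rewrite (_ : _ `&` _ = set0) ?Rintegral_set0//.
  apply/seteqP; split => x //=; rewrite in_itv /= => -[/andP[x0 _]].
  have [->|xn0] := eqVneq x 0; first by rewrite (negbTE P0).
  by rewrite hP ?t0// ltNge x0.
Qed.

End OneSided.

Section VolResidue.
Variables (R : realType) (r : nat) (E : 'cV[R]_r) (Q : mpoly.mpoly r R).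
Notation V := ('rV[R]_r).
Implicit Types (a phi : V) (s : seq V) (w : seq 'I_r).

Let lev a := pairing a E.

(** The residue at 0 of e^(l z) / prod_(phi <- s) (<phi,E> z). *)
Definition vol_rho s (l : R) : R :=
  if s is [::] then 0 else
  l ^+ (size s).-1 / ((size s).-1`!%:R * \prod_(phi <- s) lev phi).

Definition vol_residue := residue_poly E Q 0 vol_rho.

Lemma vol_rho_perm s1 s2 l : perm_eq s1 s2 -> vol_rho s1 l = vol_rho s2 l.
Proof.
move=> p; rewrite /vol_rho (perm_size p) (perm_big _ p).
by have := perm_size p; case: (s1) => [|? ?]; case: (s2).
Qed.

Lemma is_line_poly_vol_residue s : is_line_poly (vol_residue s).
Proof.
apply: is_line_poly_residue => s'; rewrite /vol_rho; case: s' => [|phi s'].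
  exact: is_line_poly_cst.
apply: is_line_polyM; last exact: is_line_poly_cst.
by apply: is_line_polyX; exists 1%N; exact: line_poly_pairing.
Qed.

Lemma vol_rho_derive phi s a (t : R) : lev phi != 0 ->
  is_derive t (1 : R) (fun t => vol_rho (phi :: s) (lev (a + t *: phi)))
            (vol_rho s (lev (a + t *: phi))).
Proof.
move=> p0; rewrite /vol_rho /=; case: s => [|psi s] /=.
  by under eq_fun do rewrite expr0; exact: is_derive_cst.
set n := size s; rewrite big_cons -[\prod_(_ <- _) _]/(\prod_(j <- psi :: s) lev j).
set c := \prod_(j <- _) _.
have dl : is_derive t (1 : R) (fun t => lev (a + t *: phi)) (lev phi).
  have -> : (fun t => lev (a + t *: phi)) = (cst (lev a) + id * cst (lev phi) : R -> R).
    by apply/funext => x; rewrite /lev pairingDl pairingZl.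
  have H := is_deriveD (is_derive_cst (lev a) t (1 : R))
    (is_deriveM (is_derive_id t (1 : R)) (is_derive_cst (lev phi) t (1 : R))).
  by apply: (is_derive_eq H); rewrite /GRing.scale /= mulr0 !add0r mulr1.
set L := (fun t => lev _) in dl *; set k := (_ * (_ * c))^-1.
have -> : (fun t => L t ^+ n.+1 * k) = (L ^+ n.+1 * cst k : R -> R).
  by apply/funext => x; rewrite !fctE.
have H := is_deriveM (is_deriveX n.+1 dl) (is_derive_cst k t (1 : R)).
apply: (is_derive_eq H); rewrite {H} /GRing.scale /= mulr0 add0r /k /L.
rewrite factS natrM -[_ *+ _]mulr_natr.
have fn : n`!%:R != 0 :> R by rewrite pnatr_eq0 -lt0n fact_gt0.
have nn : n.+1%:R != 0 :> R by rewrite pnatr_eq0.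
have [->|c0] := eqVneq c 0; first by rewrite !mulr0 invr0 !mulr0 mul0r.
by field; rewrite c0 fn p0 nat1r nn.
Qed.

Lemma vol_residue_derive phi s a (t : R) : (forall x, x \in phi :: s -> lev x != 0) ->
  is_derive t (1 : R) (fun t => vol_residue (phi :: s) (a + t *: phi))
            (vol_residue s (a + t *: phi)).
Proof.
move=> hs; rewrite /vol_residue /residue_poly.
pose T s' t m := symbol 0 (a + t *: phi) (fun s => vol_rho s (lev (a + t *: phi)))
  (deriv_word m) s'.
apply: (@is_derive_bigsum R _ _ (fun m t => mpoly.mcoeff m Q * T (phi :: s) t m)
  (fun m => mpoly.mcoeff m Q * T s t m)) => m.
suff dT : is_derive t (1 : R) (T (phi :: s) ^~ m) (T s t m).
  exact: (is_deriveZ (mpoly.mcoeff m Q) dT).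
apply: (symbol_derive (P := fun x => lev x != 0)
   (val := fun s a => vol_rho s (lev a))) => //.
  by move=> s1 s2 a' p; rewrite (vol_rho_perm _ p).
by move=> psi s' a' t' h; apply: vol_rho_derive; apply: h (mem_head _ _).
Qed.

Lemma vol_residue_eq0 s a : (1 < size s)%N -> lev a = 0 -> vol_residue s a = 0.
Proof.
move=> s1 la; rewrite /vol_residue /residue_poly big1 // => m _.
rewrite (@symbol_ind _ _ (fun s => 1 < size s)%N) ?mulr0//; first by move=> ? [].
by move=> [|? [|? s']]//= _; rewrite -/(lev a) la /vol_rho /= expr0n /= mul0r.
Qed.

Lemma vol_residue_nil a : vol_residue [::] a = 0.
Proof.
rewrite /vol_residue /residue_poly big1// => m _.
rewrite (@symbol_ind _ _ (fun s => s = [::])) ?mulr0// => [? ? + s_nil|? -> //].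
by rewrite s_nil.
Qed.

Lemma vol_residue_single phi a : lev a = 0 ->
  vol_residue [:: phi] a = mpoly_eval Q a / lev phi.
Proof.
move=> la; rewrite mpoly_evalE mulr_suml; apply: eq_bigr => m _.
rewrite -mulrA; congr (_ * _); rewrite mulrC.
apply: symbol_single; first by rewrite /vol_rho /= big_seq1 expr0 mul1r mul1r.
by move=> [|? [|? s']]//= _; rewrite -/(lev a) la /vol_rho /= expr0n /= mul0r.
Qed.

End VolResidue.

Section VolCrossing.
Variables (R : realType) (r : nat) (E : 'cV[R]_r) (Q : mpoly.mpoly r R).
Notation V := ('rV[R]_r).
Notation mu := (@lebesgue_measure R).
Implicit Types (a phi : V) (s : seq V).

Let lev a := pairing a E.
Let D := vol_residue E Q.

(** For a single vector phi, the wall itself belongs to the side into which phi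
    points; for longer s this choice is immaterial, D s being zero there. *)
Let above s a := (0 < lev a) || ((lev a == 0) && (neg_count E s == 0)%N).
Let H s a := if above s a then D s a else 0.

(** Integrability on all segments of length h; it is preserved by
    translations. *)
Definition line_integrable (h : R) (g : V -> R) := forall a phi,
  mu.-integrable `[0, h] (EFin \o (fun x => g (a - x *: phi))).

Definition int_avg (h : R) phi (g : V -> R) a :=
  \int[mu]_(x in `[0, h]) g (a - x *: phi).

Lemma lev_line a phi (x : R) : lev (a - x *: phi) = lev a - x * lev phi.
Proof. by rewrite /lev pairingBl pairingZl. Qed.

Lemma above_cut s a phi : lev phi != 0 ->
  (forall x, x != lev a / lev phi -> above s (a - x *: phi) = (x < lev a / lev phi)) \/
  (forall x, x != lev a / lev phi -> above s (a - x *: phi) = (lev a / lev phi < x)).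
Proof.
move=> p0; have ne x : x != lev a / lev phi -> (lev a - x * lev phi == 0) = false.
  by move=> xt; apply: contraNF xt; rewrite subr_eq0 => /eqP->; rewrite mulfK.
have [lp|lp] := ltP (lev phi) 0.
  right=> x xt; rewrite /above lev_line ne//= orbF.
  by rewrite ltr_ndivrMr// subr_gt0.
left=> x xt; rewrite /above lev_line ne//= orbF.
by rewrite ltr_pdivlMr ?subr_gt0// lt_neqAle eq_sym p0.
Qed.

Lemma line_poly_continuous (g : V -> R) a phi : is_line_poly g ->
  continuous (fun x : R => g (a - x *: phi)).
Proof.
move=> [d /(_ a (- phi)) [q [_ hq]]] x.
have -> : (fun x => g (a - x *: phi)) = horner q.
  by apply/funext => y; rewrite -hq scalerN.
exact: continuous_horner.
Qed.

Lemma line_integrable_H (h : R) s : 0 <= h -> line_integrable h (H s).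
Proof.
move=> h0 a phi; rewrite /H.
have cD := @line_poly_continuous _ a phi (is_line_poly_vol_residue E Q s).
have [p0|p0] := eqVneq (lev phi) 0; last first.
  apply: (cut_integrable (P := fun x => above s (a - x *: phi)) _ cD).
  exact: above_cut.
have eq_above x : above s (a - x *: phi) = above s a.
  by rewrite /above lev_line p0 mulr0 subr0.
rewrite (_ : (fun x => _) = if above s a then (fun x => D s (a - x *: phi)) else cst 0).
  case: ifP => _; first exact: continuous_integrable_itv.
  by apply: continuous_integrable_itv => x; exact: cvg_cst.
by apply/funext => x; rewrite eq_above; case: ifP.
Qed.

Lemma H_step (h : R) phi psi s a : 0 <= h ->
  (forall x, x \in [:: phi, psi & s] -> lev x != 0) ->
  H [:: phi, psi & s] a - H [:: phi, psi & s] (a - h *: phi) =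
  int_avg h phi (H (psi :: s)) a.
Proof.
move=> h0 hs; have p0 := hs _ (mem_head _ _).
pose G x := D [:: phi, psi & s] (a - x *: phi).
have Gt : G (lev a / lev phi) = 0.
  by apply: vol_residue_eq0 => //; rewrite -/(lev _) lev_line divfK ?subrr.
have dG x : is_derive x (1 : R) G (- D (psi :: s) (a - x *: phi)).
  have H1 := vol_residue_derive Q a (- x) hs.
  have HN : is_derive x (1 : R) (-%R : R -> R) (- 1).
    by have := is_deriveN (is_derive_id x (1 : R)).
  have H2 := @is_derive1_comp R _ (-%R) x _ _ H1 HN.
  rewrite (_ : G = (fun t => vol_residue E Q [:: phi, psi & s] (a + t *: phi)) \o -%R).
    by apply: (is_derive_eq H2); rewrite mulrN1 scaleNr.
  by apply/funext => y; rewrite /G /= scaleNr.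
have := Rintegral_cut h0 dG (@line_poly_continuous _ a phi
  (is_line_poly_vol_residue E Q (psi :: s))) Gt (above_cut (psi :: s) a p0).
rewrite /int_avg -/(H _) => ->; rewrite /G scale0r subr0 /H.
(* the values at level 0 differ in whether the wall itself is included, but
   there the residue vanishes *)
suff key b : (if above [:: phi, psi & s] b then D [:: phi, psi & s] b else 0) =
  (if above (psi :: s) b then D [:: phi, psi & s] b else 0) by rewrite !key.
have [l0|l0] := eqVneq (lev b) 0; last by rewrite /above (negbTE l0) !andFb.
by rewrite /D vol_residue_eq0// !if_same.
Qed.

(** The same argument with integrals along the vectors in the place of sums:
    F s minus the cut-off polynomial H s is annihilated near w0 by iterated
    differences, and agrees with P1 - D s above the wall and with P2 below. *)
Theorem vol_crossing (F : seq V -> V -> R) (s : seq V) (P1 P2 : V -> R)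
    (w0 v : V) (eps : R) :
  s != [::] -> (forall phi, phi \in s -> off_wall E phi) ->
  (forall h phi s', 0 <= h -> (forall x, x \in phi :: s' -> x \in s) ->
     line_integrable h (F (phi :: s'))) ->
  (forall h phi psi s' a, 0 <= h -> (forall x, x \in [:: phi, psi & s'] -> x \in s) ->
     F [:: phi, psi & s'] a - F [:: phi, psi & s'] (a - h *: phi) =
     int_avg h phi (F (psi :: s')) a) ->
  (forall phi a, phi \in s -> F [:: phi] a =
     if 0 <= lev a / lev phi then F [::] (wall_proj E phi a) / `|lev phi| else 0) ->
  lev w0 = 0 -> 0 < eps -> lev v = 1 ->
  (forall (L : R) w, 0 < L -> lev w = 0 ->
     `|w - L *: w0| < L * eps -> F [::] w = mpoly_eval Q w) ->
  (forall (L : R) a, 0 < L -> `|a - L *: w0| < L * eps -> 0 < lev a ->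
     F s a = P1 a) ->
  (forall (L : R) a, 0 < L -> `|a - L *: w0| < L * eps -> lev a < 0 ->
     F s a = P2 a) ->
  is_line_poly P1 -> is_line_poly P2 ->
  forall a, P1 a - P2 a = vol_residue E Q s a.
Proof.
move=> s0 off F_int F_step F_single lw0 eps0 lv F_nil F1 F2 lp1 lp2 a.
set K := l1norm E; have K0 : 0 <= K := l1norm_ge0 E.
set S := total_norm s; have S0 : 0 <= S := total_norm_ge0 s.
have nS phi : phi \in s -> `|phi| <= S.
  by move=> ps; rewrite /S /total_norm (big_rem phi)//= lerDl sumr_ge0.
have KS : 1 <= 1 + K * S by rewrite lerDl mulr_ge0.
have ln0 phi : phi \in s -> lev phi != 0.
  by move=> /off[_]; rewrite -/(lev phi) => -[] ?; [rewrite lt_eqF|rewrite gt_eqF] => //; lra.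
pose e := eps / (1 + K * S).
have e0 : 0 < e by rewrite divr_gt0//; lra.
have ee : e <= eps by rewrite ler_pdivrMr ?ler_peMr//; lra.
have nearW (L : R) b : 0 < L -> `|b - L *: w0| < L * e -> `|b - L *: w0| < L * eps.
  by move=> L0 /lt_le_trans; apply; rewrite ler_pM2l.
apply/eqP; rewrite subr_eq addrC -subr_eq; apply/eqP; move: a.
apply: (polynomials_agree (F := fun a => F s a - H s a) off lw0 e0 lv) => //.
- move=> L a L0 Za /(nearW _ _ L0) na; rewrite -/(lev a) => la.
  by rewrite (F1 L)// /H /above la.
- move=> L a L0 Za /(nearW _ _ L0) na; rewrite -/(lev a) => la.
  by rewrite (F2 L)// /H /above lt_eqF// lt_gtF//= subr0.
- move=> L h a L0 Za na.
  have h0 : 0 <= h%:R :> R by [].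
  apply: (@avg_iter_diff_eq0 R r h%:R (line_integrable h%:R) (int_avg h%:R) _ _ _
    (fun s a => F s a - H s a) (fun x => x \in s) _ _ (L *: w0) (L * e)) => //.
  + move=> g psi ig b phi.
    have := integrableB _ (ig b phi) (ig (b - h%:R *: psi) phi).
    move=> /(_ (measurable_itv _)); apply: eq_integrable => //= x _.
    by rewrite /= EFinB addrAC.
  + move=> phi psi g b ig; rewrite /int_avg.
    rewrite -RintegralB//.
    by apply: eq_Rintegral => x _; rewrite addrAC.
  + move=> phi g b g0; rewrite /int_avg (@eq_Rintegral _ _ _ _ _ (cst 0)).
      by rewrite Rintegral_cst// mul0r.
    by move=> x; rewrite inE /= in_itv /= => xh; rewrite g0.
  + move=> phi s' hs' b psi.
    have := integrableB _ (F_int _ _ _ h0 hs' b psi) (line_integrable_H (phi :: s') h0 b psi).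
    by move=> /(_ (measurable_itv _)); apply: eq_integrable.
  + move=> phi psi s' b hs'.
    have hs2 x : x \in psi :: s' -> x \in s by move=> xs; apply: hs'; rewrite inE xs orbT.
    rewrite /int_avg RintegralB//; last 2 first.
    * exact: F_int.
    * exact: line_integrable_H.
    rewrite -[X in _ = X - _]/(int_avg _ _ _ _) -F_step// -[X in _ = _ - X]/(int_avg _ _ _ _).
    rewrite -H_step//; last by move=> y /hs' /ln0.
    ring.
  + move=> phi b ps nb; have lp0 := ln0 _ ps.
    have nb1 : `|b - L *: w0| < L * e.
      by apply: le_lt_trans nb; rewrite lerDl mulr_ge0.
    have nb2 : `|b - h%:R *: phi - L *: w0| < L * e.
      apply: le_lt_trans nb; rewrite addrAC (le_trans (ler_normB _ _))//.
      by rewrite normrZ normr_nat.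
    (* near w0, the difference is constant along phi: F and H agree if phi
       points upwards; otherwise one is supported below the wall and the other
       above it, with opposite signs *)
    suff key x : `|x - L *: w0| < L * e -> F [:: phi] x - H [:: phi] x =
        if lev phi < 0 then mpoly_eval Q (wall_proj E phi x) / `|lev phi| else 0.
      by rewrite !key// wall_proj_shift// subrr.
    move=> nx; rewrite F_single//.
    have nw := wall_proj_near (off _ ps) (nS _ ps) lw0 nx.
    have lw := lev_wall_proj x lp0.
    have Dw : D [:: phi] x = D [:: phi] (wall_proj E phi x).
      have dD t : is_derive t (1 : R) (fun t => D [:: phi] (x + t *: phi)) 0.
        rewrite -(vol_residue_nil E Q (x + t *: phi)).
        by apply: vol_residue_derive => y; rewrite inE => /eqP->.
      have -> : wall_proj E phi x = x + (- (lev x / lev phi)) *: phi.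
        by rewrite /wall_proj scaleNr.
      by rewrite (is_derive_0_is_cst (- (lev x / lev phi)) 0 dD) scale0r addr0.
    rewrite (F_nil L)// /H /above Dw /D vol_residue_single//.
    rewrite /neg_count /= -/(lev phi).
    have [lp|lp] := ltP (lev phi) 0.
      rewrite ler_ndivlMr// mul0r andbF orbF ltr0_norm// leNgt.
      by case: (0 < lev x) => /=; rewrite ?subr0// sub0r invrN mulrN.
    have {}lp : 0 < lev phi by rewrite lt_neqAle eq_sym lp0.
    rewrite ler_pdivlMr// mul0r eqxx andbT gtr0_norm// le_eqVlt eq_sym orbC.
    by case: ifP; rewrite subrr.
- apply: is_line_polyD => //; apply: is_line_poly_ext
    (is_line_polyM (is_line_poly_cst _ (-1)) (is_line_poly_vol_residue E Q s)) => x.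
  by rewrite mulN1r.
Qed.

End VolCrossing.

(** * Laurent expansions *)

Section Laurent.
Variable R : realType.
Implicit Types (b c : nat -> R) (f g : R -> R) (z K : R).

(** A bound on the coefficients, rather than convergence, is what products,
    derivatives and recursive constructions preserve. *)
Definition geo_bound b K := 1 <= K /\ forall k, `|b k| <= K ^+ k.+1.

Lemma geo_boundW b K K' : K <= K' -> geo_bound b K -> geo_bound b K'.
Proof.
move=> KK' [K1 hb]; split=> [|k]; first exact: le_trans KK'.
rewrite (le_trans (hb k))// lerXn2r// nnegrE; first by lra.
by apply: le_trans KK'; lra.
Qed.

Lemma geo_bound_cvg b K z : geo_bound b K -> `|z| * K < 1 -> cvgn (pseries b z).
Proof.
move=> [K1 hb] zK; apply: normed_cvg.
apply: (@series_le_cvg _ _ (geometric K (`|z| * K))) => [n|n|n|].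
- exact: normr_ge0.
- by rewrite /= mulr_ge0 ?exprn_ge0 ?mulr_ge0//; lra.
- rewrite /= normrM normrX exprMn mulrCA -exprS mulrC.
  by rewrite ler_wpM2l// exprn_ge0.
- by apply: is_cvg_geometric_series; rewrite ger0_norm// mulr_ge0//; lra.
Qed.

Lemma geo_boundD b c K : geo_bound b K -> geo_bound c K ->
  geo_bound (fun k => b k + c k) (2 * K).
Proof.
move=> [K1 hb] [_ hc]; split=> [|k]; first by lra.
rewrite (le_trans (ler_normD _ _))// exprMn.
have hK : 0 <= K ^+ k.+1 by rewrite exprn_ge0//; lra.
have := ler_wpM2r hK (_ : 2 <= 2 ^+ k.+1 :> R).
rewrite exprS ler_peMr// ?exprn_ege1// ?ler1n// => /(_ isT).
by have := hb k; have := hc k; lra.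
Qed.

Lemma geo_boundZ b (a K : R) : geo_bound b K ->
  geo_bound (fun k => a * b k) ((1 + `|a|) * K).
Proof.
move=> [K1 hb]; have a0 := normr_ge0 a; have aK : 0 <= `|a| * K by apply: mulr_ge0 => //; lra.
split=> [|k]; first by rewrite mulrDl mul1r; lra.
rewrite normrM exprMn ler_pM//.
have a1 : 1 <= 1 + `|a| by lra.
rewrite exprS (le_trans (_ : _ <= 1 + `|a|))//; first by lra.
by rewrite ler_peMr ?exprn_ege1//; lra.
Qed.

Lemma geo_bound_shift b K : geo_bound b K ->
  geo_bound (fun k => if k is k'.+1 then b k' else 0) K.
Proof.
move=> [K1 hb]; split=> // -[|k]; first by rewrite normr0 exprn_ge0//; lra.
by rewrite (le_trans (hb k))// [leRHS]exprS ler_peMl ?exprn_ge0//; lra.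
Qed.

Lemma geo_bound_diffs b K : geo_bound b K -> geo_bound (pseries_diffs b) (2 * K ^+ 2).
Proof.
move=> [K1 hb]; have K0 : 0 <= K by lra.
have K2 : 1 <= K ^+ 2 by rewrite exprn_ege1.
split=> [|k]; first by lra.
rewrite /pseries_diffs normrM exprMn normr_nat ler_pM//.
  by rewrite -natrX ler_nat ltnW// ltn_expl.
by rewrite (le_trans (hb _))// -exprM ler_weXn2l//; lia.
Qed.

(** Only a neighbourhood of 0 matters, so that the radii here and below are far
    from optimal. *)
Lemma pseries_derive b K z : geo_bound b K -> `|z| * (8 * K ^+ 4) < 1 ->
  is_derive z (1 : R) (fun x => limn (pseries b x)) (limn (pseries (pseries_diffs b) z)).
Proof.
move=> hb; have K1 := hb.1; have K0 : 0 <= K by lra.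
have hb1 := geo_bound_diffs hb; have hb2 := geo_bound_diffs hb1.
rewrite (_ : 2 * (2 * K ^+ 2) ^+ 2 = 8 * K ^+ 4) in hb2; last first.
  by rewrite exprMn -exprM; ring.
set K4 := 8 * K ^+ 4 in hb2 *; have K41 : 1 <= K4 := hb2.1.
move=> zK.
have K24 : 2 * K ^+ 2 <= K4.
  have k2 : 1 <= K ^+ 2 by rewrite exprn_ege1.
  rewrite /K4 (_ : K ^+ 4 = K ^+ 2 * K ^+ 2); last by rewrite -exprD.
  by have := ler_peMr (_ : 0 <= K ^+ 2) k2; rewrite exprn_ge0// => /(_ isT); lra.
have K04 : K <= K4.
  have k2 : K <= K ^+ 2 by rewrite expr2 ler_peMr.
  by apply: le_trans K24; have := exprn_ge0 2 K0; lra.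
have K4p : 0 < K4 by lra.
pose x := (`|z| + K4^-1) / 2.
have z1 : `|z| < K4^-1 by rewrite -[K4^-1]mul1r ltr_pdivlMr.
have x0 : 0 <= x by rewrite /x; have := normr_ge0 z; lra.
have xK : `|x| * K4 < 1.
  by rewrite ger0_norm// -ltr_pdivlMr// div1r /x; lra.
apply: (@pseries_snd_diffs _ b x z).
- by apply: (geo_bound_cvg hb); apply: le_lt_trans xK; rewrite ler_wpM2l.
- by apply: (geo_bound_cvg hb1); apply: le_lt_trans xK; rewrite ler_wpM2l.
- exact: (geo_bound_cvg hb2).
- by rewrite [ltRHS]ger0_norm// /x; lra.
Qed.

(** ** Products of power series *)

Definition cauchy_prod b c k := \sum_(i < k.+1) b i * c (k - i)%N.

(** The gap consists of the terms with i, j < N <= i + j, fewer than N ^ 2 in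
    number. *)
Lemma cauchy_prod_gap (u v : nat -> R) N (q M : R) : 0 <= q <= 1 ->
  (forall k, `|u k| <= M * q ^+ k) -> (forall k, `|v k| <= M * q ^+ k) ->
  `|(\sum_(i < N) u i) * (\sum_(j < N) v j) - \sum_(k < N) cauchy_prod u v k| <=
  N%:R ^+ 2 * (M ^+ 2 * q ^+ N).
Proof.
move=> /andP[q0 q1] hu hv.
have M0 : 0 <= M by have := hu 0%N; rewrite expr0 mulr1; apply: le_trans.
pose V m := \sum_(j < m) v j.
have -> : \sum_(k < N) cauchy_prod u v k = \sum_(i < N) u i * V (N - i)%N.
  elim: N => [|N IH]; first by rewrite !big_ord0.
  rewrite big_ord_recr IH [RHS]big_ord_recr /cauchy_prod big_ord_recr /= addrA.
  congr (_ + _); last by rewrite subSnn subnn /V big_ord1.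
  rewrite -big_split /=; apply: eq_bigr => i _; rewrite -mulrDr.
  by rewrite subSn ?(ltnW (ltn_ord i))// /V [in RHS]big_ord_recr.
rewrite mulr_suml -sumrB; under eq_bigr do rewrite -mulrBr -/(V N).
rewrite (le_trans (ler_norm_sum _ _ _))//.
rewrite (le_trans (_ : _ <= \sum_(i < N) N%:R * (M ^+ 2 * q ^+ N)))//; last first.
  by rewrite sumr_const card_ord -[_ *+ N]mulr_natl mulrA -expr2.
apply: ler_sum => i _; have iN := ltn_ord i; rewrite normrM.
have -> : N%:R * (M ^+ 2 * q ^+ N) = (M * q ^+ i) * (N%:R * (M * q ^+ (N - i))).
  by rewrite -[in q ^+ N](subnK (ltnW iN)) exprD; ring.
apply: ler_pM => //.
have -> : V N - V (N - i)%N = \sum_(N - i <= j < N) v j.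
  rewrite /V -!(big_mkord xpredT v) (@big_cat_nat _ _ _ (N - i)%N 0%N N)//= ?leq_subr//.
  by rewrite addrAC subrr add0r.
rewrite (le_trans (ler_norm_sum _ _ _))//.
rewrite (le_trans (_ : _ <= \sum_(N - i <= j < N) M * q ^+ (N - i)))//.
  rewrite !big_nat; apply: ler_sum => j /andP[j1 j2].
  by rewrite (le_trans (hv j))// ler_wpM2l// ler_wiXn2l.
rewrite sumr_const_nat -[_ *+ _]mulr_natl ler_wpM2r ?mulr_ge0 ?exprn_ge0//.
by rewrite ler_nat leq_subr.
Qed.

Lemma sqr_geo_cvg0 (q : R) : 0 <= q -> q * 8 <= 1 ->
  (fun N : nat => N%:R ^+ 2 * q ^+ N) @ \oo --> (0 : R).
Proof.
move=> q0 q8; apply: (@squeeze_cvgr _ _ _ _ (fun=> 0) (geometric 1 2^-1)).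
- near=> N; rewrite /= mul1r; apply/andP; split; first by rewrite mulr_ge0 ?exprn_ge0.
  have N2 : N%:R <= 2 ^+ N :> R by rewrite -natrX ler_nat ltnW// ltn_expl.
  have N4 : N%:R ^+ 2 <= 4 ^+ N :> R.
    rewrite (_ : 4 = 2 ^+ 2 :> R); last by rewrite expr2; lra.
    by rewrite -exprM mulnC exprM lerXn2r// ?nnegrE ?exprn_ge0.
  apply: (@le_trans _ _ (4 ^+ N * 8^-1 ^+ N)).
    by apply: ler_pM; rewrite ?exprn_ge0// lerXn2r// ?nnegrE; lra.
  by rewrite -exprMn (_ : 4 / 8 = 2^-1 :> R)//; lra.
- exact: cvg_cst.
- by apply: cvg_geometric; rewrite ger0_norm//; lra.
Unshelve. all: by end_near. Qed.

Lemma pseries_cauchy_prod b c K z : geo_bound b K -> geo_bound c K ->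
  `|z| * K * 8 <= 1 ->
  pseries (cauchy_prod b c) z @ \oo --> limn (pseries b z) * limn (pseries c z).
Proof.
move=> hb hc zK; have K1 := hb.1; have q0 : 0 <= `|z| * K by apply: mulr_ge0 => //; lra.
have zK1 : `|z| * K < 1 by lra.
have cb := geo_bound_cvg hb zK1; have cc := geo_bound_cvg hc zK1.
pose u k := b k * z ^+ k; pose v k := c k * z ^+ k.
have gu d : geo_bound d K -> forall k, `|d k * z ^+ k| <= K * (`|z| * K) ^+ k.
  move=> [_ hd] k; rewrite normrM normrX exprMn mulrCA -exprS mulrC.
  by rewrite ler_wpM2l// exprn_ge0.
have gap N : `|pseries b z N * pseries c z N - pseries (cauchy_prod b c) z N| <=
    K ^+ 2 * (N%:R ^+ 2 * (`|z| * K) ^+ N).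
  have -> : pseries (cauchy_prod b c) z N = \sum_(k < N) cauchy_prod u v k.
    rewrite /pseries /series /= big_mkord; apply: eq_bigr => k _.
    rewrite /cauchy_prod mulr_suml; apply: eq_bigr => i _; rewrite /u /v mulrACA -exprD.
    by rewrite subnKC// -ltnS.
  rewrite {1 2}/pseries /series /= !big_mkord mulrCA.
  apply: cauchy_prod_gap; [by apply/andP; lra|exact: gu|exact: gu].
have cgap : (fun N => pseries b z N * pseries c z N -
    pseries (cauchy_prod b c) z N) @ \oo --> (0 : R).
  apply/norm_cvg0P; apply: (@squeeze_cvgr _ _ _ _ (fun=> 0)
     (fun N => K ^+ 2 * (N%:R ^+ 2 * (`|z| * K) ^+ N))).
  - by near=> N; rewrite /= normr_ge0 gap.
  - exact: cvg_cst.
  - by rewrite -(mulr0 (K ^+ 2)); 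
    exact: (cvgM (cvg_cst (K ^+ 2)) (sqr_geo_cvg0 q0 zK)).
have lim := cvgB (cvgM cb cc) cgap; rewrite subr0 in lim.
rewrite (_ : pseries (cauchy_prod b c) z = pseries b z \* pseries c z -
    (fun N => pseries b z N * pseries c z N - pseries (cauchy_prod b c) z N)).
  exact: lim.
by apply/funext => N; rewrite !fctE /= opprB addrC subrK.
Unshelve. all: by end_near. Qed.

End Laurent.

Section HasResidue.
Variable R : realType.
Implicit Types (b c : nat -> R) (f g : R -> R) (z K : R).

(** The bound on the coefficients is what makes this class stable under
    derivation. *)
Definition laurent f (m : nat) b := exists K, geo_bound b K /\
  forall z, z != 0 -> `|z| * K < 1 -> z ^+ m.+1 * f z = limn (pseries b z).

Definition has_residue f (rho : R) := exists m b, laurent f m b /\ b m = rho.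

Lemma limn_pseriesD b c K z : geo_bound b K -> geo_bound c K -> `|z| * K < 1 ->
  limn (pseries (fun k => b k + c k) z) = limn (pseries b z) + limn (pseries c z).
Proof.
move=> hb hc zK; apply/cvg_lim => //.
rewrite (_ : pseries _ z = pseries b z \+ pseries c z); last first.
  apply/funext => N; rewrite /pseries /series /= -big_split /=.
  by apply: eq_bigr => i _; rewrite mulrDl.
by apply: cvgD; [exact: (geo_bound_cvg hb)|exact: (geo_bound_cvg hc)].
Qed.

Lemma limn_pseriesZ (a : R) b K z : geo_bound b K -> `|z| * K < 1 ->
  limn (pseries (fun k => a * b k) z) = a * limn (pseries b z).
Proof.
move=> hb zK; apply/cvg_lim => //.
rewrite (_ : pseries _ z = (fun N => a * pseries b z N)); last first.
  apply/funext => N; rewrite /pseries /series /= mulr_sumr.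
  by apply: eq_bigr => i _; rewrite mulrA.
exact: (cvgM (cvg_cst a) (geo_bound_cvg hb zK)).
Qed.

Lemma limn_pseries_shift b K z : geo_bound b K -> `|z| * K < 1 ->
  limn (pseries (fun k => if k is k'.+1 then b k' else 0) z) = z * limn (pseries b z).
Proof.
move=> hb zK; apply/cvg_lim => //.
rewrite -cvg_shiftS /=.
rewrite (_ : (fun n => _) = (fun N => z * pseries b z N)); last first.
  apply/funext => N; rewrite /pseries /series /= big_nat_recl// mul0r add0r mulr_sumr.
  by apply: eq_bigr => i _; rewrite exprS mulrCA.
exact: (cvgM (cvg_cst z) (geo_bound_cvg hb zK)).
Qed.

Lemma laurent_ext f g m b (e : R) : 0 < e ->
  (forall z, z != 0 -> `|z| < e -> f z = g z) -> laurent f m b -> laurent g m b.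
Proof.
move=> e0 fg [K [hK hf]]; exists (Num.max K e^-1); split.
  by apply: geo_boundW hK; rewrite le_max lexx.
move=> z z0 zK; rewrite -fg//; last first.
  rewrite -[e]invrK -[e^-1^-1]mul1r ltr_pdivlMr ?invr_gt0//.
  by apply: le_lt_trans zK; rewrite ler_wpM2l// le_max lexx orbT.
by apply: hf => //; apply: le_lt_trans zK; rewrite ler_wpM2l// le_max lexx.
Qed.

Lemma laurent_shift f m b : laurent f m b ->
  laurent f m.+1 (fun k => if k is k'.+1 then b k' else 0).
Proof.
move=> [K [hK hf]]; exists K; split; first exact: geo_bound_shift.
move=> z z0 zK; rewrite (limn_pseries_shift hK zK) -hf// exprS; ring.
Qed.

Lemma laurentD f g m b c : laurent f m b -> laurent g m c ->
  laurent (fun z => f z + g z) m (fun k => b k + c k).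
Proof.
move=> [K [hK hf]] [L [hL hg]]; pose M := Num.max K L.
have hbM : geo_bound b M by apply: geo_boundW hK; rewrite le_max lexx.
have hcM : geo_bound c M by apply: geo_boundW hL; rewrite le_max lexx orbT.
exists (2 * M); split; first exact: geo_boundD.
have M1 := hbM.1.
move=> z z0 zM; have {}zM : `|z| * M < 1.
  by apply: le_lt_trans zM; rewrite ler_wpM2l//; lra.
rewrite (limn_pseriesD hbM hcM zM) mulrDr; congr (_ + _).
  by apply: hf => //; apply: le_lt_trans zM; rewrite ler_wpM2l// le_max lexx.
by apply: hg => //; apply: le_lt_trans zM; rewrite ler_wpM2l// le_max lexx orbT.
Qed.

Lemma laurentZ (a : R) f m b : laurent f m b ->
  laurent (fun z => a * f z) m (fun k => a * b k).
Proof.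
move=> [K [hK hf]]; have K1 := hK.1; exists ((1 + `|a|) * K).
split; first exact: geo_boundZ.
move=> z z0 zK; have {}zK : `|z| * K < 1.
  apply: le_lt_trans zK; rewrite ler_wpM2l// ler_peMl//; first by lra.
  by have := normr_ge0 a; lra.
by rewrite (limn_pseriesZ _ hK zK) mulrCA hf.
Qed.

(** At z^-1 the two terms cancel: a derivative has residue 0. *)
Lemma laurent_derive f f' m b (e : R) : 0 < e ->
  (forall z, z != 0 -> `|z| < e -> is_derive z (1 : R) f (f' z)) -> laurent f m b ->
  laurent f' m.+1 (fun k => (if k is k'.+1 then pseries_diffs b k' else 0) +
                            (- m.+1%:R) * b k).
Proof.
move=> e0 df [K [hK hf]]; have K1 := hK.1; have K0 : 0 <= K by lra.
pose M := Num.max ((1 + `|- m.+1%:R|) * K) (Num.max (8 * K ^+ 4) (Num.max (2 * K ^+ 2) e^-1)).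
have hM1 : geo_bound (fun k => if k is k'.+1 then pseries_diffs b k' else 0) M.
  apply: geo_boundW (geo_bound_shift (geo_bound_diffs hK)).
  by rewrite !le_max lexx !orbT.
have hM2 : geo_bound (fun k => - m.+1%:R * b k) M.
  by apply: geo_boundW (geo_boundZ (- m.+1%:R) hK); rewrite le_max lexx.
exists (2 * M); split; first exact: geo_boundD.
have M1 := hM1.1.
move=> z z0 zM; have {}zM : `|z| * M < 1.
  by apply: le_lt_trans zM; rewrite ler_wpM2l//; lra.
have hz L : L <= M -> `|z| * L < 1.
  by move=> LM; apply: le_lt_trans zM; rewrite ler_wpM2l.
have zK : `|z| * K < 1.
  apply: hz; rewrite le_max ler_peMl ?orTb//.
  by have := normr_ge0 (- m.+1%:R : R); lra.
have zK4 : `|z| * (8 * K ^+ 4) < 1 by apply: hz; rewrite !le_max lexx !orbT.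
have zK2 : `|z| * (2 * K ^+ 2) < 1 by apply: hz; rewrite !le_max lexx !orbT.
have ze : `|z| < e.
  rewrite -[e]invrK -[e^-1^-1]mul1r ltr_pdivlMr ?invr_gt0//.
  by apply: hz; rewrite !le_max lexx !orbT.
rewrite (limn_pseriesD hM1 hM2 zM) (limn_pseries_shift (geo_bound_diffs hK) zK2).
rewrite (limn_pseriesZ _ hK zK) -hf//.
pose P x := limn (pseries b x); pose h := (fun x : R => x ^+ m.+1) * f.
have dP : is_derive z (1 : R) P (limn (pseries (pseries_diffs b) z)).
  exact: pseries_derive hK zK4.
have dX : is_derive z (1 : R) (fun x : R => x ^+ m.+1) (m.+1%:R * z ^+ m).
  rewrite (_ : (fun x : R => _) = id ^+ m.+1); last by apply/funext => x; rewrite !fctE.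
  have H := is_deriveX m.+1 (is_derive_id z (1 : R)).
  by apply: (is_derive_eq H); rewrite /GRing.scale /= mulr1.
have dh := is_deriveM dX (df z z0 ze).
have hP : \forall x \near z, P x = h x.
  near=> x; rewrite /P /h !fctE hf//.
    by near: x; exact: (@cvgr_neq0 _ _ _ (nbhs z) _ id z (@cvg_id _ _) z0).
  rewrite -ltr_pdivlMr; last by lra.
  near: x; apply: (@cvgr_norm_lt _ _ _ (nbhs z) _ id z (@cvg_id _ _)).
  by rewrite ltr_pdivlMr; lra.
have <- : 'D_1 P z = limn (pseries (pseries_diffs b) z) by have [_] := dP.
rewrite (near_eq_derive _ hP)//; have [_ ->] := dh.
by rewrite /GRing.scale /= !exprS; ring.
Unshelve. all: by end_near. Qed.

Lemma laurent_residue0 f m b : laurent f m b -> residue0 f (b m).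
Proof.
move=> [K [hK hf]]; have K1 := hK.1; exists m, b; split => //.
have K0 : 0 < K by lra.
near=> z; rewrite hf//.
- apply: (geo_bound_cvg hK); rewrite -ltr_pdivlMr// div1r.
  near: z; apply: dnbhs0_lt; by rewrite invr_gt0.
- by near: z; exact: nbhs_dnbhs_neq.
- rewrite -ltr_pdivlMr// div1r.
  near: z; apply: dnbhs0_lt; by rewrite invr_gt0.
Unshelve. all: by end_near. Qed.

Lemma has_residue_residue0 f rho : has_residue f rho -> residue0 f rho.
Proof. by move=> [m [b [h <-]]]; exact: laurent_residue0 h. Qed.

Lemma has_residue_ext f g rho (e : R) : 0 < e ->
  (forall z, z != 0 -> `|z| < e -> f z = g z) -> has_residue f rho -> has_residue g rho.
Proof.
by move=> e0 fg [m [b [h hb]]]; exists m, b; split=> //; exact: laurent_ext e0 fg h.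
Qed.

Lemma laurent_raise f m b n : laurent f m b ->
  exists2 b', laurent f (n + m)%N b' & b' (n + m)%N = b m.
Proof.
move=> h; elim: n => [|n [b' h' e]]; first by exists b.
by exists (fun k => if k is k'.+1 then b' k' else 0) => //; exact: laurent_shift.
Qed.

Lemma has_residueD f g rho sigma : has_residue f rho -> has_residue g sigma ->
  has_residue (fun z => f z + g z) (rho + sigma).
Proof.
move=> [m [b [hf <-]]] [n [c [hg <-]]].
have [b' hb' <-] := laurent_raise n hf; have [c' hc' <-] := laurent_raise m hg.
rewrite (addnC m) in hc' *.
by exists (n + m)%N, (fun k => b' k + c' k); split=> //; exact: laurentD.
Qed.

Lemma has_residueZ (a : R) f rho : has_residue f rho ->
  has_residue (fun z => a * f z) (a * rho).
Proof.
by move=> [m [b [hf <-]]]; exists m, (fun k => a * b k); split => //; exact: laurentZ.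
Qed.

Lemma has_residue0 : has_residue (fun=> 0) 0.
Proof.
exists 0%N, (fun=> 0); split=> //; exists 1; split.
  by split=> // k; rewrite normr0 exprn_ge0.
move=> z z0 z1; rewrite mulr0; apply/esym/cvg_lim => //.
rewrite (_ : pseries _ _ = fun=> 0); first exact: cvg_cst.
by apply/funext => N; rewrite /pseries /series /= big1// => i _; rewrite mul0r.
Qed.

Lemma has_residue_sum (I : eqType) (s : seq I) (F : I -> R -> R) (rho : I -> R) :
  (forall i, i \in s -> has_residue (F i) (rho i)) ->
  has_residue (fun z => \sum_(i <- s) F i z) (\sum_(i <- s) rho i).
Proof.
elim: s => [|i s IH] h.
  by under eq_fun do rewrite big_nil; rewrite big_nil; exact: has_residue0.
under eq_fun do rewrite big_cons; rewrite big_cons; apply: has_residueD.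
  exact: h (mem_head _ _).
by apply: IH => j js; apply: h; rewrite inE js orbT.
Qed.

Lemma has_residue_bigsum (I : Type) (s : seq I) (F : I -> R -> R) (rho : I -> R) :
  (forall i, has_residue (F i) (rho i)) ->
  has_residue (fun z => \sum_(i <- s) F i z) (\sum_(i <- s) rho i).
Proof.
move=> h; elim: s => [|i s IH].
  by under eq_fun do rewrite big_nil; rewrite big_nil; exact: has_residue0.
by under eq_fun do rewrite big_cons; rewrite big_cons; exact: has_residueD.
Qed.

(** ** The residues of e^(l z) / z^n and e^(l z) / (1 - e^-z)^n *)

Definition exp_series (l : R) (k : nat) : R := l ^+ k / k`!%:R.

Lemma exp_series_bound l : geo_bound (exp_series l) (1 + `|l|).
Proof.
have l0 := normr_ge0 l; split=> [|k]; first by lra.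
rewrite /exp_series normrM normrX.
apply: (@le_trans _ _ (`|l| ^+ k)).
  rewrite ler_piMr ?exprn_ge0// normfV normr_nat invf_le1 ?ler1n ?ltr0n ?fact_gt0//.
rewrite exprS; apply: (@le_trans _ _ ((1 + `|l|) ^+ k)).
  by rewrite lerXn2r// ?nnegrE; lra.
by rewrite ler_peMl ?exprn_ge0//; lra.
Qed.

Lemma exp_seriesE l z : limn (pseries (exp_series l) z) = expR (l * z).
Proof.
rewrite /expR /pseries; congr (limn (series _)); apply/funext => k.
by rewrite /exp_series /exp_coeff /= exprMn; ring.
Qed.

Lemma has_residue_exp_pole (l : R) (n : nat) :
  has_residue (fun z => expR (l * z) / z ^+ n.+1) (l ^+ n / n`!%:R).
Proof.
exists n, (exp_series l); split => //; exists (1 + `|l|).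
split; first exact: exp_series_bound.
move=> z z0 _; rewrite exp_seriesE mulrCA mulfV ?mulr1// expf_neq0//.
Qed.

Lemma has_residue_exp (l : R) : has_residue (fun z => expR (l * z)) 0.
Proof.
exists 0%N, (fun k => if k is k'.+1 then exp_series l k' else 0); split => //.
exists (1 + `|l|); split; first exact: geo_bound_shift (exp_series_bound l).
move=> z z0 zK; rewrite (limn_pseries_shift (exp_series_bound l) zK).
by rewrite exp_seriesE expr1.
Qed.

(** Produces the coefficients of a series from an equation that determines each
    of them from the previous ones. *)
Lemma strong_recursion (T : Type) (F : nat -> (nat -> T) -> T) (t0 : T) :
  (forall n u v, (forall i, (i < n)%N -> u i = v i) -> F n u = F n v) ->
  exists d : nat -> T, forall n, d n = F n d.
Proof.
move=> hF; pose fix pre n : seq T :=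
  if n is n'.+1 then rcons (pre n') (F n' (nth t0 (pre n'))) else [::].
have sz n : size (pre n) = n by elim: n => //= n IH; rewrite size_rcons IH.
have pre_nth n i k : (i < n)%N -> nth t0 (pre (n + k)%N) i = nth t0 (pre n) i.
  move=> ni; elim: k => [|k IH]; first by rewrite addn0.
  by rewrite addnS /= nth_rcons sz (leq_trans ni (leq_addr _ _)).
exists (fun n => nth t0 (pre n.+1) n) => n.
rewrite /= nth_rcons sz ltnn eqxx; apply: hF => i ni.
by rewrite -[in LHS](subnKC ni) pre_nth.
Qed.

(** The expansion of z e^(l z) / (1 - e^-z) is obtained by solving
    D(z) e^-z = D(z) - z e^(l z) coefficient by coefficient. *)
Lemma todd_expansion (l : R) : exists2 d : nat -> R,
  d 0%N = 1 & laurent (fun z => expR (l * z) / (1 - expR (- z))) 0 d.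
Proof.
pose F n (u : nat -> R) :=
  exp_series l n - \sum_(i < n) u i * ((-1) ^+ (n - i) / (n.+1 - i)`!%:R).
have [d dE] : exists d : nat -> R, forall n, d n = F n d.
  apply: (strong_recursion 0) => n u v uv; rewrite /F; congr (_ - _).
  by apply: eq_bigr => i _; rewrite uv.
have d0 : d 0%N = 1 by rewrite dE /F big_ord0 subr0 /exp_series expr0 fact0 divr1.
exists d => //.
set L := 1 + `|l|; have l0 := normr_ge0 l; pose K := 2 * L + 1.
have K3 : 3 <= K by rewrite /K /L; lra.
have K1 : 1 <= K by lra.
have hd : geo_bound d K.
  split => //; elim/ltn_ind => n IH; rewrite dE /F (le_trans (ler_normB _ _))//.
  have h1 : `|exp_series l n| <= 2^-1 * K ^+ n.+1.
    rewrite (le_trans ((exp_series_bound l).2 n))// -/L.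
    apply: (@le_trans _ _ ((2^-1 * K) ^+ n.+1)).
      by apply: lerXn2r; rewrite ?nnegrE /K /L; lra.
    rewrite exprMn ler_wpM2r ?exprn_ge0//; first by lra.
    by rewrite exprS ler_piMr ?exprn_ile1//; lra.
  have h2 : `|\sum_(i < n) d i * ((-1) ^+ (n - i) / (n.+1 - i)`!%:R)| <=
      \sum_(i < n) K ^+ i.+1.
    rewrite (le_trans (ler_norm_sum _ _ _))//; apply: ler_sum => i _.
    rewrite normrM -[leRHS]mulr1 ler_pM// ?IH//.
    rewrite normrM normrX normrN1 expr1n mul1r normfV normr_nat.
    by rewrite invf_le1 ?ler1n ?ltr0n ?fact_gt0.
  have h3 : 2 * \sum_(i < n) K ^+ i.+1 <= K ^+ n.+1.
    elim: n {IH h1 h2} => [|n IH]; first by rewrite big_ord0 mulr0 exprn_ge0//; lra.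
    rewrite big_ord_recr /= mulrDr.
    have : 3 * K ^+ n.+1 <= K ^+ n.+2.
      by rewrite [leRHS]exprS ler_wpM2r ?exprn_ge0//; lra.
    by lra.
  by lra.
have he : geo_bound (exp_series (-1)) K.
  by apply: geo_boundW (exp_series_bound (-1)); rewrite normrN1; lra.
have hl : geo_bound (exp_series l) K.
  by apply: geo_boundW (exp_series_bound l); rewrite /K /L; lra.
have cauchyE : cauchy_prod d (exp_series (-1)) =
    (fun k => d k + (-1) * (if k is k'.+1 then exp_series l k' else 0)).
  apply/funext => -[|n]; rewrite /cauchy_prod.
    by rewrite big_ord1 d0 /exp_series subnn expr0 fact0 divr1 !mulr0 addr0 mulr1.
  rewrite big_ord_recr /= subnn /exp_series expr0 fact0 divr1 mulr1 addrC mulN1r.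
  congr (_ + _); have := dE n; rewrite /F => /eqP; rewrite eq_sym subr_eq => /eqP.
  rewrite -/(exp_series l n) => ->; rewrite opprD addrC big_ord_recr /= subSnn.
  rewrite expr1 divr1 mulrN1; congr (_ + _).
  rewrite -sumrN; apply: eq_bigr => i _.
  by rewrite (subSn (ltnW (ltn_ord i))) exprS; ring.
exists (8 * (2 * K)); split; first by apply: geo_boundW hd; lra.
move=> z z0 zK; have z00 := normr_ge0 z.
have zK1 : `|z| * K < 1 by nra.
have zK8 : `|z| * K * 8 <= 1 by nra.
have := pseries_cauchy_prod hd he zK8; rewrite cauchyE.
have hb2 : geo_bound (fun k => if k is k'.+1 then exp_series l k' else 0) K.
  exact: geo_bound_shift.
have hb3 : geo_bound (fun k => -1 * (if k is k'.+1 then exp_series l k' else 0)) (2 * K).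
  by have := geo_boundZ (-1) hb2; rewrite normrN1.
have hd2 : geo_bound d (2 * K) by apply: geo_boundW hd; lra.
have zK2 : `|z| * (2 * K) < 1 by nra.
move=> /(cvg_lim (@Rhausdorff R)); rewrite (limn_pseriesD hd2 hb3 zK2).
rewrite (limn_pseriesZ _ hb2 zK1) (limn_pseries_shift hl zK1) !exp_seriesE !mulN1r.
set D := limn _ => hD.
have e1 : 1 - expR (- z) != 0.
  by rewrite subr_eq0 eq_sym -expR0 (inj_eq (@expR_inj R)) oppr_eq0.
rewrite expr1 mulrA; apply/eqP; rewrite eq_sym; apply/eqP.
by apply: (mulIf e1); rewrite mulfVK// mulrBr mulr1 -hD opprD addNKr opprK.
Qed.

(** The derivative of e^(l z) / (1 - e^-z)^n has residue 0 and is a combination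
    of the functions for n and n + 1, which gives a recursion on n. *)
Lemma has_residue_todd (l : R) (n : nat) :
  has_residue (fun z => expR (l * z) / (1 - expR (- z)) ^+ n.+1)
              (\prod_(k < n) (l + k.+1%:R) / n`!%:R).
Proof.
elim: n => [|n [m [b [hf hb]]]].
  have [d d0 hd] := todd_expansion l; exists 0%N, d.
  by rewrite d0 big_ord0 fact0 divr1; split => //; under eq_fun do rewrite expr1.
pose f z := expR (l * z) / (1 - expR (- z)) ^+ n.+1.
pose g z := expR (l * z) / (1 - expR (- z)) ^+ n.+2.
pose f' z := l * f z + n.+1%:R * (f z - g z).
have nn : n.+1%:R != 0 :> R by rewrite pnatr_eq0.
have df z : z != 0 -> `|z| < 1 -> is_derive z (1 : R) f (f' z).
  move=> z0 _; have e1 : 1 - expR (- z) != 0.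
    by rewrite subr_eq0 eq_sym -expR0 (inj_eq (@expR_inj R)) oppr_eq0.
  pose k z := (1 - expR (- z))^-1.
  have dk : is_derive z (1 : R) k (k z - k z ^+ 2).
    have dN : is_derive z (1 : R) (-%R : R -> R) (- 1).
      by have := is_deriveN (is_derive_id z (1 : R)).
    have dE := is_derive1_comp (is_derive_expR (- z)) dN.
    have dU := is_deriveB (is_derive_cst (1 : R) z (1 : R)) dE.
    have H := is_deriveV (f := fun z => 1 - expR (- z)) e1 dU.
    apply: (is_derive_eq H); rewrite /GRing.scale /= /k.
    by field.
  have dl : is_derive z (1 : R) (fun z => expR (l * z)) (l * expR (l * z)).
    have dL : is_derive z (1 : R) (fun z : R => l * z) l.
      by have := is_deriveZ l (is_derive_id z (1 : R)); rewrite /GRing.scale /= mulr1.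
    have H := is_derive1_comp (is_derive_expR (l * z)) dL.
    by apply: (is_derive_eq H); rewrite mulrC.
  rewrite (_ : f = (fun z => expR (l * z)) * k ^+ n.+1); last first.
    by apply/funext => x; rewrite /f !fctE exprVn.
  have H := is_deriveM dl (is_deriveX n.+1 dk).
  apply: (is_derive_eq H).
  rewrite /f' /f /g /GRing.scale /= !fctE -!exprVn -/(k z) !exprS.
  by ring.
have := laurent_derive ltr01 df hf => hf'.
have := has_residueD
  (has_residueZ (n.+1%:R^-1 * (l + n.+1%:R)) (ex_intro _ m (ex_intro _ b (conj hf hb))))
  (has_residueZ (- n.+1%:R^-1) (ex_intro _ _ (ex_intro _ _ (conj hf' erefl)))).
move=> H; have {}H := has_residue_ext ltr01 _ H.
have -> : \prod_(k < n.+1) (l + k.+1%:R) / n.+1`!%:R =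
  n.+1%:R^-1 * (l + n.+1%:R) * (\prod_(k < n) (l + k.+1%:R) / n`!%:R) +
  - n.+1%:R^-1 * (pseries_diffs b m + - m.+1%:R * b m.+1).
  rewrite /pseries_diffs mulNr subrr mulr0 addr0 big_ord_recr /= factS natrM.
  have fn : n`!%:R != 0 :> R by rewrite pnatr_eq0 -lt0n fact_gt0.
  by field; rewrite fn nat1r nn.
apply: H => z z0 _; rewrite /f' -/(f z) -/(g z); field; by rewrite nat1r nn.
Qed.

End HasResidue.

(** * The differential operator and the residue *)

Section DiffOp.
Variables (R : realType) (r : nat) (E : 'cV[R]_r).
Notation V := ('rV[R]_r).
Variables (c : R) (kappa : R -> R).
Hypothesis kappa_derive : forall u, u != 0 ->
  is_derive u (1 : R) kappa (c * kappa u - kappa u ^+ 2).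
Implicit Types (a phi : V) (s : seq V) (w : seq 'I_r) (x v : 'cV[R]_r).

Let lev a := pairing a E.

Definition exp_prod a s x : R :=
  expR (pairing a x) * \prod_(phi <- s) kappa (pairing phi x).

Lemma derive_line (f : 'cV[R]_r -> R) x v (d : R) :
  is_derive (0 : R) (1 : R) (fun t => f (x + t *: v)) d -> 'D_v f x = d.
Proof.
move=> [_ <-]; rewrite /derive; 
have -> : (fun h : R => h^-1 *: ((f \o shift x) (h *: v) - f x)) =
  (fun h : R => h^-1 *: (((fun t : R => f (x + t *: v)) \o shift (0 : R)) (h *: (1 : R))
    - f (x + (0 : R) *: v))).
  apply/funext => h.
  by rewrite /shift /= scale0r !addr0 [h%:A]mulr1 (addrC x).
by [].
Qed.

Lemma pairing_line_derive (phi : V) x v :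
  is_derive (0 : R) (1 : R) (fun t => pairing phi (x + t *: v)) (pairing phi v).
Proof.
rewrite (_ : (fun t => _) = (cst (pairing phi x) + id * cst (pairing phi v) : R -> R)); last first.
  by apply/funext => t; rewrite pairingDr pairingZr.
have H := is_deriveD (is_derive_cst (pairing phi x) (0 : R) (1 : R))
  (is_deriveM (is_derive_id (0 : R) (1 : R)) (is_derive_cst (pairing phi v) (0 : R) (1 : R))).
by apply: (is_derive_eq H); rewrite /GRing.scale /= mul0r !add0r mulr1.
Qed.

Lemma exp_prod_derive a s x v : (forall phi, phi \in s -> pairing phi x != 0) ->
  is_derive (0 : R) (1 : R) (fun t => exp_prod a s (x + t *: v))
   (pairing a v * exp_prod a s x + \sum_(phi <- s) pairing phi v *
      (c * exp_prod a s x - exp_prod a (phi :: s) x)).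
Proof.
elim: s => [|phi s IH] hs.
  rewrite big_nil addr0; under eq_fun do rewrite /exp_prod big_nil mulr1.
  have D0 : is_derive (pairing a (x + (0 : R) *: v)) (1 : R) expR (expR (pairing a x)).
    by have := is_derive_expR (pairing a x); rewrite scale0r addr0.
  have H := is_derive1_comp D0 (pairing_line_derive a x v).
  by apply: (is_derive_eq H); rewrite /exp_prod big_nil mulr1 mulrC.
have p0 : pairing phi x != 0 by apply: hs; exact: mem_head.
have {}IH := IH (fun psi h => hs psi (mem_behead (s := phi :: s) h)).
have Dk : is_derive (pairing phi (x + (0 : R) *: v)) (1 : R) kappa
    (c * kappa (pairing phi x) - kappa (pairing phi x) ^+ 2).
  by have := kappa_derive p0; rewrite scale0r addr0.
have H := is_deriveM (is_derive1_comp Dk (pairing_line_derive phi x v)) IH.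
rewrite (_ : (fun t => _) = (kappa \o (fun t : R => pairing phi (x + t *: v))) *
    (fun t => exp_prod a s (x + t *: v))); last first.
  by apply/funext => t; rewrite !fctE /exp_prod big_cons mulrCA.
have x0 : x + (0 : R) *: v = x by rewrite scale0r addr0.
apply: (is_derive_eq H); rewrite {H} /GRing.scale /= !(x0 : x + scalemx 0 v = x).
set k := kappa _; set e := exp_prod a s x.
have eE : exp_prod a (phi :: s) x = k * e.
  by rewrite /e /k /exp_prod big_cons mulrCA.
have eE2 : exp_prod a [:: phi, phi & s] x = k * (k * e).
  by rewrite -eE /k /exp_prod !big_cons mulrCA.
have eE3 j : exp_prod a [:: j, phi & s] x = k * exp_prod a (j :: s) x.
  by rewrite /k /exp_prod !big_cons; ring.
rewrite big_cons eE eE2; under [in RHS]eq_bigr do rewrite eE3.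
rewrite mulrDr mulr_sumr.
rewrite [X in _ + (_ + X)](_ : _ = \sum_(i <- s) k * (pairing i v *
    (c * e - exp_prod a (i :: s) x))); last first.
  by apply: eq_bigr => j _; ring.
by ring.
Qed.

Lemma foldl_deriv_word (m : mpoly.multinom r) (f : 'cV[R]_r -> R) :
  mpartial_deriv m f = foldl (fun g i => partial_deriv i g) f (deriv_word m).
Proof.
rewrite /deriv_word foldl_rev /mpartial_deriv.
elim: (enum 'I_r) => //= i s ->; rewrite foldr_cat.
by elim: (mpoly.fun_of_multinom m i) => //= n ->.
Qed.

(** On the open set where no factor has a pole, iterated partial derivatives of
    combinations of products are given by [symbol]. *)
Lemma partial_derivs_symbol a (s0 : seq V) (z : R) w
    (S : seq (R * seq V)) (f : 'cV[R]_r -> R) :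
  (forall p, p \in S -> {subset p.2 <= s0}) ->
  (forall x, (forall phi, phi \in s0 -> pairing phi (x + z *: E) != 0) ->
     f x = \sum_(p <- S) p.1 * exp_prod a p.2 (x + z *: E)) ->
  forall x, (forall phi, phi \in s0 -> pairing phi (x + z *: E) != 0) ->
  foldl (fun g i => partial_deriv i g) f w x =
  \sum_(p <- S) p.1 * symbol c a (fun s => exp_prod a s (x + z *: E)) w p.2.
Proof.
elim: w S f => [|i w IH] S f Ss fE x Ux; first by rewrite /= fE.
pose dS1 (p : R * seq V) : seq (R * seq V) :=
  (p.1 * a 0 i, p.2) :: flatten [seq [:: (p.1 * phi 0 i * c, p.2);
     (- (p.1 * phi 0 i), phi :: p.2)] | phi <- p.2].
have sum_dS1 (val : seq V -> R) p : \sum_(q <- dS1 p) q.1 * val q.2 =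
    p.1 * (a 0 i * val p.2 + \sum_(phi <- p.2) phi 0 i * (c * val p.2 - val (phi :: p.2))).
  rewrite /dS1 big_cons /= big_flatten big_map mulrDr mulr_sumr; congr (_ + _).
    by rewrite mulrA.
  by apply: eq_bigr => phi _; rewrite !big_cons big_nil /=; ring.
rewrite /= (IH (flatten [seq dS1 p | p <- S])) //.
- rewrite big_flatten big_map; apply: eq_bigr => p _.
  exact: (sum_dS1 (fun s => symbol c a (fun s => exp_prod a s (x + z *: E)) w s)).
- move=> q /flattenP[_ /mapP[p pS ->]]; rewrite inE => /predU1P[->|].
    exact: (Ss p pS).
  move=> /flattenP[_ /mapP[phi phip ->]]; rewrite !inE => /orP[]/eqP-> /=.
    exact: (Ss p pS).
  by move=> y; rewrite inE => /predU1P[->|]; [exact: (Ss p pS _ phip)|exact: (Ss p pS)].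
move=> y Uy; rewrite big_flatten big_map.
under eq_bigr do rewrite (sum_dS1 (fun s => exp_prod a s (y + z *: E))).
rewrite /partial_deriv; apply: derive_line.
set v := delta_mx i 0.
have pv phi : pairing phi v = phi 0 i.
  rewrite pairingE (bigD1 i)//= /v mxE !eqxx mulr1 big1 ?addr0// => j ji.
  by rewrite mxE (negbTE ji) mulr0.
have dg : is_derive (0 : R) (1 : R)
   (fun t => \sum_(p <- S) p.1 * exp_prod a p.2 ((y + z *: E) + t *: v))
   (\sum_(p <- S) p.1 * (a 0 i * exp_prod a p.2 (y + z *: E) +
      \sum_(phi <- p.2) phi 0 i * (c * exp_prod a p.2 (y + z *: E)
        - exp_prod a (phi :: p.2) (y + z *: E)))).
  apply: is_derive_sum_seq => p pS; apply: is_deriveZ.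
  have H := @exp_prod_derive a p.2 (y + z *: E) v (fun phi h => Uy phi (Ss p pS phi h)).
  apply: (is_derive_eq H); rewrite pv; congr (_ + _).
  by apply: eq_bigr => phi _; rewrite pv.
have near_eq : \forall t \near (0 : R),
    \sum_(p <- S) p.1 * exp_prod a p.2 ((y + z *: E) + t *: v) = f (y + t *: v).
  have nU : \forall t \near (0 : R), forall phi, phi \in s0 ->
      pairing phi ((y + z *: E) + t *: v) != 0.
    elim: (s0) Uy => [|phi s' IHs] Uy; first by near=> t.
    pose g t := pairing phi (y + z *: E + t *: v).
    have c1 : g @ (0 : R) --> g 0.
      apply: differentiable_continuous; apply/derivable1_diffP.
      by have [] := pairing_line_derive phi (y + z *: E) v.
    have g0 : g 0 != 0 by rewrite /g scale0r addr0; apply: Uy; exact: mem_head.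
    have n1 : \forall t \near (0 : R), g t != 0 by exact: cvgr_neq0 c1 g0.
    have n2 := IHs (fun psi h => Uy psi (mem_behead (s := phi :: s') h)).
    by apply: filterS2 n1 n2 => t h1 h2 psi; rewrite inE => /predU1P[->|/h2].
  apply: filterS nU => t Ut; rewrite fE; last first.
    by move=> phi phis; rewrite addrAC; exact: Ut.
  by apply: eq_bigr => p _; rewrite (addrAC y).
exact: (near_eq_is_derive near_eq dg).
Unshelve. all: by end_near. Qed.

Lemma has_residue_symbol (P : V -> Prop) a w s (val : R -> seq V -> R) (rho : seq V -> R) :
  (forall s', (forall phi, phi \in s' -> P phi) ->
     has_residue (val ^~ s') (rho s')) ->
  (forall phi, phi \in s -> P phi) ->
  has_residue (fun z => symbol c a (val z) w s) (symbol c a rho w s).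
Proof.
move=> h; elim: w s => [|i w IH] s Ps /=; first exact: h.
apply: has_residueD; first exact: (has_residueZ (a 0 i) (IH s Ps)).
apply: (@has_residue_sum R _ s (fun phi z => phi 0 i *
  (c * symbol c a (val z) w s - symbol c a (val z) w (phi :: s)))) => phi phis.
have IH' : has_residue (fun z => symbol c a (val z) w (phi :: s)) (symbol c a rho w (phi :: s)).
  by apply: IH => psi; rewrite inE => /predU1P[->|]; exact: Ps.
have H := has_residueZ (phi 0 i) (has_residueD (has_residueZ c (IH s Ps))
  (has_residueZ (-1) IH')).
rewrite mulN1r in H; apply: (@has_residue_ext _ _ _ _ 1 ltr01 _ H) => z _ _.
by rewrite mulN1r.
Qed.

(** At x = 0 the symbol is a fixed combination of functions of z of the form
    e^(l z) prod kappa(<phi,E> z), whose residues are given by rho. *)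
Lemma diffop_residue0 (Q : mpoly.mpoly r R) (P : V -> Prop) (rho : seq V -> R -> R) a s :
  (forall phi, P phi -> lev phi != 0) ->
  (forall s', (forall phi, phi \in s' -> P phi) ->
     has_residue (fun z => expR (lev a * z) * \prod_(phi <- s') kappa (lev phi * z))
       (rho s' (lev a))) ->
  (forall phi, phi \in s -> P phi) ->
  residue0 (fun z : R => diffop Q (fun x => exp_prod a s (x + z *: E)) 0)
    (residue_poly E Q c rho s a).
Proof.
move=> P0 hrho Ps; apply: has_residue_residue0.
apply: (@has_residue_ext _ (fun z => \sum_(m <- mpoly.msupp Q) mpoly.mcoeff m Q *
  symbol c a (fun s' => expR (lev a * z) * \prod_(phi <- s') kappa (lev phi * z))
    (deriv_word m) s) _ _ 1) => // [z z0 _|].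
  rewrite /diffop; apply: eq_bigr => m _; congr (_ * _).
  rewrite foldl_deriv_word.
  have U0 phi : phi \in s -> pairing phi (0 + z *: E) != 0.
    by move=> ps; rewrite add0r pairingZr mulf_neq0// P0//; exact: Ps.
  rewrite (@partial_derivs_symbol a s z _ [:: (1, s)] _ _ _ 0 U0); last 2 first.
  - by move=> p; rewrite inE => /eqP->.
  - by move=> x _; rewrite big_seq1 mul1r.
  rewrite big_seq1 mul1r; congr symbol; apply/funext => s'.
  rewrite /exp_prod add0r pairingZr (mulrC z); congr (_ * _).
  by apply: eq_bigr => phi _; rewrite pairingZr mulrC.
apply: (@has_residue_bigsum R _ _ (fun m z => mpoly.mcoeff m Q * symbol c a
  (fun s' => expR (lev a * z) * \prod_(phi <- s') kappa (lev phi * z)) (deriv_word m) s)) => m.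
apply: has_residueZ.
exact: (has_residue_symbol (P := P) a _ (rho := fun s' => rho s' (lev a))
  (val := fun z s' => expR (lev a * z) * \prod_(phi <- s') kappa (lev phi * z))).
Qed.

End DiffOp.

Section ResidueFormulas.
Variables (R : realType) (r : nat) (E : 'cV[R]_r) (Q : mpoly.mpoly r R).
Implicit Types (a phi : 'rV[R]_r) (s : seq 'rV[R]_r).

Let lev a := pairing a E.

Lemma inv_derive (u : R) : u != 0 ->
  is_derive u (1 : R) (fun u => u^-1) (0 * u^-1 - u^-1 ^+ 2).
Proof.
move=> u0; have H := is_deriveV (f := id) u0 (is_derive_id u (1 : R)).
by apply: (is_derive_eq H); rewrite /GRing.scale /= mul0r sub0r mulr1 exprVn.
Qed.

Lemma todd_derive (u : R) : u != 0 ->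
  is_derive u (1 : R) (fun u => (1 - expR (- u))^-1)
    (1 * (1 - expR (- u))^-1 - (1 - expR (- u))^-1 ^+ 2).
Proof.
move=> u0; have e1 : 1 - expR (- u) != 0.
  by rewrite subr_eq0 eq_sym -expR0 (inj_eq (@expR_inj R)) oppr_eq0.
have dN : is_derive u (1 : R) (-%R : R -> R) (- 1).
  by have := is_deriveN (is_derive_id u (1 : R)).
have dE := is_derive1_comp (is_derive_expR (- u)) dN.
have dU := is_deriveB (is_derive_cst (1 : R) u (1 : R)) dE.
have H := is_deriveV (f := fun z => 1 - expR (- z)) e1 dU.
by apply: (is_derive_eq H); rewrite /GRing.scale /=; field.
Qed.

Theorem vol_residue0 a s : (forall phi, phi \in s -> lev phi != 0) ->
  residue0 (fun z : R => diffop Q (fun x => expR (pairing a (x + z *: E)) /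
     \prod_(phi <- s) pairing phi (x + z *: E)) 0) (vol_residue E Q s a).
Proof.
move=> hs.
have -> : (fun z : R => diffop Q (fun x => expR (pairing a (x + z *: E)) /
     \prod_(phi <- s) pairing phi (x + z *: E)) 0) =
  (fun z : R => diffop Q (fun x => exp_prod (fun u => u^-1) a s (x + z *: E)) 0).
  apply/funext => z; congr diffop; apply/funext => x.
  by rewrite /exp_prod prodfV.
apply: (diffop_residue0 inv_derive Q (P := fun phi => lev phi != 0)) => // s' hs'.
rewrite /vol_rho; case: s' hs' => [|phi s'] hs'.
  by under eq_fun do rewrite big_nil mulr1; exact: has_residue_exp.
set p := \prod_(_ <- _) _.
apply: (@has_residue_ext _
  (fun z => p^-1 * (expR (lev a * z) / z ^+ (size (phi :: s')))) _ _ 1) => //.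
  move=> z z0 _; rewrite mulrCA; congr (_ * _).
  rewrite (eq_bigr (fun phi => (lev phi)^-1 * z^-1)); last by move=> j _; rewrite invfM.
  by rewrite big_split /= prodfV -/p big_const_seq count_predT iter_mulr_1 exprVn.
rewrite invfM mulrA [X in has_residue _ X]mulrC.
by apply: has_residueZ; exact: has_residue_exp_pole.
Qed.

Theorem count_residue0 a s : (forall phi, phi \in s -> unit_lev E phi) ->
  residue0 (fun z : R => diffop Q (fun x => expR (pairing a (x + z *: E)) /
     \prod_(phi <- s) (1 - expR (- pairing phi (x + z *: E)))) 0)
    (count_residue E Q s a).
Proof.
move=> hs.
have -> : (fun z : R => diffop Q (fun x => expR (pairing a (x + z *: E)) /
     \prod_(phi <- s) (1 - expR (- pairing phi (x + z *: E)))) 0) =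
  (fun z : R => diffop Q (fun x =>
     exp_prod (fun u => (1 - expR (- u))^-1) a s (x + z *: E)) 0).
  apply/funext => z; congr diffop; apply/funext => x.
  by rewrite /exp_prod prodfV.
apply: (diffop_residue0 todd_derive Q (P := unit_lev E)) => //.
  by move=> phi [] ->; rewrite ?oppr_eq0 oner_eq0.
move=> s' hs'; rewrite /count_rho; set q := neg_count E s'.
have prodE z : z != 0 -> \prod_(phi <- s') (1 - expR (- (lev phi * z)))^-1 =
    (-1) ^+ q * expR (- q%:R * z) / (1 - expR (- z)) ^+ size s'.
  move=> z0; rewrite /q; elim: s' hs' {q} => [|phi s' IH] hs'.
    by rewrite big_nil /neg_count /= expr0 oppr0 mul0r expR0 expr0 divr1 mulr1.
  have e1 : 1 - expR (- z) != 0.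
    by rewrite subr_eq0 eq_sym -expR0 (inj_eq (@expR_inj R)) oppr_eq0.
  have e2 : 1 - expR z != 0.
    by rewrite subr_eq0 eq_sym -[X in _ == X]expR0 (inj_eq (@expR_inj R)).
  rewrite big_cons IH; last by move=> psi h; apply: hs'; rewrite inE h orbT.
  rewrite /neg_count /= -/(neg_count E s') -/(lev phi) [RHS](_ : _ =
    (-1) ^+ ((lev phi < 0)%R + neg_count E s') *
    expR (- ((lev phi < 0)%R + neg_count E s')%:R * z) /
    ((1 - expR (- z)) * (1 - expR (- z)) ^+ size s')); last by rewrite exprS.
  case: (hs' _ (mem_head _ _)); rewrite -/(lev phi) => ->.
    by rewrite ltr10 add0n mul1r invfM; ring.
  rewrite ltrN10 add1n mulN1r opprK exprS -natr1 opprD mulrDl mulN1r expRD.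
  rewrite invfM [in RHS]mulrA.
  have -> : (1 - expR z)^-1 = - (expR (- z) * (1 - expR (- z))^-1).
    rewrite expRN; field; rewrite gt_eqF ?expR_gt0// e2 andbT.
    by rewrite subr_eq0 eq_sym -subr_eq0.
  rewrite (mulN1r z); ring.
move: prodE; rewrite {}/q; case: s' hs' => [|phi s'] hs' prodE.
  by under eq_fun do rewrite big_nil mulr1; exact: has_residue_exp.
apply: (@has_residue_ext _ (fun z => (-1) ^+ neg_count E (phi :: s') *
  (expR ((lev a - (neg_count E (phi :: s'))%:R) * z) / (1 - expR (- z)) ^+ size (phi :: s'))) _ _ 1) => //.
  move=> z z0 _; rewrite prodE// mulrDl expRD; ring.
by apply: has_residueZ; exact: has_residue_todd.
Qed.

End ResidueFormulas.

(** * Iterated integrals along vectors *)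

Section AffineSubstitution.
Variable R : realType.
Notation mu := (@lebesgue_measure R).
Local Open Scope ereal_scope.

Lemma lebesgue_measure_affine (c b : R) (A : set R) : c != 0%R -> measurable A ->
  mu A = `|c|%:E * mu ((fun x => c * x + b)%R @^-1` A).
Proof.
move=> c0 mA.
pose phi : measurableTypeR R -> measurableTypeR R := fun x => (c * x + b)%R.
have mphi : measurable_fun setT phi.
  by apply: measurable_funD => //; exact: measurable_funM.
pose k : {nonneg R} := NngNum (normr_ge0 c).
have := @lebesgue_measure_unique R (mscale k (pushforward mu phi)).
move=> /(_ mphi) uniq; rewrite (uniq _ A mA)//.
move=> _ [[u v]] _ <-.
have phiE : phi @^-1` `]u, v] = if (0 < c)%R then `]((u - b) / c)%R, ((v - b) / c)%R]%classic
    else `[((v - b) / c)%R, ((u - b) / c)%R[%classic.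
  apply/seteqP; split => x /=; rewrite in_itv /= /phi.
    move=> /andP[h1 h2]; case: ifPn => cp; rewrite /= in_itv /=; apply/andP; split.
    - by rewrite ltr_pdivrMr// mulrC; lra.
    - by rewrite ler_pdivlMr// mulrC; lra.
    - have cn : (c < 0)%R by rewrite lt_neqAle c0 leNgt.
      by rewrite ler_ndivrMr// mulrC; lra.
    - have cn : (c < 0)%R by rewrite lt_neqAle c0 leNgt.
      by rewrite ltr_ndivlMr// mulrC; lra.
  case: ifPn => cp; rewrite /= in_itv /= => /andP[].
    rewrite ltr_pdivrMr// ler_pdivlMr// (mulrC x) => h1 h2.
    by apply/andP; split; lra.
  have cn : (c < 0)%R by rewrite lt_neqAle c0 leNgt.
  rewrite ler_ndivrMr// ltr_ndivlMr// (mulrC x) => h1 h2.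
  by apply/andP; split; lra.
rewrite -[RHS]/(`|c|%:E * mu (phi @^-1` `]u, v])) phiE.
have [cp|cp] := ltP 0%R c.
  rewrite !lebesgue_measure_itv /= !lte_fin ltr_pM2r ?invr_gt0// ltrD2r.
  case: ifP => _; last by rewrite mule0.
  rewrite -!EFinB -EFinM; congr EFin; rewrite gtr0_norm//.
  by rewrite -mulrBl mulrC divfK//; lra.
have cn : (c < 0)%R by rewrite lt_neqAle c0.
rewrite !lebesgue_measure_itv /= !lte_fin ltr_nM2r ?invr_lt0// ltrD2r.
case: ifP => _; last by rewrite mule0.
rewrite -!EFinB -EFinM; congr EFin; rewrite ltr0_norm//.
by rewrite -mulrBl mulNr mulrC divfK//; lra.
Qed.

Lemma integral_affine (c b : R) (f : R -> \bar R) : c != 0%R ->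
  measurable_fun setT f -> (forall x, 0 <= f x) ->
  \int[mu]_x f x = `|c|%:E * \int[mu]_x f (c * x + b)%R.
Proof.
move=> c0 mf f0.
pose phi : measurableTypeR R -> measurableTypeR R := fun x => (c * x + b)%R.
have mphi : measurable_fun setT phi.
  by apply: measurable_funD => //; exact: measurable_funM.
pose k : {nonneg R} := NngNum (normr_ge0 c).
rewrite (@eq_measure_integral _ _ _ _ (mscale k (pushforward mu phi))); last first.
  by move=> A mA _; exact: (lebesgue_measure_affine b c0 mA).
rewrite ge0_integral_mscale//; congr (_ * _).
by rewrite ge0_integral_pushforward// preimage_setT.
Qed.

End AffineSubstitution.

Section IteratedIntegrals.
Variables (R : realType) (N : nat).
Notation V := ('rV[R]_N).
Notation mu := (@lebesgue_measure R).
Local Open Scope ereal_scope.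
Implicit Types (g : V -> \bar R) (k t v : V) (ks : seq V).

(** Measurability is tested on all coordinatewise measurable families of
    points; this avoids any sigma-algebra on row vectors and is stable under
    integration along a vector. *)
Definition tame g := (forall t, 0 <= g t) /\
  forall (d : measure_display) (T : measurableType d) (f : T -> V),
    (forall i, measurable_fun setT (fun x => f x 0%R i)) ->
    measurable_fun setT (g \o f).

Definition int_along k g t := \int[mu]_x g (t + x *: k)%R.

Definition iter_int ks g := foldr int_along g ks.

Lemma tame_line g t k : tame g -> measurable_fun setT (fun x : R => g (t + x *: k)%R).
Proof.
move=> [_ mg]; apply: (mg _ (measurableTypeR R) (fun x => t + x *: k)%R) => i.
under eq_fun do rewrite !mxE.
by apply: measurable_funD => //; exact: measurable_funM.
Qed.

Lemma tame_int_along k g : tame g -> tame (int_along k g).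
Proof.
move=> tg; have [g0 mg] := tg; split=> [t|d T f mf].
  by apply: integral_ge0 => x _.
pose F (p : T * measurableTypeR R) := g (f p.1 + p.2 *: k)%R.
have mF : measurable_fun setT F.
  apply: (mg _ _ (fun p : T * measurableTypeR R => f p.1 + p.2 *: k)%R) => i.
  under eq_fun do rewrite !mxE.
  apply: measurable_funD; first exact: (measurableT_comp (mf i) measurable_fst).
  by apply: measurable_funM => //; exact: measurable_snd.
exact: (measurable_fun_fubini_tonelli_F (m2 := mu) F mF (fun=> g0 _)).
Qed.

Lemma tame_iter_int ks g : tame g -> tame (iter_int ks g).
Proof. by move=> tg; elim: ks => //= k ks IH; exact: tame_int_along. Qed.

(** Tonelli in the plane spanned by the two directions. *)
Lemma int_along_swap k k' g t : tame g ->
  int_along k (int_along k' g) t = int_along k' (int_along k g) t.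
Proof.
move=> [g0 mg].
pose F (p : measurableTypeR R * measurableTypeR R) := g (t + p.1 *: k + p.2 *: k')%R.
have mF : measurable_fun setT F.
  apply: (mg _ _ (fun p : measurableTypeR R * measurableTypeR R => t + p.1 *: k + p.2 *: k')%R) => i.
  under eq_fun do rewrite !mxE.
  apply: measurable_funD; last by apply: measurable_funM => //; exact: measurable_snd.
  by apply: measurable_funD => //; apply: measurable_funM => //; exact: measurable_fst.
have := fubini_tonelli (m1 := mu) (m2 := mu) F mF (fun=> g0 _).
rewrite /F /= => e; rewrite /int_along e.
by apply: eq_integral => y _; apply: eq_integral => x _; rewrite addrAC.
Qed.

Lemma int_along_shift k g t (c : R) : tame g ->
  int_along k g (t + c *: k)%R = int_along k g t.
Proof.
move=> tg; rewrite [RHS]/int_along.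
rewrite (integral_affine c (oner_neq0 R) (tame_line t k tg)); last by move=> x; exact: tg.1.
rewrite normr1 mul1e; apply: eq_integral => x _.
by rewrite mul1r scalerDl -addrA (addrC (c *: k)%R).
Qed.

Lemma int_along_scale (c : R) k g t : tame g -> c != 0%R ->
  int_along (c *: k) g t = `|c|^-1%:E * int_along k g t.
Proof.
move=> tg c0; rewrite [in RHS]/int_along.
rewrite (integral_affine 0%R c0 (tame_line t k tg)); last by move=> x; exact: tg.1.
rewrite muleA -EFinM mulVf ?normr_eq0// mul1e; apply: eq_integral => x _.
by rewrite addr0 scalerA mulrC.
Qed.

Lemma iter_int_cat ks ks' g : iter_int (ks ++ ks') g = iter_int ks (iter_int ks' g).
Proof. exact: foldr_cat. Qed.

Lemma iter_int_move k ks g t : tame g ->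
  iter_int (k :: ks) g t = iter_int ks (int_along k g) t.
Proof.
move=> tg; elim: ks t => //= k' ks IH t.
rewrite int_along_swap; last exact: tame_iter_int.
by apply: eq_integral => x _; exact: IH.
Qed.

Lemma iter_int_perm ks ks' g : tame g -> perm_eq ks ks' ->
  iter_int ks g = iter_int ks' g.
Proof.
move=> tg; elim: ks ks' => [|k ks IH] ks'.
  by rewrite perm_sym => /perm_nilP ->.
move=> p; have kin : k \in ks' by rewrite -(perm_mem p) mem_head.
move: p; case/splitPr: kin => p1 p2; rewrite perm_sym -cat1s perm_catCA cat1s perm_cons.
rewrite perm_sym => /IH e; apply/funext => t /=.
rewrite -[LHS]/(int_along k (iter_int ks g) t) e !iter_int_cat.
exact: (iter_int_move k p1 t (tame_iter_int p2 tg)).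
Qed.

Lemma iter_int_shift k ks g t (c : R) : tame g -> k \in ks ->
  iter_int ks g (t + c *: k)%R = iter_int ks g t.
Proof.
move=> tg kin; rewrite (iter_int_perm tg (perm_to_rem kin)) /=.
by apply: int_along_shift; exact: tame_iter_int.
Qed.

Lemma iter_int_mulmx m (K : 'M[R]_(m, N)) (s : 'rV[R]_m) ks g t : tame g ->
  (forall i, row i K \in ks) -> iter_int ks g (t + s *m K)%R = iter_int ks g t.
Proof.
move=> tg Kks; rewrite mulmx_sum_row.
elim/big_rec: _ t => [|i v _ IH] t; first by rewrite addr0.
by rewrite addrCA addrC iter_int_shift.
Qed.

(** Translations of the integrand along k have no effect, hence neither do the
    components of the directions along k. *)
Lemma iter_int_shear (I : Type) (s : seq I) (f : I -> V) (b : I -> R) k g t :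
  (forall t (c : R), g (t + c *: k)%R = g t) ->
  iter_int [seq (f i + b i *: k)%R | i <- s] g t = iter_int [seq f i | i <- s] g t.
Proof.
move=> gk; have inv t' (c : R) : iter_int [seq f i | i <- s] g (t' + c *: k)%R =
    iter_int [seq f i | i <- s] g t'.
  elim: s t' => //= i s IH t'; apply: eq_integral => x _.
  by rewrite addrAC IH.
elim: s t inv => //= i s IH t inv.
have inv' t' (c : R) : iter_int [seq f i | i <- s] g (t' + c *: k)%R =
    iter_int [seq f i | i <- s] g t'.
  elim: (s) t' => //= j s' IHs t'; apply: eq_integral => x _.
  by rewrite addrAC IHs.
by apply: eq_integral => x _; rewrite IH// scalerDr addrA scalerA inv'.
Qed.

Definition rowseq m (K : 'M[R]_(m, N)) : seq V := [seq row i K | i <- enum 'I_m].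

Lemma rowseq_col_mx m (k : V) (K : 'M[R]_(m, N)) : rowseq (col_mx k K) = k :: rowseq K.
Proof.
rewrite /rowseq enum_ordSl /=; congr (_ :: _).
  by rewrite (_ : ord0 = lshift m (ord0 : 'I_1)); [rewrite rowKu row_id|exact: val_inj].
rewrite -map_comp; apply: eq_map => i /=.
by rewrite (_ : lift ord0 i = rshift 1 i); [rewrite rowKd|exact: val_inj].
Qed.

Lemma rowseq_perm m (s : 'S_m) (K : 'M[R]_(m, N)) : perm_eq (rowseq (row_perm s K)) (rowseq K).
Proof.
rewrite /rowseq (eq_map (f := fun i => row i (row_perm s K)) (g := (fun i => row i K) \o s)).
  rewrite map_comp; apply: perm_map; apply: uniq_perm.
  - by rewrite map_inj_uniq ?enum_uniq//; exact: perm_inj.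
  - exact: enum_uniq.
  by move=> i; rewrite mem_enum inE; apply/mapP; exists (s^-1%g i); rewrite ?mem_enum ?permKV.
by move=> i; apply/rowP => j; rewrite !mxE.
Qed.

(** Linear substitution in iterated integrals, by elimination of the first row:
    the direction of the pivot is integrated first, after which it may be
    subtracted from the other directions. *)
Theorem iter_int_unitmx m (U : 'M[R]_m) (K : 'M[R]_(m, N)) g t : tame g ->
  U \in unitmx ->
  iter_int (rowseq (U *m K)) g t = `|\det U|^-1%:E * iter_int (rowseq K) g t.
Proof.
elim: m U K g t => [|m IH] U K g t tg uU.
  by rewrite det_mx00 normr1 invr1 mul1e /rowseq !(size0nil (size_enum_ord 0)).
wlog U00 : U uU / U ord0 ord0 != 0%R => [wl|].
  have [i Ui] : exists i, U i ord0 != 0%R.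
    apply/existsP; rewrite -negb_forall; apply/negP => /forallP U0.
    have : (\det U == 0)%R.
      rewrite (expand_det_col _ ord0) big1// => i _.
      by rewrite (eqP (U0 i)) mul0r.
    by move: uU; rewrite unitmxE unitfE => /negP.
  pose s := tperm ord0 i.
  have := wl (row_perm s U); rewrite mxE tpermL => /(_ _ Ui).
  rewrite row_permE unitmx_mul unitmx_perm uU det_mulmx det_perm normrM normrX normrN1.
  rewrite expr1n mul1r -mulmxA -row_permE => /(_ isT) <-.
  by rewrite (iter_int_perm tg (rowseq_perm s (U *m K))).
pose U' : 'M[R]_(1 + m) := U; pose K' : 'M[R]_(1 + m, N) := K.
pose a : R := U ord0 ord0; pose b : 'rV_m := ursubmx U'; pose c : 'cV_m := dlsubmx U'.
pose T : 'M[R]_m := drsubmx U'.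
have UE : U' = block_mx a%:M b c T.
  rewrite -[U']submxK; congr block_mx; apply/matrixP => i j.
  by rewrite !ord1 !mxE eqxx mulr1n /U' /a; congr (U _ _); exact: val_inj.
pose k0 : V := usubmx K'; pose K1 : 'M[R]_(m, N) := dsubmx K'.
have KE : K' = col_mx k0 K1 by rewrite vsubmxK.
pose S : 'M[R]_m := (T - a^-1 *: (c *m b))%R.
have detU : \det U = (a * \det S)%R.
  have LU : U' = (block_mx (scalar_mx 1) 0 (a^-1 *: c) (scalar_mx 1) *m block_mx (scalar_mx a) b 0 S)%R.
    rewrite UE mulmx_block !mul1mx !mul0mx ?mulmx0 ?addr0 ?mulmx1.
    rewrite -scalemxAl mul_mx_scalar scalerA mulVf// scale1r.
    by rewrite -scalemxAl /S addrC subrK.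
  rewrite [LHS](congr1 (@determinant R (1 + m)) LU) det_mulmx det_lblock !det1 !mul1r det_ublock.
  by rewrite det_scalar1.
have uS : S \in unitmx.
  by move: uU; rewrite !unitmxE !unitfE detU mulf_eq0 negb_or => /andP[].
pose v : V := (a *: k0 + b *m K1)%R.
have UKE : U *m K = col_mx v (c *m k0 + T *m K1)%R.
  have -> : U *m K = mulmx (block_mx (scalar_mx a) b c T) (col_mx k0 K1).
    exact: (f_equal2 (@mulmx R (1 + m) (1 + m) N) UE KE).
  by rewrite mul_block_col mul_scalar_mx.
rewrite UKE rowseq_col_mx -[K in RHS]/K' KE rowseq_col_mx iter_int_move//.
have -> : rowseq (c *m k0 + T *m K1)%R = [seq (row i (S *m K1) + (c i ord0 / a) *: v)%R | i <- enum 'I_m].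
  apply: eq_map => i; rewrite linearD /= /v scalerDr scalerA divfK// /S.
  rewrite mulmxBl -scalemxAl -mulmxA linearB /= linearZ /=.
  rewrite !row_mul (_ : row i c = scalar_mx (c i ord0)); last first.
    by apply/rowP => j; rewrite !ord1 !mxE eqxx mulr1n.
  rewrite !mul_scalar_mx scalerA (mulrC (a^-1)%R) addrCA.
  by congr (_ + _)%R; rewrite subrK.
rewrite iter_int_shear; last by move=> t1 c1; exact: int_along_shift.
rewrite IH//; last exact: tame_int_along.
rewrite -iter_int_move// /= detU normrM invfM mulrC EFinM -muleA; congr (_ * _).
rewrite -int_along_scale//; last exact: tame_iter_int.
apply: eq_integral => x _; rewrite /v scalerDr addrA scalemxAl.
apply: iter_int_mulmx => // i; apply/mapP; exists i => //; exact: mem_enum.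
Qed.

End IteratedIntegrals.

(** * Volumes of fibers *)

Section RowSpaces.
Variables (R : realType) (r : nat).
Implicit Types (s : seq 'rV[R]_r).

Lemma row_mx_of_seq s (i : 'I_(size s)) : row i (mx_of_seq s) = s`_i.
Proof. by apply/rowP => j; rewrite !mxE. Qed.

Lemma mulmx_mx_of_seq s (t : 'rV[R]_(size s)) :
  t *m mx_of_seq s = \sum_i t 0 i *: s`_i.
Proof. by rewrite mulmx_sum_row; apply: eq_bigr => i _; rewrite row_mx_of_seq. Qed.

Lemma mx_of_seq_cons phi s :
  mx_of_seq (phi :: s) = col_mx phi (mx_of_seq s) :> 'M[R]_(1 + size s, r).
Proof.
apply/row_matrixP => i; rewrite [LHS](@row_mx_of_seq (phi :: s) i).
case: (splitP i) => j ij.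
  have -> : i = lshift (size s) j by exact: val_inj.
  by rewrite rowKu row_id (ord1 j).
have -> : i = rshift 1 j by exact: val_inj.
by rewrite rowKd row_mx_of_seq.
Qed.

Lemma mem_span_submx s (a : 'rV[R]_r) : (a \in << s >>%VS) = (a <= mx_of_seq s)%MS.
Proof.
apply/idP/idP.
  move=> /(coord_span (X := in_tuple s)) ->.
  rewrite summx_sub// => i _; apply: scalemx_sub.
  by rewrite -(row_mx_of_seq (i : 'I_(size s))); exact: row_sub.
move=> /submxP[t ->]; rewrite mulmx_mx_of_seq rpred_sum// => i _.
by rewrite rpredZ// memv_span// mem_nth.
Qed.

Lemma dim_span_rank s : \dim << s >>%VS = \rank (mx_of_seq s).
Proof.
pose B := row_base (mx_of_seq s).
have sB : size (rowseq B) = \rank (mx_of_seq s).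
  by rewrite size_map size_enum_ord.
have nB (i : 'I_(\rank (mx_of_seq s))) : (rowseq B)`_i = row i B.
  by rewrite (nth_map i) ?size_enum_ord// nth_ord_enum.
suff bB : basis_of << s >>%VS (rowseq B).
  by rewrite -sB; apply: (size_basis (X := in_tuple (rowseq B))).
apply/andP; split.
  apply/eqP/vspaceP => a; rewrite !mem_span_submx.
  suff -> : (mx_of_seq (rowseq B) :=: mx_of_seq s)%MS by [].
  apply/eqmxP/andP; split; apply/row_subP => i.
    rewrite row_mx_of_seq; have := mem_nth 0 (ltn_ord i) => /mapP[j _ ->].
    by rewrite (submx_trans (row_sub _ _))// eq_row_base.
  rewrite (submx_trans (row_sub _ _))// -(eq_row_base (mx_of_seq s)).
  apply/row_subP => j; rewrite -nB.
  have jl : (j < size (rowseq B))%N by rewrite sB.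
  by rewrite -[nat_of_ord j]/(nat_of_ord (Ordinal jl)) -row_mx_of_seq row_sub.
apply/(freeP (X := in_tuple (rowseq B))) => k k0 i.
pose k' : 'rV[R]_(\rank (mx_of_seq s)) := \row_j k (cast_ord (esym sB) j).
have : k' *m B = 0.
  rewrite -[RHS]k0 mulmx_sum_row (reindex (cast_ord sB)) /=; last first.
    by exists (cast_ord (esym sB)) => j _; [exact: cast_ordK|exact: cast_ordKV].
  apply: eq_bigr => j _; rewrite mxE cast_ordK; congr (_ *: _).
  by rewrite -nB.
move=> /eqP; rewrite -(mul0mx _ B) => /eqP /(row_free_inj (row_base_free _)).
by move=> /rowP/(_ (cast_ord sB i)); rewrite !mxE cast_ordK.
Qed.

End RowSpaces.

Section Lattices.
Variables (R : realType) (r : nat).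
Implicit Types (s : seq 'rV[R]_r).

Lemma Zspan_rowseq d (B : 'M[R]_(d, r)) (x : 'rV[R]_r) :
  Zspan (rowseq B) x <-> exists c : 'rV[int]_d, x = map_mx intr c *m B.
Proof.
have sB : size (rowseq B) = d by rewrite size_map size_enum_ord.
have nB (i : 'I_d) : (rowseq B)`_i = row i B.
  by rewrite (nth_map i) ?size_enum_ord// nth_ord_enum.
split.
  move=> [c ->]; exists (\row_j c (cast_ord (esym sB) j)).
  rewrite mulmx_sum_row (reindex (cast_ord (esym sB))) /=; last first.
    by exists (cast_ord sB) => j _; [exact: cast_ordKV|exact: cast_ordK].
  by apply: eq_bigr => j _; rewrite !mxE scaler_int -nB.
move=> [c ->]; exists [ffun j => c 0 (cast_ord sB j)].
rewrite mulmx_sum_row (reindex (cast_ord sB)) /=; last first.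
  by exists (cast_ord (esym sB)) => j _; [exact: cast_ordK|exact: cast_ordKV].
by apply: eq_bigr => j _; rewrite ffunE !mxE scaler_int -nB.
Qed.

Lemma Zindep_rowseq d (B : 'M[R]_(d, r)) :
  (forall c : 'I_(size (rowseq B)) -> int,
    \sum_(i < size (rowseq B)) (rowseq B)`_i *~ c i = 0 -> forall i, c i = 0) <->
  (forall c : 'rV[int]_d, map_mx intr c *m B = 0 -> c = 0).
Proof.
have sB : size (rowseq B) = d by rewrite size_map size_enum_ord.
have nB (i : 'I_d) : (rowseq B)`_i = row i B.
  by rewrite (nth_map i) ?size_enum_ord// nth_ord_enum.
split=> h c.
  move=> c0; apply/rowP => i; rewrite mxE.
  rewrite -(h (fun j => c 0 (cast_ord sB j)) _ (cast_ord (esym sB) i)) ?cast_ordKV//.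
  rewrite -[RHS]c0 mulmx_sum_row [RHS](reindex (cast_ord sB)) /=; last first.
    by exists (cast_ord (esym sB)) => j _; [exact: cast_ordK|exact: cast_ordKV].
  by apply: eq_bigr => j _; rewrite !mxE scaler_int -nB.
move=> c0 i; have : \row_j c (cast_ord (esym sB) j) = 0.
  apply: h; rewrite -[RHS]c0 mulmx_sum_row (reindex (cast_ord sB)) /=; last first.
    by exists (cast_ord (esym sB)) => j _; [exact: cast_ordK|exact: cast_ordKV].
  by apply: eq_bigr => j _; rewrite !mxE scaler_int cast_ordK -nB.
by move=> /rowP/(_ (cast_ord sB i)); rewrite !mxE cast_ordK.
Qed.

(** The two matrices of change of basis are integral and inverse to each
    other. *)
Lemma Zbasis_change d (B B' : 'M[R]_(d, r)) (L : set 'rV[R]_r) :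
  Zbasis L (rowseq B) -> Zbasis L (rowseq B') ->
  exists2 U : 'M[R]_d, B = U *m B' & `|\det U| = 1.
Proof.
have key (A A' : 'M[R]_(d, r)) : Zbasis L (rowseq A) -> Zbasis L (rowseq A') ->
    exists U : 'M[int]_d, A = map_mx intr U *m A'.
  move=> [LA _] [LA' _].
  have /choice[c hc] (i : 'I_d) : exists c : 'rV[int]_d, row i A = map_mx intr c *m A'.
    apply/Zspan_rowseq; rewrite -LA' LA; apply/Zspan_rowseq.
    exists (delta_mx 0 i); rewrite rowE; congr (_ *m _).
    by apply/matrixP => k j; rewrite !mxE; case: (_ && _).
  exists (\matrix_i c i); apply/row_matrixP => i; rewrite row_mul -map_row rowK.
  exact: hc.
move=> hB hB'; have [U hU] := key _ _ hB hB'; have [U' hU'] := key _ _ hB' hB.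
have UU : U *m U' = 1%:M.
  apply/eqP; rewrite -subr_eq0; apply/eqP/row_matrixP => i; rewrite row0.
  apply: ((Zindep_rowseq B).1 hB.2); rewrite map_row rowE -mulmxA.
  rewrite map_mxB map_mxM map_mx1 mulmxBl mul1mx -mulmxA -hU' -hU subrr mulmx0 //.
exists (map_mx intr U) => //; rewrite det_map_mx.
have : \det U * \det U' = 1 by rewrite -det_mulmx UU det1.
move=> /(congr1 absz); rewrite abszM => /eqP; rewrite muln_eq1 => /andP[/eqP dU _].
by rewrite -intr_norm -abszE dU.
Qed.

End Lattices.

Section Fibers.
Variables (R : realType).

Definition orthant N : set 'rV[R]_N := [set t | forall i, 0 <= t 0 i].

Definition orthant_ind N (t : 'rV[R]_N) : \bar R := (\1_(@orthant N) t)%:E.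

Lemma tame_orthant_ind N : tame (@orthant_ind N).
Proof.
split=> [t|d T f mf]; first by rewrite lee_fin.
apply/measurable_EFinP.
rewrite [X in measurable_fun _ X](_ : _ =
    \1_(\bigcap_(i in [set: 'I_N]) [set x | 0 <= f x 0 i])); last first.
  apply/funext => x /=; rewrite /indic; congr (_%:R); congr (nat_of_bool _).
  by apply/idP/idP; rewrite !inE => h i //=; exact: h.
apply: measurable_indic; apply: fin_bigcap_measurable => // i _.
rewrite -[X in measurable X]setTI.
have -> : [set x | 0 <= f x 0 i] = (fun x => f x 0 i) @^-1` `[0, +oo[.
  by apply/seteqP; split => x /=; rewrite in_itv /= andbT.
exact: (mf i measurableT).
Qed.

Lemma lebesgue_volE N m (K : 'M[R]_(m, N)) (A : set 'rV[R]_N) t :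
  lebesgue_vol [set s | A (t + s *m K)] = iter_int (rowseq K) (fun t => (\1_A t)%:E) t.
Proof.
elim: m K t => [|m IH] K t /=.
  rewrite /rowseq (size0nil (size_enum_ord 0)) /= /indic; congr (_%:R%:E).
  congr (nat_of_bool _); apply/idP/idP; rewrite !inE /=.
    by rewrite (flatmx0 K) mulmx0 addr0.
  by rewrite (flatmx0 K) mulmx0 addr0.
have KE : K = col_mx (usubmx (K : 'M[R]_(1 + m, N))) (dsubmx (K : 'M[R]_(1 + m, N))).
  by rewrite vsubmxK.
rewrite [in RHS]KE rowseq_col_mx /=; apply: eq_integral => x _.
rewrite -IH; congr lebesgue_vol; apply/funext => s /=; congr (A _).
have -> : row_mx (x%:M : 'rV[R]_1) s *m (K : 'M[R]_(1 + m, N)) =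
    mulmx (row_mx (x%:M : 'rV[R]_1) s)
      (col_mx (usubmx (K : 'M[R]_(1 + m, N))) (dsubmx (K : 'M[R]_(1 + m, N)))).
  exact: (f_equal (@mulmx R 1 (1 + m) N _) KE).
by rewrite mul_row_col mul_scalar_mx addrA.
Qed.

End Fibers.

Section FiberData.
Variables (R : realType) (r : nat).

Definition stack d m N (e : (d + m)%N = N) (A : 'M[R]_(d, N)) (B : 'M[R]_(m, N)) :
  'M[R]_N := castmx (e, erefl) (col_mx A B).

(** Adapted coordinates on the fibers of t |-> t *m M, in arbitrary
    dimensions: the definition of [vol] fixes the dimensions of a frame, which
    makes frames of different sequences incomparable. *)
Definition fiber_data N (M : 'M[R]_(N, r)) d m (e : (d + m)%N = N)
    (P : 'M[R]_(d, N)) (K : 'M[R]_(m, N)) :=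
  [/\ K *m M = 0, d = \rank M,
      Zbasis ([set a | (a <= M)%MS] `&` @Zpoints R r) (rowseq (P *m M)) &
      stack e P K \in unitmx].

Definition fiber_vol d m N (e : (d + m)%N = N) (P : 'M[R]_(d, N))
    (K : 'M[R]_(m, N)) (t : 'rV[R]_N) : \bar R :=
  (`|\det (stack e P K)|%:E * iter_int (rowseq K) (@orthant_ind R N) t)%E.

Lemma stack_decomp d m N (e : (d + m)%N = N) (P : 'M[R]_(d, N)) (K : 'M[R]_(m, N))
    k (v : 'M[R]_(k, N)) : stack e P K \in unitmx ->
  exists X Y, v = X *m P + Y *m K.
Proof.
subst N; rewrite /stack castmx_id => u.
exists (lsubmx (v *m invmx (col_mx P K))), (rsubmx (v *m invmx (col_mx P K))).
by rewrite -mul_row_col hsubmxK -mulmxA mulVmx// mulmx1.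
Qed.

Lemma fiber_ker N (M : 'M[R]_(N, r)) d m (e : (d + m)%N = N) P K
    k (v : 'M[R]_(k, N)) : fiber_data M e P K -> v *m M = 0 ->
  exists Y, v = Y *m K.
Proof.
move=> [KM dM _ u] vM; have [X [Y vE]] := stack_decomp v u.
have [X' [Y' idE]] := stack_decomp (1%:M : 'M[R]_N) u.
have PMfree : row_free (P *m M).
  have : (M <= P *m M)%MS.
    apply/submxP; exists X'; rewrite mulmxA -[LHS]mul1mx idE mulmxDl -(mulmxA Y') KM.
    by rewrite mulmx0 addr0.
  by move=> /mxrankS; rewrite -dM /row_free eqn_leq rank_leq_row => ->.
exists Y; rewrite vE; have : X *m (P *m M) = 0 *m (P *m M).
  by rewrite mul0mx -vM vE mulmxDl -(mulmxA Y) KM mulmx0 addr0 mulmxA.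
by move=> /(row_free_inj PMfree) ->; rewrite mul0mx add0r.
Qed.

(** Changing P within the lattice multiplies the determinant by 1 or -1; changing
    K by Y multiplies it by det Y, which the linear substitution in the
    integral compensates. *)
Lemma fiber_vol_indep N (M : 'M[R]_(N, r)) d m (e : (d + m)%N = N) P K P' K' t t' :
  fiber_data M e P K -> fiber_data M e P' K' -> t *m M = t' *m M ->
  fiber_vol e P K t = fiber_vol e P' K' t'.
Proof.
move=> D D' tt'; have [KM dM ZP uP] := D; have [KM' _ ZP' uP'] := D'.
have [U PU dU] := Zbasis_change ZP ZP'.
have [X XE] : exists X, P - U *m P' = X *m K'.
  by apply: (fiber_ker D'); rewrite mulmxBl PU mulmxA subrr.
have [Y YE] := fiber_ker D' KM.
have [z zE] : exists z, t - t' = z *m K'.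
  by apply: (fiber_ker D'); rewrite mulmxBl tt' subrr.
have PE : P = U *m P' + X *m K' by rewrite -XE addrCA subrr addr0.
have stackE : \det (stack e P K) = \det U * \det Y * \det (stack e P' K').
  clear -PE YE; subst N; rewrite /stack !castmx_id PE YE.
  rewrite -[Y *m K']add0r -[X in col_mx _ (X + _)](mul0mx _ P') -mul_block_col.
  by rewrite det_mulmx det_ublock.
have uY : Y \in unitmx.
  move: uP; rewrite !unitmxE !unitfE stackE !mulf_eq0 !negb_or.
  by move=> /andP[/andP[_ ->]].
rewrite /fiber_vol stackE YE iter_int_unitmx//; last exact: tame_orthant_ind.
rewrite !normrM dU mul1r EFinM -!muleA (muleCA (`|\det (stack _ _ _)|%:E)) muleA.
rewrite -EFinM mulfV ?mul1e; last by rewrite normr_eq0 -unitfE -unitmxE.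
congr (_ * _)%E; have -> : t = t' + z *m K' by rewrite -zE addrCA subrr addr0.
apply: iter_int_mulmx; first exact: tame_orthant_ind.
by move=> i; apply/mapP; exists i => //; exact: mem_enum.
Qed.

Lemma vol_fiber (Psi : seq 'rV[R]_r) N (M : 'M[R]_(N, r)) d m (e : (d + m)%N = N)
    P K t a : size Psi = N -> (forall i : 'I_N, row i M = Psi`_i) ->
  fiber_data M e P K -> t *m M = a -> vol Psi a = fiber_vol e P K t.
Proof.
move=> sN; case: N / sN M e P K t => M e P K t rM D tM.
have ME : M = mx_of_seq Psi.
  by apply/row_matrixP => i; rewrite rM row_mx_of_seq.
subst M; have dE : d = \dim <<Psi>>%VS by rewrite dim_span_rank; case: D.
subst d; have mE : m = (size Psi - \dim <<Psi>>)%N by rewrite -[X in (X - _)%N]e addKn.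
subst m; rewrite (eq_irrelevance e (subnKC (dim_span Psi))) in D *.
have sets : [set a | (a <= mx_of_seq Psi)%MS] = spanned Psi.
  by apply/seteqP; split => x /=; rewrite /spanned /= mem_span_submx.
have fp : fiber_frame (P, K).
  by case: D => D1 _ D2 D3; split => //; rewrite -sets.
have := @xgetPex _ (0, 0) [set p | @fiber_frame R r Psi p] (ex_intro _ _ fp).
rewrite /vol; set p := xget _ _ => fp'.
have D' : fiber_data (mx_of_seq Psi) (subnKC (dim_span Psi)) p.1 p.2.
  by case: fp' => D1 D2 D3; split => //; [rewrite -dim_span_rank|rewrite sets].
have aM : (a <= mx_of_seq Psi)%MS by rewrite -tM submxMl.
rewrite (_ : [set s | _] = [set s | @orthant R (size Psi) (a *m pinvmx (mx_of_seq Psi) + s *m p.2)]).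
  rewrite lebesgue_volE -[LHS]/(fiber_vol (subnKC (dim_span Psi)) p.1 p.2 _).
  by apply: (fiber_vol_indep D' D); rewrite mulmxKpV.
apply/seteqP; split => s /=; first by case.
by move=> h; split => //; rewrite mulmxDl mulmxKpV// -mulmxA; case: fp' => -> _ _;
  rewrite mulmx0 addr0.
Qed.

(** This includes the points outside the span, for which the origin chosen in
    [vol] is not in the fiber. *)
Lemma vol_out (Psi : seq 'rV[R]_r) a :
  (forall t, ~ polytope Psi a t) -> vol Psi a = 0%E.
Proof.
move=> h; rewrite /vol /=; set A := (X in lebesgue_vol X); have -> : A = set0.
  by apply/seteqP; split => // s /= hs; case: (h _ hs).
suff -> : forall m, lebesgue_vol (set0 : set 'rV[R]_m) = 0%E by rewrite mule0.
elim=> [|m IH] /=; first by rewrite indic0.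
by rewrite integral0_eq// => x _; rewrite -[RHS]IH.
Qed.

(** ** Permuting the sequence *)

Lemma iter_int_map N (f : 'rV[R]_N -> 'rV[R]_N) ks g t :
  (forall t k (x : R), f (t + x *: k) = f t + x *: f k) ->
  iter_int [seq f k | k <- ks] g (f t) = iter_int ks (g \o f) t.
Proof.
move=> hf; elim: ks t => //= k ks IH t; apply: eq_integral => x _.
by rewrite -IH hf.
Qed.

Lemma fiber_data_perm N (M : 'M[R]_(N, r)) d m (e : (d + m)%N = N) P K (s : 'S_N) :
  fiber_data M e P K -> fiber_data (row_perm s M) e (col_perm s P) (col_perm s K).
Proof.
have mul k (A : 'M[R]_(k, N)) : col_perm s A *m row_perm s M = A *m M.
  rewrite col_permE row_permE mulmxA -(mulmxA A) -perm_mxM mulVg perm_mx1 mulmx1 //.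
have eqM : (row_perm s M :=: M)%MS.
  by rewrite row_permE; apply: eqmxMfull; rewrite row_full_unit unitmx_perm.
move=> [KM dM ZP u]; split.
- by rewrite mul.
- by rewrite eqM.
- rewrite mul (_ : [set a | (a <= row_perm s M)%MS] = [set a : 'rV[R]_r | (a <= M)%MS])//.
  by apply/seteqP; split => a /=; rewrite eqM.
- have -> : stack e (col_perm s P) (col_perm s K) = col_perm s (stack e P K).
    subst N; rewrite /stack !castmx_id !col_permE -mul_col_mx //.
  by rewrite col_permE unitmx_mul u unitmx_perm.
Qed.

Lemma fiber_vol_perm N d m (e : (d + m)%N = N) P K (s : 'S_N) t :
  fiber_vol e (col_perm s P) (col_perm s K) (col_perm s t) = fiber_vol e P K t.
Proof.
rewrite /fiber_vol; congr (_%:E * _)%E.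
  have -> : stack e (col_perm s P) (col_perm s K) = col_perm s (stack e P K).
    subst N; rewrite /stack !castmx_id !col_permE -mul_col_mx //.
  by rewrite col_permE det_mulmx det_perm normrM normrX normrN1 expr1n mulr1.
have -> : rowseq (col_perm s K) = [seq col_perm s k | k <- rowseq K].
  rewrite /rowseq -map_comp; apply: eq_map => i /=.
  by apply/rowP => j; rewrite !mxE.
rewrite iter_int_map; last by move=> u k x; apply/rowP => j; rewrite !mxE.
congr iter_int; apply/funext => u /=; rewrite /orthant_ind /indic.
congr (_%:R%:E); congr (nat_of_bool _); apply/idP/idP; rewrite !inE => h i.
  by have := h (s^-1%g i); rewrite mxE permKV.
by rewrite mxE.
Qed.

Lemma vol_perm (Phi Psi : seq 'rV[R]_r) d m (e : (d + m)%N = size Psi) P K a :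
  perm_eq Phi Psi -> fiber_data (mx_of_seq Psi) e P K ->
  vol Phi a = vol Psi a.
Proof.
move=> p D; have [aM|aM] := boolP (a <= mx_of_seq Psi)%MS; last first.
  have out (Xi : seq 'rV[R]_r) : perm_eq Xi Psi -> vol Xi a = 0%E.
    move=> pX; apply: vol_out => t [_ ta]; move/negP: aM; apply.
    rewrite -mem_span_submx -(eq_span (perm_mem pX)) mem_span_submx -ta.
    exact: submxMl.
  by rewrite !out.
have [t ta] := submxP aM; pose M := mx_of_seq Psi.
have [s sE] := tuple_permP (t := in_tuple Psi) p.
have sP : size Phi = size Psi by exact: perm_size.
rewrite (@vol_fiber Psi _ M _ _ e P K t a)//; last first.
  by move=> i; rewrite row_mx_of_seq.
rewrite -(fiber_vol_perm e P K s t).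
apply: (@vol_fiber Phi _ (row_perm s M)) => //.
- move=> i; have -> : row i (row_perm s (mx_of_seq Psi)) = row (s i) M.
    by apply/rowP => j; rewrite !mxE.
  by rewrite row_mx_of_seq sE (nth_map i) ?size_enum_ord// nth_ord_enum (tnth_nth 0).
- exact: fiber_data_perm.
- rewrite ta col_permE row_permE mulmxA -(mulmxA t) -perm_mxM mulVg perm_mx1 mulmx1 //.
Qed.

End FiberData.

(** * Adding a vector to the sequence *)

Section AddingVectors.
Variables (R : realType) (r : nat).
Notation V := ('rV[R]_r).

Definition framed (Psi : seq V) := exists d m (e : (d + m)%N = size Psi) P K,
  fiber_data (mx_of_seq Psi) e P K.

(** Comparing determinants through the sequences of rows dispenses with the casts
    between the dimensions of stacked matrices. *)
Lemma det_rowseq N (X Y : 'M[R]_N) :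
  perm_eq (rowseq X) (rowseq Y) -> `|\det X| = `|\det Y|.
Proof.
have sz (Z : 'M[R]_N) : size (rowseq Z) = N by rewrite size_map size_enum_ord.
have nB (Z : 'M[R]_N) (i : 'I_N) : (rowseq Z)`_i = row i Z.
  by rewrite (nth_map i) ?size_enum_ord// nth_ord_enum.
have sY : size (rowseq Y) == N by rewrite sz.
move=> /(tuple_permP (t := Tuple sY))[s sE].
suff -> : X = row_perm s Y.
  by rewrite row_permE det_mulmx det_perm normrM normrX normrN1 expr1n mul1r.
apply/row_matrixP => i; rewrite -nB sE (nth_map i) ?size_enum_ord// nth_ord_enum.
by rewrite (tnth_nth 0) /= nB; apply/rowP => j; rewrite !mxE.
Qed.

Lemma rowseq_stack d m N (e : (d + m)%N = N) (P : 'M[R]_(d, N)) (K : 'M[R]_(m, N)) :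
  rowseq (stack e P K) = rowseq P ++ rowseq K.
Proof.
subst N; rewrite /stack castmx_id /rowseq.
have -> : enum 'I_(d + m) = [seq lshift m i | i <- enum 'I_d] ++
    [seq rshift d i | i <- enum 'I_m].
  apply: (inj_map val_inj); rewrite val_enum_ord map_cat iotaD add0n.
  congr (_ ++ _).
    by rewrite -map_comp -[LHS](val_enum_ord d); apply: eq_map.
  rewrite -map_comp -[X in iota X _]addn0 iotaDl -(val_enum_ord m) -map_comp.
  by apply: eq_map.
rewrite map_cat -!map_comp.
by congr (_ ++ _); apply: eq_map => i /=; rewrite ?rowKu ?rowKd.
Qed.

Lemma rowseq_row_mx0 m N (K : 'M[R]_(m, N)) :
  rowseq (row_mx (0 : 'cV[R]_m) K) = [seq row_mx (0 : 'rV[R]_1) k | k <- rowseq K].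
Proof.
by rewrite /rowseq -map_comp; apply: eq_map => i /=; rewrite row_row_mx row0.
Qed.

Lemma iter_int_row_mx0 N ks (x : R) (t : 'rV[R]_N) :
  iter_int [seq row_mx (0 : 'rV[R]_1) k | k <- ks] (@orthant_ind R (1 + N))
    (row_mx x%:M t) = if 0 <= x then iter_int ks (@orthant_ind R N) t else 0%E.
Proof.
elim: ks t => [|k ks IH] t /=.
  rewrite /orthant_ind /indic; case: ifPn => x0.
    congr (_%:R%:E); congr (nat_of_bool _); apply/idP/idP; rewrite !inE => h i.
      by have := h (rshift 1 i); rewrite row_mxEr.
    case: (splitP i) => j ij.
      rewrite (_ : i = lshift N j); last exact: val_inj.
      by rewrite row_mxEl mxE (ord1 j) mulr1n.
    by rewrite (_ : i = rshift 1 j); [rewrite row_mxEr|exact: val_inj].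
  rewrite memNset// => /(_ (lshift N 0)); rewrite row_mxEl mxE mulr1n.
  exact/negP.
rewrite /int_along.
under eq_integral do rewrite scale_row_mx scaler0 add_row_mx addr0 IH.
by case: ifPn => // _; rewrite integral0_eq.
Qed.

Lemma mulmx_col0 d N (P : 'M[R]_(d, N)) (M : 'M[R]_(N, r)) (phi : V) :
  row_mx (0 : 'cV[R]_d) P *m col_mx phi M = P *m M.
Proof. by rewrite mul_row_col mul0mx add0r. Qed.

(** A vector phi that depends on the sequence adds one dimension to the
    fibers. The coordinate of phi is the new parameter, so that the volume is
    an integral along phi. *)
Section Dependent.
Variables (Psi : seq V) (d m : nat) (e : (d + m)%N = size Psi)
  (P : 'M[R]_(d, size Psi)) (K : 'M[R]_(m, size Psi)) (phi : V).
Hypotheses (D : fiber_data (mx_of_seq Psi) e P K) (phiPsi : phi \in << Psi >>%VS).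

Let M := mx_of_seq Psi.
Let tau := phi *m pinvmx M.
Let P' : 'M[R]_(d, 1 + size Psi) := row_mx 0 P.
Let K' : 'M[R]_(1 + m, 1 + size Psi) := col_mx (row_mx 1%:M (- tau)) (row_mx 0 K).

Let e' : (d + (1 + m))%N = (1 + size Psi)%N.
Proof. by rewrite addnCA e. Qed.

Let tauM : tau *m M = phi.
Proof. by rewrite mulmxKpV// -mem_span_submx. Qed.

Let det_dependent : `|\det (stack e' P' K')| = `|\det (stack e P K)|.
Proof.
rewrite (@det_rowseq _ _ (col_mx (row_mx 1%:M (- tau)) (row_mx 0 (stack e P K)))).
  by rewrite (det_ublock 1%:M) det1 mul1r.
rewrite rowseq_stack !rowseq_col_mx !rowseq_row_mx0 rowseq_stack map_cat.
by rewrite -cat1s perm_catCA.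
Qed.

Let fiber_data_col : fiber_data (col_mx phi M) e' P' K'.
Proof.
have [KM dM ZP u] := D.
have eqM : (col_mx phi (mx_of_seq Psi) :=: mx_of_seq Psi)%MS.
  apply: eqmx_trans (eqmx_sym (addsmxE _ _)) _.
  apply/eqmxP/andP; split; last exact: addsmxSr.
  by rewrite addsmx_sub submx_refl -mem_span_submx phiPsi.
split.
- rewrite /K' mul_col_mx mulmx_col0 KM mul_row_col mul1mx mulNmx tauM subrr.
  exact: col_mx0.
- by rewrite eqM.
- rewrite mulmx_col0 (_ : [set a | _] = [set a : V | (a <= mx_of_seq Psi)%MS])//.
  by apply/seteqP; split => a /=; rewrite eqM.
- by rewrite unitmxE unitfE -normr_eq0 det_dependent normr_eq0 -unitfE -unitmxE.
Qed.

Lemma framed_dependent : framed (phi :: Psi).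
Proof. by exists _, _, e', P', K'; rewrite mx_of_seq_cons; exact: fiber_data_col. Qed.

Lemma vol_dependent a : vol (phi :: Psi) a =
  (\int[@lebesgue_measure R]_x (if (0 <= x)%R then vol Psi (a - x *: phi)%R else 0))%E.
Proof.
have [aM|aM] := boolP (a \in << Psi >>%VS); last first.
  rewrite vol_out; last first.
    move=> t [_ ta]; move/negP: aM; apply; rewrite -ta mulmx_mx_of_seq rpred_sum// => i _.
    rewrite rpredZ//; have := mem_nth 0 (ltn_ord i); rewrite inE => /orP[/eqP ->//|].
    exact: memv_span.
  rewrite integral0_eq// => x _; case: ifP => // _; rewrite vol_out// => t [_ ta].
  move/negP: aM; apply; rewrite -(subrK (x *: phi) a) -ta rpredD ?rpredZ//.
  by rewrite mem_span_submx submxMl.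
move: aM; rewrite mem_span_submx => aM; pose t := a *m pinvmx M.
have tM : t *m M = a by rewrite mulmxKpV.
rewrite (@vol_fiber _ _ (phi :: Psi) _ (col_mx phi M) _ _ _ _ _ (row_mx 0 t) a erefl _ fiber_data_col).
- rewrite /fiber_vol det_dependent /K' rowseq_col_mx /= rowseq_row_mx0 /int_along.
  rewrite -ge0_integralZl//.
  + apply: eq_integral => x _.
    rewrite scale_row_mx add_row_mx add0r scalemx1 iter_int_row_mx0; case: ifP => _; last by rewrite mule0.
    rewrite (@vol_fiber _ _ Psi _ _ _ _ _ _ _ (t + x *: - tau) _ erefl _ D)//.
      by move=> i; rewrite row_mx_of_seq.
    by rewrite mulmxDl -scalemxAl mulNmx tauM tM scalerN.
  + apply: tame_line; exact/tame_iter_int/tame_orthant_ind.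
  + by move=> x _; apply: (tame_iter_int _ (tame_orthant_ind _ _)).1.
- by move=> i; rewrite -(row_mx_of_seq (i : 'I_(size (phi :: Psi)))) mx_of_seq_cons.
- by rewrite mulmx_col0.
Qed.

End Dependent.

(** A vector phi off the hyperplane spanned by the sequence: the fibers keep
    their dimension, the coordinate of phi being determined by the level. *)
Section Transversal.
Variables (E : 'cV[R]_r) (Psi : seq V) (d m : nat) (e : (d + m)%N = size Psi)
  (P : 'M[R]_(d, size Psi)) (K : 'M[R]_(m, size Psi)) (phi e0 : V).
Hypotheses (D : fiber_data (mx_of_seq Psi) e P K)
  (spanPsi : forall a : V, (a \in << Psi >>%VS) <-> pairing a E = 0)
  (phiE : pairing phi E != 0) (dualE : dual_lattice E)
  (Ze0 : Zpoints e0) (lev_e0 : pairing e0 E = 1).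

Let M := mx_of_seq Psi.
Let rho := (e0 - (pairing phi E)^-1 *: phi) *m pinvmx M.
Let P' : 'M[R]_(1 + d, 1 + size Psi) :=
  col_mx (row_mx ((pairing phi E)^-1)%:M rho) (row_mx 0 P).
Let K' : 'M[R]_(m, 1 + size Psi) := row_mx 0 K.

Let e' : ((1 + d) + m)%N = (1 + size Psi)%N.
Proof. by rewrite -addnA e. Qed.

Let submxE (a : V) : (a <= M)%MS <-> pairing a E = 0.
Proof. by rewrite -mem_span_submx. Qed.

Let det_transversal :
  `|\det (stack e' P' K')| = `|pairing phi E|^-1 * `|\det (stack e P K)|.
Proof.
rewrite (@det_rowseq _ _ (col_mx (row_mx ((pairing phi E)^-1)%:M rho)
    (row_mx 0 (stack e P K)))).
  by rewrite (det_ublock ((pairing phi E)^-1)%:M) det_scalar1 normrM normfV.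
by rewrite rowseq_stack !rowseq_col_mx !rowseq_row_mx0 rowseq_stack map_cat.
Qed.

Let PM' : P' *m col_mx phi M = col_mx e0 (P *m M).
Proof.
rewrite /P' mul_col_mx mulmx_col0 mul_row_col mul_scalar_mx mulmxKpV.
  by rewrite addrCA subrr addr0.
by apply/submxE; rewrite pairingBl pairingZl mulVf// lev_e0 subrr.
Qed.

Let fullM (a : V) : (a <= col_mx phi M)%MS.
Proof.
rewrite -addsmxE -(subrK ((pairing a E / pairing phi E) *: phi) a) addrC.
apply: addmx_sub_adds; first exact: scalemx_sub.
by apply/submxE; rewrite pairingBl pairingZl divfK// subrr.
Qed.

Let fiber_data_col : fiber_data (col_mx phi M) e' P' K'.
Proof.
have [KM dM ZP u] := D; split.
- by rewrite mulmx_col0.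
- apply/eqP; rewrite eqn_leq dM; apply/andP; split.
    apply: (@rank_ltmx _ _ _ _ M (col_mx phi M)); apply/andP; split.
      by rewrite -addsmxE addsmxSr.
    apply/negP => h; have := submx_trans (fullM phi) h.
    by move=> /submxE/eqP; exact/negP.
  rewrite -addsmxE (leq_trans (mxrank_adds_leqif _ _).1)// leq_add2r.
  exact: rank_leq_row.
- have {ZP}[LB indB] := ZP; rewrite PM'; split; last first.
    apply/Zindep_rowseq => c; rewrite -[c]hsubmxK map_row_mx mul_row_col => c0.
    have l0 : lsubmx (c : 'rV[int]_(1 + d)) = 0.
      have : pairing (map_mx intr (lsubmx (c : 'rV[int]_(1 + d))) *m e0 +
          map_mx intr (rsubmx (c : 'rV[int]_(1 + d))) *m (P *m M)) E = 0.
        by rewrite c0 pairing0l.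
      rewrite pairingDl [X in _ + X](_ : _ = 0) ?addr0; last first.
        by apply/submxE; rewrite mulmxA submxMl.
      rewrite [map_mx _ _]mx11_scalar mul_scalar_mx pairingZl lev_e0 mulr1 mxE.
      move=> /eqP; rewrite intr_eq0 => /eqP h; apply/rowP => i.
      by rewrite (ord1 i) h mxE.
    move: c0; rewrite l0 map_mx0 mul0mx add0r => /((Zindep_rowseq _).1 indB) ->.
    exact: row_mx0.
  apply/seteqP; split => [a [_ /= Za]|a /Zspan_rowseq[c ->]].
    apply/Zspan_rowseq.
    have /intrP[n nE] := dualE Za.
    have : ([set a | (a <= M)%MS] `&` @Zpoints R r) (a - n%:~R *: e0).
      split; last by apply: ZpointsB => //; apply: ZpointsZ => //; exact: intr_int.
      by apply/submxE; rewrite pairingBl pairingZl lev_e0 mulr1 -nE subrr.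
    rewrite LB => /Zspan_rowseq[c' c'E]; exists (row_mx n%:M c').
    by rewrite map_row_mx mul_row_col -c'E map_scalar_mx mul_scalar_mx addrC subrK.
  split; first exact: fullM.
  rewrite -[c]hsubmxK map_row_mx mul_row_col; apply: ZpointsD.
    rewrite [map_mx _ _]mx11_scalar mul_scalar_mx mxE; apply: ZpointsZ; [exact: intr_int|exact: Ze0].
  have : Zspan (rowseq (P *m M)) (map_mx intr (rsubmx (c : 'rV[int]_(1 + d))) *m (P *m M)).
    by apply/Zspan_rowseq; eexists.
  by rewrite -LB => -[].
- rewrite unitmxE unitfE -normr_eq0 det_transversal.
  by rewrite mulf_neq0// ?invr_eq0 ?normr_eq0// -unitfE -unitmxE.
Qed.

Lemma framed_transversal : framed (phi :: Psi).
Proof. by exists _, _, e', P', K'; rewrite mx_of_seq_cons; exact: fiber_data_col. Qed.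

Lemma vol_transversal a : vol (phi :: Psi) a =
  (if (0 <= pairing a E / pairing phi E)%R
   then `|pairing phi E|^-1%:E * vol Psi (wall_proj E phi a) else 0)%E.
Proof.
have wM : (wall_proj E phi a <= M)%MS by apply/submxE; exact: lev_wall_proj.
pose x := pairing a E / pairing phi E; pose t := wall_proj E phi a *m pinvmx M.
rewrite (@vol_fiber _ _ (phi :: Psi) _ (col_mx phi M) _ _ _ _ _ (row_mx x%:M t) a erefl _ fiber_data_col).
- rewrite /fiber_vol det_transversal rowseq_row_mx0 iter_int_row_mx0 -/x.
  case: ifP => _; last by rewrite mule0.
  rewrite (@vol_fiber _ _ Psi _ _ _ _ _ _ _ t _ erefl _ D) ?mulmxKpV//.
    by rewrite EFinM muleA.
  by move=> i; rewrite row_mx_of_seq.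
- by move=> i; rewrite -(row_mx_of_seq (i : 'I_(size (phi :: Psi)))) mx_of_seq_cons.
- by rewrite mul_row_col mul_scalar_mx mulmxKpV// addrC /wall_proj subrK.
Qed.

End Transversal.

End AddingVectors.

(** * Lattice bases adapted to a hyperplane *)

Section HyperplaneLattice.
Variables (R : realType).

Lemma Zpoints_intr n (a : 'rV[R]_n) : Zpoints a -> exists c : 'rV[int]_n, a = map_mx intr c.
Proof.
move=> Za; have /choice[c hc] (i : 'I_n) : exists z : int, a 0 i = z%:~R by exact/intrP/Za.
by exists (\row_i c i); apply/rowP => i; rewrite !mxE hc.
Qed.

Lemma intr_Zpoints n (c : 'rV[int]_n) : Zpoints (map_mx intr c : 'rV[R]_n).
Proof. by move=> i; rewrite mxE intr_int. Qed.

Lemma Zpoints_mul n k (c : 'rV[int]_k) (A : 'M[int]_(k, n)) :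
  Zpoints (map_mx intr c *m map_mx intr A : 'rV[R]_n).
Proof. by rewrite -map_mxM; exact: intr_Zpoints. Qed.

(** The Smith normal form of the column E is a multiple of the first basis
    vector, with factor 1 or -1 as E is primitive: the change of basis gives
    coordinates of the lattice in which the first one is the level. *)
Lemma hyperplane_basis n (E : 'cV[R]_(1 + n)) : primitive E ->
  exists (e0 : 'rV[R]_(1 + n)) (B : 'M[R]_(n, 1 + n)),
    [/\ Zpoints e0, pairing e0 E = 1, row_free B,
        forall a : 'rV[R]_(1 + n), (a <= B)%MS <-> pairing a E = 0 &
        Zbasis ([set a | pairing a E = 0] `&` @Zpoints R (1 + n)) (rowseq B)].
Proof.
move=> [dE pE].
have /choice[Ei hE] (i : 'I_(1 + n)) : exists z : int, E i 0 = z%:~R.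
  apply/intrP; have := dE (delta_mx 0 i); rewrite /pairing -rowE mxE; apply.
  by move=> j; rewrite mxE; case: (_ && _).
have EE : E = map_mx intr (\col_i Ei i).
  by apply/colP => i; rewrite !mxE.
have [L uL [U uU [d _ SE]]] := int_Smith_normal_form (\col_i Ei i).
pose g : int := d`_0 * U 0 0; pose G := invmx L.
have EiE : \col_i Ei i = g *: (L *m delta_mx 0 0).
  rewrite SE [U]mx11_scalar mul_mx_scalar -/(U 0 0).
  have -> : \matrix_(i < 1 + n, j < 1) (d`_i *+ (i == j :> nat)) =
      d`_0 *: (delta_mx 0 0 : 'cV[int]_(1 + n)).
    apply/matrixP => i j; rewrite (ord1 j) !mxE eqxx andbT.
    case: (eqVneq i 0) => [->|i0]; first by rewrite mulr1.
    by rewrite (_ : (i == _ :> nat) = false) ?mulr0//; apply/negbTE.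
  by rewrite -scalemxAr scalerA mulrC.
pose LR : 'M[R]_(1 + n) := map_mx intr L; pose GR : 'M[R]_(1 + n) := map_mx intr G.
have GL : GR *m LR = 1%:M by rewrite -map_mxM mulVmx// map_mx1.
have LG : LR *m GR = 1%:M by rewrite -map_mxM mulmxV// map_mx1.
have levE a : pairing a E = g%:~R * (a *m LR) 0 0.
  rewrite /pairing EE EiE map_mxZ map_mxM -scalemxAr mxE; congr (_ * _).
  by rewrite mulmxA map_delta_mx -colE mxE.
have g1 : g * g = 1.
  have gE : E = (map_mx intr (L *m delta_mx 0 0) *~ sgz g) *+ `|g|%N.
    rewrite EE EiE map_mxZ -scaler_int -scaler_nat scalerA; congr (_ *: _).
    by rewrite (pmulrn 1) -intrM mulrC -intEsg.
  have := pE _ _ _ gE; rewrite -[X in _ -> X]/(_ = 1) => h.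
  have {h} : `|g|%N = 1%N.
    apply: h => a /Zpoints_intr[c ->]; rewrite -scaler_int pairingZr.
    rewrite rpredM ?intr_int// /pairing -map_mxM mxE intr_int //.
  by move=> h; rewrite -expr2 -real_normK ?num_real// -abszE h.
pose B : 'M[R]_(n, 1 + n) := dsubmx GR.
have BL i : (B *m LR) i 0 = 0.
  by rewrite mul_dsub_mx GL !mxE.
have BR : B *m rsubmx LR = 1%:M.
  rewrite mul_dsub_mx mulmx_rsub GL; apply/matrixP => i j.
  by rewrite !mxE eq_rshift.
exists (g%:~R *: usubmx GR), B; split.
- apply: ZpointsZ; first exact: intr_int.
  by move=> i; rewrite !mxE intr_int.
- rewrite levE -scalemxAl mxE mulrA -intrM g1 mul1r mul_usub_mx GL.
  rewrite !mxE (_ : lshift n 0 = 0) ?eqxx//; exact: val_inj.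
- apply/row_freeP; exists (rsubmx LR).
  exact: BR.
- move=> a; split=> [/submxP[c ->]|].
    rewrite levE -mulmxA [(_ *m (_ *m _)) 0 0]mxE big1 ?mulr0// => i _.
    by rewrite BL mulr0.
  rewrite levE => /eqP; rewrite mulf_eq0 intr_eq0.
  have -> : (g == 0) = false by apply/eqP => g0; move: g1; rewrite g0 mul0r.
  move=> /eqP a0; apply/submxP; exists (rsubmx (a *m LR)).
  rewrite -[LHS]mulmx1 -LG mulmxA -[a *m LR in LHS]hsubmxK -[GR in LHS]vsubmxK mul_row_col.
  rewrite [lsubmx _](_ : _ = 0) ?mul0mx ?add0r//; apply/rowP => i.
  by rewrite (ord1 i) [RHS]mxE mxE -[RHS]a0; congr (_ _ _); exact: val_inj.
- split; last first.
    apply/Zindep_rowseq => c /(congr1 (mulmx^~ (rsubmx LR))).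
    rewrite -mulmxA BR mulmx1 mul0mx => /rowP c0; apply/rowP => i.
    by have := c0 i; rewrite !mxE => /eqP; rewrite intr_eq0 => /eqP.
  apply/seteqP; split => [a [/= la /Zpoints_intr[c aE]]|a /Zspan_rowseq[c ->]].
    apply/Zspan_rowseq; exists (rsubmx (c *m L)).
    move: la; rewrite levE => /eqP; rewrite mulf_eq0 intr_eq0.
    have -> : (g == 0) = false by apply/eqP => g0; move: g1; rewrite g0 mul0r.
    move=> /eqP a0; rewrite -[LHS]mulmx1 -LG mulmxA -[a *m LR in LHS]hsubmxK.
    rewrite -[GR in LHS]vsubmxK mul_row_col.
    rewrite [lsubmx _](_ : _ = 0) ?mul0mx ?add0r.
      by rewrite aE /LR -map_mxM map_rsubmx.
    apply/rowP => i; rewrite (ord1 i) [RHS]mxE mxE -[RHS]a0.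
    by congr (_ _ _); exact: val_inj.
  split; last by rewrite /B -map_dsubmx; exact: Zpoints_mul.
  rewrite /= levE -mulmxA [(_ *m (_ *m _)) 0 0]mxE big1 ?mulr0// => i _.
  by rewrite BL mulr0.
Qed.

End HyperplaneLattice.

Section Framing.
Variables (R : realType) (r : nat).
Notation V := ('rV[R]_r).

Lemma stack_unit d m N (e : (d + m)%N = N) (P : 'M[R]_(d, N)) (K : 'M[R]_(m, N)) :
  (forall (X : 'rV_d) (Y : 'rV_m), X *m P + Y *m K = 0 -> X = 0 /\ Y = 0) -> stack e P K \in unitmx.
Proof.
move: P K; subst N => P K h; rewrite /stack castmx_id -row_free_unit -kermx_eq0.
apply/rowV0P => v /sub_kermxP; rewrite -[v]hsubmxK mul_row_col => /h[-> ->].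
exact: row_mx0.
Qed.

(** Lift a lattice basis of the span and complete it by a basis of the kernel. *)
Lemma framed_basis n (B : 'M[R]_(n, r)) (Psi : seq V) :
  row_free B -> (B :=: mx_of_seq Psi)%MS ->
  Zbasis ([set a | (a <= B)%MS] `&` @Zpoints R r) (rowseq B) -> framed Psi.
Proof.
move=> fB BM ZB; pose M := mx_of_seq Psi.
have rB : \rank B = n by exact/eqP.
have e : (n + \rank (kermx M))%N = size Psi.
  by rewrite mxrank_ker -BM rB subnKC// -{1}rB BM rank_leq_row.
exists n, (\rank (kermx M)), e, (B *m pinvmx M), (row_base (kermx M)).
have KM : row_base (kermx M) *m M = 0 by apply/sub_kermxP; rewrite eq_row_base.
have PM : B *m pinvmx M *m M = B by rewrite mulmxKpV// BM.
split=> //; first by rewrite -BM rB.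
  rewrite PM (_ : [set a | _] = [set a : V | (a <= B)%MS])//.
  by apply/seteqP; split => a /=; rewrite BM.
apply: stack_unit => X Y XY.
have X0 : X = 0.
  have : (X *m (B *m pinvmx M) + Y *m row_base (kermx M)) *m M = 0 by rewrite XY mul0mx.
  rewrite mulmxDl -(mulmxA Y) KM mulmx0 addr0 -mulmxA PM => XB.
  by apply: (row_free_inj fB); rewrite mul0mx.
split=> //; move: XY; rewrite X0 mul0mx add0r => Y0.
by apply: (row_free_inj (row_base_free (kermx M))); rewrite mul0mx.
Qed.

End Framing.

(** * Bounds and recursion for volumes *)

Section VolumeBounds.
Variables (R : realType) (r : nat) (lam : 'cV[R]_r).
Notation V := ('rV[R]_r).
Notation mu := (@lebesgue_measure R).

Definition bounded_vol (Psi : seq V) := forall M : R, exists C : R,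
  0 <= C /\ forall a, `|a| <= M -> (vol Psi a <= C%:E)%E.

Lemma vol_ge0 (Psi : seq V) a : framed Psi -> (0 <= vol Psi a)%E.
Proof.
move=> [d [m [e [P [K D]]]]]; have [aM|aM] := boolP (a <= mx_of_seq Psi)%MS; last first.
  by rewrite vol_out// => t [_ ta]; move/negP: aM; apply; rewrite -ta submxMl.
rewrite (@vol_fiber _ _ Psi _ _ _ _ _ _ _ (a *m pinvmx (mx_of_seq Psi)) a erefl _ D).
- by rewrite mule_ge0//; apply: (tame_iter_int _ (tame_orthant_ind _ _)).1.
- by move=> i; rewrite row_mx_of_seq.
- by rewrite mulmxKpV.
Qed.

Lemma measurable_vol_line (Psi : seq V) a phi : framed Psi -> phi \in << Psi >>%VS ->
  measurable_fun setT (fun x : R => vol Psi (a - x *: phi)).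
Proof.
move=> [d [m [e [P [K D]]]]]; rewrite mem_span_submx => phiM.
have [aM|aM] := boolP (a <= mx_of_seq Psi)%MS; last first.
  apply: (eq_measurable_fun (cst 0%E)) => // x _.
  rewrite vol_out// => t [_ ta]; move/negP: aM; apply.
  by rewrite -(subrK (x *: phi) a) -ta addmx_sub ?submxMl// scalemx_sub.
pose t := a *m pinvmx (mx_of_seq Psi); pose k := - (phi *m pinvmx (mx_of_seq Psi)).
apply: (eq_measurable_fun (fun x : R => fiber_vol e P K (t + x *: k))) => [x _|].
  rewrite (@vol_fiber _ _ Psi _ _ _ _ _ _ _ (t + x *: k) _ erefl _ D)//.
    by move=> i; rewrite row_mx_of_seq.
  by rewrite mulmxDl -scalemxAl mulNmx !mulmxKpV// scalerN.
apply: measurable_funeM.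
apply: (tame_line t k (g := iter_int (rowseq K) (@orthant_ind R (size Psi)))).
exact: (tame_iter_int _ (tame_orthant_ind _ _)).
Qed.

Lemma vol_neg (Psi : seq V) a : (forall psi, psi \in Psi -> 0 <= pairing psi lam) ->
  pairing a lam < 0 -> vol Psi a = 0%E.
Proof.
move=> h al; rewrite vol_out// => t [t0 ta]; move: al; apply/negP; rewrite -leNgt.
rewrite -ta mulmx_mx_of_seq pairing_suml sumr_ge0// => i _.
by rewrite pairingZl mulr_ge0// h// mem_nth.
Qed.

Lemma vol_dependent_ray (Psi : seq V) phi a : framed Psi -> phi \in << Psi >>%VS ->
  vol (phi :: Psi) a = (\int[mu]_(x in `[0%R, +oo[) vol Psi (a - x *: phi)%R)%E.
Proof.
move=> [d [m [e [P [K D]]]]] p; rewrite (vol_dependent D)// [RHS]integral_mkcond.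
apply: eq_integral => x _; rewrite patchE; congr (if _ then _ else _).
by apply/idP/idP; rewrite inE /= in_itv /= andbT.
Qed.

Lemma framed_cons (Psi : seq V) phi : framed Psi -> phi \in << Psi >>%VS ->
  framed (phi :: Psi).
Proof. by move=> [d [m [e [P [K D]]]]] p; exact: framed_dependent D p. Qed.

(** The ray leaves the half-space, hence the support of the volume, after a
    time bounded in terms of the norm. *)
Lemma bounded_vol_cons (Psi : seq V) phi :
  (forall psi, psi \in phi :: Psi -> 0 < pairing psi lam) ->
  framed Psi -> phi \in << Psi >>%VS -> bounded_vol Psi -> bounded_vol (phi :: Psi).
Proof.
move=> pos fP pP bP M; have lphi : 0 < pairing phi lam by rewrite pos// mem_head.
pose X := Num.max 0 (l1norm lam * M / pairing phi lam).
have X0 : 0 <= X by rewrite le_max lexx.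
have [C [C0 hC]] := bP (M + X * `|phi|).
exists (C * X); split; first exact: mulr_ge0.
move=> a aM; rewrite vol_dependent_ray//.
have mf : measurable_fun setT (fun x : R => vol Psi (a - x *: phi)).
  exact: measurable_vol_line.
apply: (@le_trans _ _ (\int[mu]_(x in `[0%R, X]) C%:E)%E); last first.
  rewrite integral_cst//= lebesgue_measure_itv /= lte_fin.
  case: ifP => _; first by rewrite oppr0 adde0.
  by rewrite mule0 lee_fin mulr_ge0.
rewrite integral_mkcond [leRHS]integral_mkcond; apply: ge0_le_integral => //.
- by move=> x _; rewrite patchE; case: ifP => // _; exact: vol_ge0.
- apply/(measurable_restrictT _ _).1 => //; exact: measurable_funS mf.
- by apply/(measurable_restrictT _ _).1.
move=> x _; rewrite !patchE.
have -> : (x \in `[0, +oo[%classic) = (0 <= x).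
  by apply/idP/idP; rewrite inE /= in_itv /= andbT.
have -> : (x \in `[0, X]%classic) = (0 <= x) && (x <= X).
  by apply/idP/idP; rewrite inE /= in_itv.
case: ifPn => //= x0; case: ifPn => xX.
  apply: hC; rewrite (le_trans (ler_normB _ _))// lerD// normrZ ger0_norm//.
  by rewrite ler_wpM2r.
rewrite vol_neg// => [psi pp|]; first by rewrite ltW// pos// inE pp orbT.
rewrite pairingBl pairingZl subr_lt0 -ltr_pdivrMr//.
move: xX; rewrite -ltNge gt_max => /andP[_]; apply: le_lt_trans.
rewrite ler_pM2r ?invr_gt0// (le_trans (ler_norm _))// (le_trans (pairing_le _ _))//.
by rewrite ler_wpM2l// l1norm_ge0.
Qed.

(** The fibers of a free family are points. *)
Lemma bounded_vol_free (nu : seq V) : free nu -> framed nu -> bounded_vol nu.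
Proof.
move=> fnu [d [m [e [P [K D]]]]] M.
have m0 : m = 0%N.
  have [_ dM _ _] := D; move: fnu; rewrite /free dim_span_rank -dM -{1}e.
  by move=> /eqP; lia.
subst m; exists `|\det (stack e P K)|; split => // a _.
have [aM|aM] := boolP (a <= mx_of_seq nu)%MS; last first.
  rewrite vol_out ?lee_fin// => t [_ ta]; move/negP: aM; apply.
  by rewrite -ta submxMl.
rewrite (@vol_fiber _ _ nu _ _ _ _ _ _ _ (a *m pinvmx (mx_of_seq nu)) a erefl _ D).
- rewrite /fiber_vol /rowseq (size0nil (size_enum_ord 0)) /= -EFinM lee_fin.
  by rewrite ler_piMr// /indic; case: (_ \in _).
- by move=> i; rewrite row_mx_of_seq.
- by rewrite mulmxKpV.
Qed.

Lemma bounded_vol_transversal (E : 'cV[R]_r) (Psi : seq V) (phi e0 : V) :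
  framed Psi -> (forall a : V, (a \in << Psi >>%VS) <-> pairing a E = 0) ->
  pairing phi E != 0 -> dual_lattice E -> Zpoints e0 -> pairing e0 E = 1 ->
  bounded_vol Psi -> framed (phi :: Psi) /\ bounded_vol (phi :: Psi).
Proof.
move=> [d [m [e [P [K D]]]]] sP pE dE Ze le bP; split.
  exact: (framed_transversal D sP pE dE Ze le).
move=> M; have [C [C0 hC]] := bP (M + l1norm E * M / `|pairing phi E| * `|phi|).
exists (`|pairing phi E|^-1 * C); split; first by rewrite mulr_ge0// invr_ge0.
move=> a aM; rewrite (vol_transversal D sP pE dE Ze le); case: ifP => _; last first.
  by rewrite lee_fin mulr_ge0// invr_ge0.
rewrite EFinM lee_pmul2l ?lte_fin ?invr_gt0 ?normr_gt0//; apply: hC.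
rewrite /wall_proj (le_trans (ler_normB _ _))// lerD// normrZ ler_wpM2r//.
rewrite normrM normfV ler_pM2r ?invr_gt0 ?normr_gt0//.
by rewrite (le_trans (pairing_le _ _))// ler_wpM2l// l1norm_ge0.
Qed.

Lemma span_cons_mem (Psi : seq V) phi a : a \in << Psi >>%VS -> a \in << phi :: Psi >>%VS.
Proof. by move=> h; rewrite span_cons -[a]add0r memv_add// mem0v. Qed.

Lemma bounded_vol_cat (s Psi : seq V) :
  (forall psi, psi \in s ++ Psi -> 0 < pairing psi lam) ->
  (forall phi, phi \in s -> phi \in << Psi >>%VS) ->
  framed Psi -> bounded_vol Psi -> framed (s ++ Psi) /\ bounded_vol (s ++ Psi).
Proof.
elim: s => //= phi s IH pos sP fP bP.
have [] := IH _ _ fP bP.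
- by move=> psi h; rewrite pos// inE h orbT.
- by move=> psi h; rewrite sP// inE h orbT.
move=> fsP bsP; have p : phi \in << s ++ Psi >>%VS.
  by rewrite (subvP (sub_span _) _ (sP _ (mem_head _ _)))// => x h; rewrite mem_cat h orbT.
by split; [exact: framed_cons|exact: bounded_vol_cons].
Qed.

End VolumeBounds.

Section VolumeSteps.
Variables (R : realType) (r : nat) (lam E : 'cV[R]_r) (e0 : 'rV[R]_r).
Variables (s Phi0 : seq 'rV[R]_r).
Notation V := ('rV[R]_r).
Notation mu := (@lebesgue_measure R).
Hypotheses (dualE : dual_lattice E) (Ze0 : Zpoints e0) (lev_e0 : pairing e0 E = 1)
  (span0 : forall a : V, (a \in << Phi0 >>%VS) <-> pairing a E = 0)
  (pos : forall psi, psi \in s ++ Phi0 -> 0 < pairing psi lam)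
  (levs : forall phi, phi \in s -> pairing phi E != 0)
  (framed0 : framed Phi0) (bounded0 : bounded_vol Phi0).

Let F (u : seq V) (a : V) := fine (vol (u ++ Phi0) a).

Lemma vol_cat_facts phi u : (forall x, x \in phi :: u -> x \in s) ->
  [/\ framed (phi :: u ++ Phi0), bounded_vol (phi :: u ++ Phi0) &
      forall a : V, a \in << phi :: u ++ Phi0 >>%VS].
Proof.
elim: u phi => [|psi u IH] phi sub /=.
  have pE : pairing phi E != 0 by apply: levs; apply: sub; rewrite mem_head.
  have [f b] := bounded_vol_transversal framed0 span0 pE dualE Ze0 lev_e0 bounded0.
  split=> // a; rewrite -(subrK ((pairing a E / pairing phi E) *: phi) a).
  rewrite rpredD//; last by rewrite rpredZ// memv_span// mem_head.
  apply: span_cons_mem; apply/span0.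
  by rewrite pairingBl pairingZl divfK// subrr.
have [|f b full] := IH psi; first by move=> x xu; apply: sub; rewrite inE xu orbT.
split; [exact: framed_cons| |by move=> a; exact: span_cons_mem].
apply: (bounded_vol_cons (lam := lam)) => // x; rewrite -cat_cons -cat_cons mem_cat.
by case/orP => xu; apply: pos; rewrite mem_cat ?xu ?orbT// sub.
Qed.

Let vol_fin phi u a : (forall x, x \in phi :: u -> x \in s) ->
  (F (phi :: u) a)%:E = vol (phi :: u ++ Phi0) a.
Proof.
move=> /vol_cat_facts[f b _]; rewrite fineK//.
have [C [_ hC]] := b `|a|; rewrite fin_numElt (lt_le_trans (ltNyr 0) (vol_ge0 a f)) /=.
by rewrite (le_lt_trans (hC _ _)) ?ltry.
Qed.

Let measurable_vol phi u a k : (forall x, x \in phi :: u -> x \in s) ->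
  measurable_fun setT (fun x : R => vol (phi :: u ++ Phi0) (a - x *: k)).
Proof. by move=> /vol_cat_facts[f _ full]; exact: measurable_vol_line. Qed.

Lemma vol_line_integrable h phi u : 0 <= h -> (forall x, x \in phi :: u -> x \in s) ->
  line_integrable h (F (phi :: u)).
Proof.
move=> h0 sub a k; have [f b full] := vol_cat_facts sub.
have [C [C0 hC]] := b (`|a| + h * `|k|).
have bound x : x \in `[0, h]%classic -> (vol (phi :: u ++ Phi0) (a - x *: k) <= C%:E)%E.
  rewrite inE /= in_itv /= => /andP[x0 xh]; apply: hC.
  by rewrite (le_trans (ler_normB _ _))// lerD// normrZ ger0_norm// ler_wpM2r.
apply: measurable_bounded_integrable => //.
- by rewrite /= lebesgue_measure_itv /=; case: ifP => _ //; rewrite -EFinB ltry.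
- apply/measurable_EFinP; apply: measurable_funTS.
  apply: (eq_measurable_fun _ _ (measurable_vol a k sub)) => x _.
  exact: (esym (vol_fin (a - x *: k) sub)).
exists C; split; first exact: num_real.
move=> M CM x xh /=; rewrite ger0_norm; last by rewrite fine_ge0// vol_ge0.
by rewrite -lee_fin vol_fin// (le_trans (bound _ (mem_set xh)))// lee_fin ltW.
Qed.

Lemma vol_step h phi psi u a : 0 <= h ->
  (forall x, x \in [:: phi, psi & u] -> x \in s) ->
  F [:: phi, psi & u] a - F [:: phi, psi & u] (a - h *: phi) =
  int_avg h phi (F (psi :: u)) a.
Proof.
move=> h0 sub.
have sub' x : x \in psi :: u -> x \in s by move=> xu; apply: sub; rewrite inE xu orbT.
have [f b full] := vol_cat_facts sub'.
pose g (x : R) := vol (psi :: u ++ Phi0) (a - x *: phi).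
have mg : measurable_fun setT g by exact: measurable_vol.
have g0 x : (0 <= g x)%E by exact: vol_ge0.
have ray b' : vol [:: phi, psi & u ++ Phi0] b' =
    (\int[mu]_(x in `[0%R, +oo[) vol (psi :: u ++ Phi0) (b' - x *: phi)%R)%E.
  exact: vol_dependent_ray.
have shifted : vol [:: phi, psi & u ++ Phi0] (a - h *: phi) =
    (\int[mu]_(x in `[h, +oo[) g x)%E.
  rewrite ray integral_mkcond [RHS]integral_mkcond.
  rewrite [RHS](@integral_affine _ 1 h)//; first last.
  - by move=> x; rewrite patchE; case: ifP.
  - by apply/(measurable_restrictT _ _).1 => //; exact: measurable_funS mg.
  rewrite normr1 mul1e; apply: eq_integral => x _; rewrite !patchE.
  have -> : (x \in `[0, +oo[%classic) = (0 <= x).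
    by apply/idP/idP; rewrite inE /= in_itv /= andbT.
  have -> : ((1 * x + h)%R \in `[h, +oo[%classic) = (0 <= x).
    by apply/idP/idP; rewrite inE /= in_itv /= andbT mul1r lerDr.
  by case: ifP => // _; rewrite /g mul1r scalerDl opprD addrA addrAC.
have split_int : vol [:: phi, psi & u ++ Phi0] a =
    (\int[mu]_(x in `[0%R, h]) g x + \int[mu]_(x in `[h, +oo[) g x)%E.
  rewrite ray -(@integral_itv_obnd_cbnd _ h); last exact: measurable_funTS.
  rewrite -ge0_integral_setU//=.
  - congr integral; apply/seteqP; split => x /=; rewrite !in_itv /= !andbT.
      by move=> ->; case: (leP x h) => _; [left|right].
    by move=> [/andP[]//|/ltW]; exact: le_trans.
  - exact: measurable_funTS.
  - rewrite disj_set2E; apply/eqP/seteqP; split => // x [].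
    by rewrite /= !in_itv /= andbT => /andP[_ xh]; rewrite ltNge xh.
have eqI : (int_avg h phi (F (psi :: u)) a)%:E = (\int[mu]_(x in `[0%R, h]) g x)%E.
  rewrite /int_avg /Rintegral fineK; last first.
    exact: integrable_fin_num (vol_line_integrable h0 sub' a phi).
  by apply: eq_integral => x _; rewrite vol_fin.
suff : (F [:: phi, psi & u] a)%:E =
    (int_avg h phi (F (psi :: u)) a + F [:: phi, psi & u] (a - h *: phi))%:E.
  by move=> [->]; rewrite addrK.
rewrite EFinD (vol_fin a sub) (vol_fin (a - h *: phi) sub) eqI.
by rewrite [LHS]split_int -shifted.
Qed.

Lemma vol_single phi a : phi \in s ->
  F [:: phi] a = if 0 <= pairing a E / pairing phi E
    then F [::] (wall_proj E phi a) / `|pairing phi E| else 0.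
Proof.
move=> ps; have [d [m [e [P [K D]]]]] := framed0.
rewrite /F /= (vol_transversal D span0 (levs ps) dualE Ze0 lev_e0).
case: ifP => // _; rewrite muleC fineM// fin_numElt.
rewrite (lt_le_trans (ltNyr 0) (vol_ge0 _ framed0)) /=.
by have [C [_ hC]] := bounded0 `|wall_proj E phi a|; rewrite (le_lt_trans (hC _ _)) ?ltry.
Qed.

End VolumeSteps.

(** * Lattice points of polytopes *)

Section Counting.
Variables (R : realType) (r : nat).
Notation V := ('rV[R]_r).

Definition card_pts (T : choiceType) (A : set T) : nat := #|` fset_set A|%fset.

Lemma card_pts_image (T U : choiceType) (f : T -> U) (A : set T) :
  finite_set A -> injective f -> card_pts (f @` A) = card_pts A.
Proof.
by move=> fA fi; rewrite /card_pts fset_set_image// card_imfset.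
Qed.

Lemma card_ptsU (T : choiceType) (A B : set T) : finite_set A -> finite_set B ->
  A `&` B = set0 -> card_pts (A `|` B) = (card_pts A + card_pts B)%N.
Proof.
move=> fA fB AB; rewrite /card_pts fset_setU// cardfsU -fset_setI// AB fset_set0.
by rewrite cardfs0 subn0.
Qed.

Definition int_fiber N (M : 'M[R]_(N, r)) (a : V) : set 'rV[R]_N :=
  [set t : 'rV[R]_N | [/\ forall i, 0 <= t 0 i, t *m M = a & Zpoints t]].

Lemma count_polytopeE (Psi : seq V) N (M : 'M[R]_(N, r)) a : size Psi = N ->
  (forall i : 'I_N, row i M = Psi`_i) -> count_polytope Psi a = card_pts (int_fiber M a).
Proof.
move=> sN; case: N / sN M => M rM.
have -> : M = mx_of_seq Psi by apply/row_matrixP => i; rewrite rM row_mx_of_seq.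
congr (size (enum_fset (fset_set _))); apply/seteqP; split => t /=.
  by move=> [[t0 tM] Zt].
by move=> [t0 tM Zt].
Qed.

Lemma count_polytope_mx (Psi : seq V) a :
  count_polytope Psi a = card_pts (int_fiber (mx_of_seq Psi) a).
Proof. by apply: count_polytopeE => // i; rewrite row_mx_of_seq. Qed.

Lemma count_polytope_cons (phi : V) Psi a :
  count_polytope (phi :: Psi) a = card_pts (int_fiber (col_mx phi (mx_of_seq Psi)) a).
Proof.
apply: count_polytopeE => // i.
by rewrite -(row_mx_of_seq (i : 'I_(size (phi :: Psi)))) mx_of_seq_cons.
Qed.

(** Splitting off the first coordinate: it is zero or at least one. *)
Lemma int_fiber_cons N (M : 'M[R]_(N, r)) (phi a : V) :
  int_fiber (col_mx phi M) a =
  (row_mx (0 : 'rV[R]_1) @` int_fiber M a) `|`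
  ((fun t => row_mx (1%:M : 'rV[R]_1) 0 + t) @` int_fiber (col_mx phi M) (a - phi)).
Proof.
apply/seteqP; split => t /=.
  rewrite -[t]hsubmxK; move: (lsubmx t) (rsubmx t) => x t' [h0 tM Zt].
  have xE : x = (x 0 0)%:M by exact: mx11_scalar.
  have l0 : lshift N 0 = lshift N 0 by [].
  have x0 : 0 <= x 0 0 by have := h0 (lshift N 0); rewrite row_mxEl.
  have Zx : x 0 0 \is a Num.int by have := Zt (lshift N 0); rewrite row_mxEl.
  have t'0 i : 0 <= t' 0 i by have := h0 (rshift 1 i); rewrite row_mxEr.
  have Zt' : Zpoints t' by move=> i; have := Zt (rshift 1 i); rewrite row_mxEr.
  case: (eqVneq (x 0 0) 0) => [xx|xx].
    left; exists t'; last by rewrite xE xx raddf0.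
    by split => //; rewrite -tM xE xx raddf0 mul_row_col mul0mx add0r.
  right; exists (row_mx (x - 1%:M) t'); last first.
    by rewrite add_row_mx add0r addrCA subrr addr0.
  have x1 : 1 <= x 0 0.
    move: Zx x0 xx => /intrP[n ->]; rewrite ler0z intr_eq0 ler1z => n0 n1.
    by rewrite -gtz0_ge1 lt_neqAle eq_sym n1 n0.
  split.
  - move=> i; case: (splitP i) => j ij.
      rewrite (_ : i = lshift N j); last exact: val_inj.
      by rewrite row_mxEl !mxE (ord1 j) mulr1n subr_ge0.
    by rewrite (_ : i = rshift 1 j); [rewrite row_mxEr|exact: val_inj].
  - by rewrite -tM !mul_row_col mulmxBl mul1mx addrAC.
  - move=> i; case: (splitP i) => j ij.
      rewrite (_ : i = lshift N j); last exact: val_inj.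
      by rewrite row_mxEl !mxE (ord1 j) mulr1n rpredB// rpred1.
    by rewrite (_ : i = rshift 1 j); [rewrite row_mxEr|exact: val_inj].
case=> -[t' [t'0 tM Zt'] <-].
  split.
  - move=> i; case: (splitP i) => j ij.
      rewrite (_ : i = lshift N j); last exact: val_inj.
      by rewrite row_mxEl mxE.
    by rewrite (_ : i = rshift 1 j); [rewrite row_mxEr|exact: val_inj].
  - by rewrite mul_row_col mul0mx add0r.
  - move=> i; case: (splitP i) => j ij.
      rewrite (_ : i = lshift N j); last exact: val_inj.
      by rewrite row_mxEl mxE rpred0.
    by rewrite (_ : i = rshift 1 j); [rewrite row_mxEr|exact: val_inj].
have one i : 0 <= row_mx (1%:M : 'rV[R]_1) (0 : 'rV[R]_N) 0 i /\
    row_mx (1%:M : 'rV[R]_1) (0 : 'rV[R]_N) 0 i \is a Num.int.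
  case: (splitP i) => j ij.
    rewrite (_ : i = lshift N j); last exact: val_inj.
    by rewrite row_mxEl mxE (ord1 j) mulr1n rpred1.
  by rewrite (_ : i = rshift 1 j); [rewrite row_mxEr mxE rpred0|exact: val_inj].
split.
- by move=> i; rewrite mxE addr_ge0//; case: (one i).
- by rewrite mulmxDl tM mul_row_col mul1mx mul0mx addr0 addrC subrK.
- by move=> i; rewrite mxE rpredD//; case: (one i).
Qed.

Section HalfSpace.
Variable lam : 'cV[R]_r.

Lemma int_fiber_neg N (M : 'M[R]_(N, r)) a : (forall i, 0 <= pairing (row i M) lam) ->
  pairing a lam < 0 -> int_fiber M a = set0.
Proof.
move=> h al; apply/seteqP; split=> // t [t0 ta _] /=; move: al; apply/negP.
rewrite -leNgt -ta mulmx_sum_row pairing_suml sumr_ge0// => i _.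
by rewrite pairingZl mulr_ge0.
Qed.

(** Each step along phi lowers the value of lam by a fixed amount, and there are
    no points when this value is negative. *)
Lemma int_fiber_finite (Psi : seq V) a : (forall psi, psi \in Psi -> 0 < pairing psi lam) ->
  finite_set (int_fiber (mx_of_seq Psi) a).
Proof.
elim: Psi a => [|phi Psi IH] a pos.
  apply: (sub_finite_set (B := [set 0])) => [t _ /=|]; last exact: finite_set1.
  by apply/rowP => -[].
have {}IH b : finite_set (int_fiber (mx_of_seq Psi) b).
  by apply: IH => psi h; rewrite pos// inE h orbT.
rewrite mx_of_seq_cons; have lphi : 0 < pairing phi lam by rewrite pos// mem_head.
have [n] : exists n : nat, pairing a lam < n%:R * pairing phi lam.
  exists (Num.truncn (`|pairing a lam| / pairing phi lam)).+1.
  rewrite -ltr_pdivrMr// (le_lt_trans _ (truncnS_gt _))//.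
  by rewrite ler_pM2r ?invr_gt0// ler_norm.
elim: n a => [|n IHn] a an.
  rewrite mul0r in an; rewrite int_fiber_neg//.
  move=> i; have -> : row i (col_mx phi (mx_of_seq Psi)) = (phi :: Psi)`_i.
    by rewrite -(row_mx_of_seq (i : 'I_(size (phi :: Psi)))) mx_of_seq_cons.
  by rewrite ltW// pos// (mem_nth 0 (ltn_ord i)).
rewrite int_fiber_cons finite_setU; split; apply: finite_image => //.
apply: IHn; rewrite pairingBl ltrBlDr (lt_le_trans an)//.
by rewrite -natr1 mulrDl mul1r.
Qed.

Lemma count_polytope_step (phi : V) Psi a :
  (forall psi, psi \in phi :: Psi -> 0 < pairing psi lam) ->
  count_polytope (phi :: Psi) a =
  (count_polytope Psi a + count_polytope (phi :: Psi) (a - phi))%N.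
Proof.
move=> pos; have fin b : finite_set (int_fiber (col_mx phi (mx_of_seq Psi)) b).
  by have := int_fiber_finite b pos; rewrite mx_of_seq_cons.
have fin' b : finite_set (int_fiber (mx_of_seq Psi) b).
  by apply: int_fiber_finite => psi h; rewrite pos// inE h orbT.
rewrite !count_polytope_cons count_polytope_mx int_fiber_cons card_ptsU.
- rewrite !card_pts_image//.
  by move=> t t' /(congr1 rsubmx); rewrite !row_mxKr.
- exact: finite_image.
- exact: finite_image.
apply/seteqP; split => // t [[t' _ <-] [t'' [t''0 _ _]]] /rowP/(_ (lshift _ 0)).
rewrite mxE !row_mxEl !mxE eqxx => h; have := t''0 (lshift _ 0).
by move: h => /eqP; rewrite addrC addr_eq0 => /eqP ->; rewrite oppr_ge0 ler10.
Qed.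

Lemma count_polytope_perm (Phi Psi : seq V) a :
  (forall psi, psi \in Psi -> 0 < pairing psi lam) -> perm_eq Phi Psi ->
  count_polytope Phi a = count_polytope Psi a.
Proof.
move=> pos p; have [s sE] := tuple_permP (t := in_tuple Psi) p.
have sP : size Phi = size Psi by exact: perm_size.
pose M := mx_of_seq Psi.
rewrite (@count_polytopeE Phi _ (row_perm s M))//; last first.
  move=> i; have -> : row i (row_perm s (mx_of_seq Psi)) = row (s i) M.
    by apply/rowP => j; rewrite !mxE.
  by rewrite row_mx_of_seq sE (nth_map i) ?size_enum_ord// nth_ord_enum (tnth_nth 0).
have mul (t : 'rV[R]_(size Psi)) : col_perm s t *m row_perm s M = t *m M.
  by rewrite col_permE row_permE mulmxA -(mulmxA t) -perm_mxM mulVg perm_mx1 mulmx1.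
rewrite count_polytope_mx -[RHS](@card_pts_image _ _ (col_perm s)).
- congr card_pts; apply/seteqP; split => t /=.
    move=> [t0 tM Zt]; exists (col_perm s^-1%g t); last first.
      by apply/rowP => j; rewrite !mxE permK.
    split; [by move=> i; rewrite mxE| |by move=> i; rewrite mxE].
    by rewrite -mul -tM; congr (_ *m _); apply/rowP => j; rewrite !mxE permK.
  move=> [t' [t0 tM Zt] <-]; split; [by move=> i; rewrite mxE| |by move=> i; rewrite mxE].
  by rewrite mul.
- exact: int_fiber_finite.
- by move=> t t' /rowP h; apply/rowP => j; have := h (s^-1%g j); rewrite !mxE permKV.
Qed.

End HalfSpace.

Lemma count_polytope_single (lam E : 'cV[R]_r) (Phi0 : seq V) (phi : V) a :
  (forall psi, psi \in Phi0 -> 0 < pairing psi lam) ->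
  (forall psi, psi \in Phi0 -> pairing psi E = 0) ->
  (forall psi, psi \in phi :: Phi0 -> Zpoints psi) ->
  dual_lattice E -> unit_lev E phi ->
  count_polytope (phi :: Phi0) a =
  if `[< Zpoints a >] && (0 <= pairing a E / pairing phi E)
  then count_polytope Phi0 (wall_proj E phi a) else 0%N.
Proof.
move=> pos lev0 ZP dE uphi; rewrite count_polytope_cons.
have lphi : pairing phi E != 0.
  by case: uphi => ->; rewrite ?oppr_eq0 oner_eq0.
have lM (t : 'rV[R]_(size Phi0)) : pairing (t *m mx_of_seq Phi0) E = 0.
  rewrite mulmx_mx_of_seq pairing_suml big1// => i _.
  by rewrite pairingZl lev0 ?mulr0// mem_nth.
have xE (x : 'rV[R]_1) (t : 'rV[R]_(size Phi0)) :
    row_mx x t *m col_mx phi (mx_of_seq Phi0) = a ->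
    x 0 0 = pairing a E / pairing phi E.
  rewrite mul_row_col [x]mx11_scalar mul_scalar_mx => <-.
  by rewrite pairingDl pairingZl lM addr0 mulfK// mxE mulr1n.
case: ifPn => [/andP[/asboolP Za x0]|h].
  rewrite count_polytope_mx -[RHS](@card_pts_image _ _ (row_mx (pairing a E / pairing phi E)%:M)).
  - congr card_pts; apply/seteqP; split => t /=.
      rewrite -[t]hsubmxK; move: (lsubmx t) (rsubmx t) => x t' [h0 tM Zt].
      have xx := xE _ _ tM; exists t'; last by rewrite -xx -mx11_scalar.
      split.
      - by move=> i; have := h0 (rshift 1 i); rewrite row_mxEr.
      - rewrite /wall_proj -xx -[in RHS]tM mul_row_col {1}[x]mx11_scalar mul_scalar_mx.
        by rewrite addrAC subrr add0r.
      - by move=> i; have := Zt (rshift 1 i); rewrite row_mxEr.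
    move=> [t' [t'0 tM Zt'] <-]; split.
    - move=> i; case: (splitP i) => j ij.
        rewrite (_ : i = lshift _ j); last exact: val_inj.
        by rewrite row_mxEl mxE (ord1 j) mulr1n.
      by rewrite (_ : i = rshift 1 j); [rewrite row_mxEr|exact: val_inj].
    - by rewrite mul_row_col tM mul_scalar_mx addrC /wall_proj subrK.
    - move=> i; case: (splitP i) => j ij.
        rewrite (_ : i = lshift _ j); last exact: val_inj.
        rewrite row_mxEl mxE (ord1 j) mulr1n.
        case: uphi => ->; first by rewrite divr1; exact: dE.
        by rewrite invrN invr1 mulrN1 rpredN; exact: dE.
      by rewrite (_ : i = rshift 1 j); [rewrite row_mxEr|exact: val_inj].
  - exact: int_fiber_finite pos.
  - by move=> t t' /(congr1 rsubmx); rewrite !row_mxKr.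
rewrite (_ : int_fiber _ _ = set0) /card_pts ?fset_set0 ?cardfs0//.
apply/seteqP; split => // t; rewrite -[t]hsubmxK.
move: (lsubmx t) (rsubmx t) => x t' [h0 tM Zt]; exfalso; move/negP: h; apply.
apply/andP; split; last first.
  by rewrite -(xE _ _ tM); have := h0 (lshift _ 0); rewrite row_mxEl.
apply/asboolP; rewrite -tM mul_row_col mulmx_mx_of_seq; apply: ZpointsD.
  rewrite [x]mx11_scalar mul_scalar_mx; apply: ZpointsZ.
    by have := Zt (lshift _ 0); rewrite row_mxEl.
  exact/ZP/mem_head.
apply: Zpoints_sum => i _; apply: ZpointsZ.
  by have := Zt (rshift 1 i); rewrite row_mxEr.
by apply: ZP; rewrite inE mem_nth ?orbT.
Qed.

End Counting.

(** * Chambers near the wall *)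

Section Segments.
Variables (R : realType) (r : nat).
Notation V := ('rV[R]_r).

Lemma nbhs_ball_sub (p : V) (A : set V) : nbhs p A ->
  exists2 eps : R, 0 < eps & forall a, `|a - p| < eps -> A a.
Proof.
move=> /nbhs_ballP[eps e0 sub]; exists eps => // a ap; apply: sub.
by rewrite -ball_normE /ball_ /= distrC.
Qed.

Lemma norm_ball_nbhs (p : V) (eps : R) : 0 < eps -> nbhs p [set a | `|a - p| < eps].
Proof.
move=> e0; apply/nbhs_ballP; exists eps => // a; rewrite -ball_normE /ball_ /=.
by rewrite distrC.
Qed.

Lemma closure_meets (A : set V) (p : V) (eps : R) : closure A p -> 0 < eps ->
  exists2 a, A a & `|a - p| < eps.
Proof. by move=> cA e0; have [a [Aa ap]] := cA _ (norm_ball_nbhs p e0); exists a. Qed.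

Lemma segment_component (A : set V) (p a : V) :
  (forall t : R, 0 <= t -> t <= 1 -> A (p + t *: (a - p))) -> connected_component A p a.
Proof.
move=> h; pose f (t : R) : V := p + t *: (a - p).
have cf : continuous f.
  by move=> t; apply: cvgD; [exact: cvg_cst|apply: cvgZr_tmp; exact: cvg_id].
apply: (@connected_component_max _ A (f @` `[0, 1]) p).
- by exists 0; [rewrite /= in_itv /= lexx ler01|rewrite /f scale0r addr0].
- move=> _ [t ht <-]; move: ht; rewrite /= in_itv /= => /andP[t0 t1]; exact: h.
- apply: connected_continuous_connected; first exact: segment_connected.
  exact: continuous_subspaceT.
by exists 1; [rewrite /= in_itv /= lexx ler01|rewrite /f scale1r addrC subrK].
Qed.

Lemma chamber_component (Psi : seq V) c p : chamber Psi c -> c p ->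
  c = connected_component (spanned Psi `\` singular Psi) p.
Proof. by move=> [x _ ->] /same_connected_component. Qed.

Lemma chamber_sub (Psi : seq V) c a : chamber Psi c -> c a ->
  spanned Psi a /\ ~ singular Psi a.
Proof. by move=> [x _ ->] /connected_component_sub. Qed.

Lemma chamber_segment (Psi : seq V) c (p a : V) : chamber Psi c -> c p ->
  (forall t : R, 0 <= t -> t <= 1 ->
     spanned Psi (p + t *: (a - p)) /\ ~ singular Psi (p + t *: (a - p))) -> c a.
Proof. by move=> ch cp h; rewrite (chamber_component ch cp); exact: segment_component. Qed.

Lemma coneZ (nu : seq V) (L : R) a : 0 <= L -> cone nu a -> cone nu (L *: a).
Proof.
move=> L0 [t t0 ->]; exists (L *: t); last by rewrite scalemxAl.
by move=> i; rewrite mxE mulr_ge0.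
Qed.

Lemma singularZ (Psi : seq V) (L : R) a : 0 < L -> singular Psi (L *: a) -> singular Psi a.
Proof.
move=> L0 [nu hnu h]; exists nu => //.
rewrite -[a]scale1r -(mulVf (lt0r_neq0 L0)) -scalerA; apply: coneZ => //.
by rewrite invr_ge0 ltW.
Qed.

Lemma chamberZ (Psi : seq V) c (L : R) a : chamber Psi c -> 0 < L -> c a -> c (L *: a).
Proof.
move=> ch L0 ca; have [sa na] := chamber_sub ch ca.
apply: (chamber_segment ch ca) => t t0 t1.
have -> : a + t *: (L *: a - a) = (1 - t + t * L) *: a.
  by rewrite scalerBr scalerA scalerDl scalerBl scale1r addrA addrAC.
have k0 : 0 < 1 - t + t * L.
  case: (eqVneq t 1) => [->|tn]; first by rewrite subrr add0r mul1r.
  by rewrite ltr_wpDr ?mulr_ge0 ?(ltW L0)// subr_gt0 lt_neqAle tn.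
by split; [exact: rpredZ|move=> /(singularZ k0)].
Qed.

Lemma closure_chamberZ (Psi : seq V) c (L : R) a : chamber Psi c -> 0 < L ->
  closure c a -> closure c (L *: a).
Proof.
move=> ch L0 ca N /nbhs_ball_sub[eps e0 sub].
have [b cb ba] := closure_meets ca (divr_gt0 e0 L0).
exists (L *: b); split; first exact: chamberZ ch L0 cb.
apply: sub; rewrite -scalerBr normrZ gtr0_norm// mulrC -ltr_pdivlMr//.
Qed.

End Segments.

Section GenericPoint.
Variables (R : realType) (r : nat) (E : 'cV[R]_r).
Notation V := ('rV[R]_r).

(** Each functional vanishes on a proper subspace of the hyperplane; a small
    displacement leaves this subspace without entering those avoided before. *)
Lemma avoid_functionals (etas : seq 'cV[R]_r) (w : V) (eps : R) :
  pairing w E = 0 -> 0 < eps ->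
  (forall eta, eta \in etas -> exists2 u : V, pairing u E = 0 & pairing u eta != 0) ->
  exists w' eps', [/\ pairing w' E = 0, 0 < eps',
    forall a, `|a - w'| < eps' -> `|a - w| < eps &
    forall eta a, eta \in etas -> `|a - w'| < eps' -> pairing a eta != 0].
Proof.
move=> wE e0; elim: etas => [|eta etas IH] h.
  by exists w, eps; split => // eta a; rewrite inE.
have [|w1 [e1 [w1E e10 near1 av1]]] := IH.
  by move=> eta' h'; apply: h; rewrite inE h' orbT.
suff [w2 [e2 [w2E e20 near2 av2]]] : exists w2 e2, [/\ pairing w2 E = 0, 0 < e2,
    forall a, `|a - w2| < e2 -> `|a - w1| < e1 &
    forall a, `|a - w2| < e2 -> pairing a eta != 0].
  exists w2, e2; split => //; first by move=> a /near2/near1.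
  move=> eta' a; rewrite inE => /orP[/eqP -> /av2//|h' /near2].
  exact: av1.
have step w2 : pairing w2 E = 0 -> `|w2 - w1| < e1 / 2 -> pairing w2 eta != 0 ->
    exists w2 e2, [/\ pairing w2 E = 0, 0 < e2,
    forall a, `|a - w2| < e2 -> `|a - w1| < e1 &
    forall a, `|a - w2| < e2 -> pairing a eta != 0].
  move=> w2E w21 w2n; have n0 := l1norm_ge0 eta.
  pose e2 := Num.min (e1 / 2) (`|pairing w2 eta| / (1 + l1norm eta)).
  exists w2, e2; split => //.
  - by rewrite lt_min !divr_gt0 ?normr_gt0//; lra.
  - move=> a; rewrite lt_min => /andP[a2 _].
    rewrite -(subrK w2 a) -addrA (le_lt_trans (ler_normD _ _))//; lra.
  move=> a; rewrite lt_min => /andP[_]; rewrite ltr_pdivlMr; last lra.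
  move=> ha; apply/eqP => a0; have := pairing_le (a - w2) eta.
  rewrite pairingBl a0 sub0r normrN; move: ha (normr_ge0 (a - w2)).
  by move: (`|a - w2|) (`|pairing w2 eta|) => x y; nra.
case: (eqVneq (pairing w1 eta) 0) => [w10|w1n]; last first.
  by apply: (step w1) => //; rewrite subrr normr0 divr_gt0.
have [u uE un] := h eta (mem_head _ _).
pose t := e1 / (2 * (1 + `|u|)).
have u0 := normr_ge0 u.
have t0 : 0 < t by rewrite divr_gt0// mulr_gt0//; lra.
apply: (step (w1 + t *: u)).
- by rewrite pairingDl pairingZl uE w1E mulr0 addr0.
- have tE : t * (2 * (1 + `|u|)) = e1 by rewrite divfK// gt_eqF// mulr_gt0//; lra.
  rewrite addrC addKr normrZ gtr0_norm//; move: tE t0.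
  by move: t (`|u|) => x y; lra.
by rewrite pairingDl pairingZl w10 add0r mulf_neq0// gt_eqF.
Qed.

(** A column of the cokernel matrix does it: together they cut out the span. *)
Lemma annihilator (nu : seq V) :
  (exists2 u : V, pairing u E = 0 & u \notin << nu >>%VS) ->
  exists2 eta : 'cV[R]_r, (forall a : V, a \in << nu >>%VS -> pairing a eta = 0) &
    exists2 u : V, pairing u E = 0 & pairing u eta != 0.
Proof.
move=> [u uE]; rewrite mem_span_submx submxE => /eqP un.
have [j uj] : exists j, (u *m cokermx (mx_of_seq nu)) 0 j != 0.
  apply: contrapT => h; apply: un; apply/rowP => j; rewrite [RHS]mxE.
  by apply/eqP; apply: contrapT => /negP hj; apply: h; exists j.
have pE (a : V) : pairing a (col j (cokermx (mx_of_seq nu))) =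
    (a *m cokermx (mx_of_seq nu)) 0 j.
  by rewrite /pairing colE mulmxA -colE mxE.
exists (col j (cokermx (mx_of_seq nu))).
  by move=> a; rewrite mem_span_submx submxE pE => /eqP ->; rewrite mxE.
by exists u => //; rewrite pE.
Qed.

Fixpoint subseqs (s : seq V) : seq (seq V) :=
  if s is x :: s' then subseqs s' ++ [seq x :: u | u <- subseqs s'] else [:: [::]].

Lemma mem_subseqs (s u : seq V) : subseq u s -> u \in subseqs s.
Proof.
elim: s u => [|x s IH] [|y u] //=.
  by move=> _; rewrite mem_cat IH ?sub0seq.
case: eqP => [-> /IH h|_ /IH h]; rewrite mem_cat ?h//.
by rewrite (map_f (cons x) h) orbT.
Qed.

Lemma cone_span (nu : seq V) a : cone nu a -> a \in << nu >>%VS.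
Proof. by move=> [t _ ->]; rewrite mem_span_submx submxMl. Qed.

(** A cone that is not inside the hyperplane spans a subspace meeting the
    hyperplane in a proper subspace, which a generic centre avoids. *)
Lemma generic_ball (Phi : seq V) (w : V) (eps : R) :
  pairing w E = 0 -> 0 < eps ->
  (forall nu : seq V, subseq nu Phi -> (size nu < \dim << Phi >>)%N ->
     (forall a : V, pairing a E = 0 -> a \in << nu >>%VS) ->
     forall a : V, a \in << nu >>%VS -> pairing a E = 0) ->
  exists w0 eps0, [/\ pairing w0 E = 0, 0 < eps0,
    forall a, `|a - w0| < eps0 -> `|a - w| < eps &
    forall a, `|a - w0| < eps0 -> singular Phi a ->
      exists2 nu, subseq nu Phi & cone nu a /\
        forall b : V, b \in << nu >>%VS -> pairing b E = 0].
Proof.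
move=> wE e0 hyp.
have /choice[eta heta] (nu : seq V) : exists eta : 'cV[R]_r,
    (exists2 u : V, pairing u E = 0 & u \notin << nu >>%VS) ->
    (forall a : V, a \in << nu >>%VS -> pairing a eta = 0) /\
    exists2 u : V, pairing u E = 0 & pairing u eta != 0.
  case: (pselect (exists2 u : V, pairing u E = 0 & u \notin << nu >>%VS)).
    by move=> h; have [eta h1 h2] := annihilator h; exists eta.
  by move=> h; exists 0.
pose bad nu := `[< exists2 u : V, pairing u E = 0 & u \notin << nu >>%VS >].
have [|w0 [eps0 [w0E e00 near0 av]]] :=
    @avoid_functionals [seq eta nu | nu <- subseqs Phi & bad nu] w eps wE e0.
  move=> x /mapP[nu]; rewrite mem_filter => /andP[/asboolP b _] ->.
  by have [_] := heta nu b.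
exists w0, eps0; split => // a an [nu [sub sz] ca].
have [b|nb] := boolP (bad nu).
  have [kill _] := heta nu (elimT (asboolP _) b).
  have := av (eta nu) a; rewrite (kill _ (cone_span ca)) eqxx => /(_ _ an) h.
  suff : false by []; apply: h; apply/mapP; exists nu => //.
  by rewrite mem_filter b mem_subseqs.
exists nu => //; split => //; apply: hyp => // u uE.
apply: contrapT => /negP un; move/asboolP: nb; apply; by exists u.
Qed.

End GenericPoint.

Section WallGeometry.
Variables (R : realType) (r : nat) (E : 'cV[R]_r).
Notation V := ('rV[R]_r).
Implicit Types (Phi nu : seq V).

Lemma Zspan_span nu a : Zspan nu a -> a \in << nu >>%VS.
Proof.
move=> [c ->]; rewrite rpred_sum// => i _; rewrite -scaler_int rpredZ//.
by rewrite memv_span// mem_nth.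
Qed.

Lemma span_full Phi a : Zspan Phi = @Zpoints R r -> a \in << Phi >>%VS.
Proof.
move=> ZPhi; rewrite [a]row_sum_delta rpred_sum// => i _; rewrite rpredZ//.
apply: Zspan_span; rewrite ZPhi => j; rewrite mxE; by case: (_ && _).
Qed.

Lemma mem_Zspan nu phi : phi \in nu -> Zspan nu phi.
Proof.
move=> h; have hl : (index phi nu < size nu)%N by rewrite index_mem.
exists [ffun i => (i == Ordinal hl)%:R]; rewrite (bigD1 (Ordinal hl))//= big1 ?addr0.
  by rewrite ffunE eqxx nth_index.
by move=> i ni; rewrite ffunE (negbTE ni).
Qed.

(** A span of dimension less than r that contains the hyperplane is equal to
    it. *)
Lemma wall_span nu Phi : (size nu).+1 = r -> free nu ->
  (forall a : V, a \in << nu >>%VS <-> pairing a E = 0) ->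
  forall nu', (size nu' < \dim << Phi >>)%N ->
    (forall a : V, pairing a E = 0 -> a \in << nu' >>%VS) ->
    forall a : V, a \in << nu' >>%VS -> pairing a E = 0.
Proof.
move=> sz fnu spn nu' sz' sub a ha; apply/spn.
suff -> : << nu >>%VS = << nu' >>%VS by [].
apply/eqP; rewrite eqEdim; apply/andP; split.
  by apply/subvP => b /spn; exact: sub.
have -> : \dim << nu >>%VS = size nu by exact/eqP.
rewrite (leq_trans (dim_span nu'))// -ltnS sz (leq_trans sz')//.
by rewrite dim_span_rank rank_leq_col.
Qed.

Lemma cone_subseq nu Phi a : subseq nu Phi -> cone nu a -> cone Phi a.
Proof.
elim: Phi nu a => [|x Phi IH] [|y nu] a.
- by [].
- by [].
- move=> _ [t _ ->]; exists 0; first by move=> i; rewrite mxE.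
  by rewrite mul0mx mulmx_mx_of_seq big1// => -[].
move=> sub [t t0 tE]; rewrite mx_of_seq_cons in tE.
have ext (c : R) (b : V) : 0 <= c -> cone Phi b -> cone (x :: Phi) (c *: x + b).
  move=> c0 [u u0 uE]; exists (row_mx c%:M u : 'rV[R]_(1 + size Phi)).
    move=> i; case: (splitP (i : 'I_(1 + size Phi))) => j ij.
      rewrite (_ : i = lshift _ j); last exact: val_inj.
      by rewrite (row_mxEl c%:M u) mxE (ord1 j) mulr1n.
    rewrite (_ : i = rshift 1 j); last exact: val_inj.
    by rewrite (row_mxEr c%:M u).
  by rewrite mx_of_seq_cons (mul_row_col c%:M u) mul_scalar_mx uE.
pose t' : 'rV[R]_(1 + size nu) := t.
have t'E : a = lsubmx t' 0 0 *: y + rsubmx t' *m mx_of_seq nu.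
  have -> : a = t' *m (col_mx y (mx_of_seq nu) : 'M[R]_(1 + size nu, r)) by exact: tE.
  by rewrite -[t' in LHS]hsubmxK mul_row_col -mul_scalar_mx -mx11_scalar.
have nuc : cone nu (rsubmx t' *m mx_of_seq nu).
  by exists (rsubmx t') => // i; rewrite mxE.
move: sub => /=; case: eqP => [yx sub|_ sub].
  by rewrite t'E yx; apply: ext; [rewrite mxE|exact: IH sub nuc].
rewrite -[a]add0r -[X in X + _](scale0r x); apply: ext => //.
apply: IH sub _; exists t => //; by rewrite mx_of_seq_cons.
Qed.

(** In a generic ball the singular set lies in the wall, so that each half-ball
    is connected and inside a single chamber. The ball meets the closures of c1
    and c2, which are different: they fill the two halves. The wall is then
    singular inside the ball, and by genericity covered by cones of Phi0, which
    keeps c12 away from the exterior. *)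
Lemma wall_ball Phi (W c1 c2 c12 : set V) :
  W = [set a | pairing a E = 0] -> wall Phi W -> (forall a : V, a \in << Phi >>%VS) ->
  chamber Phi c1 -> chamber Phi c2 -> adjacent_along Phi W E c1 c2 ->
  let Phi0 := [seq phi <- Phi | phi \in W] in
  closure c1 `&` closure c2 `&` W `<=` closure c12 ->
  exists w0 eps, [/\ pairing w0 E = 0, 0 < eps, c12 <> exterior Phi0,
    forall a, `|a - w0| < eps -> 0 < pairing a E -> c1 a &
    (forall a, `|a - w0| < eps -> pairing a E < 0 -> c2 a) /\
    (forall a, `|a - w0| < eps -> pairing a E = 0 -> closure c12 a)].
Proof.
move=> WE [nu [subnu sznu fnu Wnu]] full ch1 ch2 [c12n c1pos c2neg [D [oD [w [Dw Ww]] DW]]].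
move=> Phi0 c12sub.
have spnu (a : V) : a \in << nu >>%VS <-> pairing a E = 0.
  have /seteqP[h1 h2] : spanned nu = [set a | pairing a E = 0] by rewrite -Wnu.
  by split; [exact: h1|exact: h2].
have [e1 e10 sub1] := nbhs_ball_sub (open_nbhs_nbhs (conj oD Dw)).
have wE : pairing w E = 0 by move: Ww; rewrite WE.
have [|w0 [eps [w0E eps0 near0 sing]]] := @generic_ball _ _ E Phi w e1 wE e10.
  by move=> nu' _; apply: (wall_span (Phi := Phi) sznu fnu spnu).
have inD a : `|a - w0| < eps -> D a by move=> /near0/sub1.
have w00 : `|w0 - w0| < eps by rewrite subrr normr0.
have off a : `|a - w0| < eps -> pairing a E != 0 -> ~ singular Phi a.
  move=> an aE /(sing _ an)[nu' _ [ca h]]; move/eqP: aE; apply; apply: h.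
  exact: cone_span.
have ball_convex (p a : V) (t : R) : `|p - w0| < eps -> `|a - w0| < eps ->
    0 <= t -> t <= 1 -> `|p + t *: (a - p) - w0| < eps.
  move=> pn an t0 t1; have -> : p + t *: (a - p) - w0 = (1 - t) *: (p - w0) + t *: (a - w0).
    by apply/rowP => i; rewrite !mxE; ring.
  rewrite (le_lt_trans (ler_normD _ _))// !normrZ !ger0_norm ?subr_ge0//.
  move: pn an; move: (`|p - w0|) (`|a - w0|) => x y xe ye.
  by have [->|tn] := eqVneq t 0; nra.
have levt (p a : V) (t : R) : pairing (p + t *: (a - p)) E =
    (1 - t) * pairing p E + t * pairing a E.
  by rewrite pairingDl pairingZl pairingBl; ring.
have [cl1 cl2] : closure c1 w0 /\ closure c2 w0.
  have : (D `&` W) w0 by split; [exact: inD|rewrite WE].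
  by move=> /DW[].
have [p1 c1p1 p1n] := closure_meets cl1 eps0.
have [p2 c2p2 p2n] := closure_meets cl2 eps0.
have p1E := c1pos _ c1p1.
have in1 a : `|a - w0| < eps -> 0 < pairing a E -> c1 a.
  move=> an aE; apply: (chamber_segment ch1 c1p1) => t t0 t1; split; first exact: full.
  apply: off; first exact: ball_convex.
  rewrite levt gt_eqF//; move: p1E aE; move: (pairing p1 E) (pairing a E) => x y.
  by have [->|tn] := eqVneq t 0; nra.
(* a regular point of the hyperplane would join the two sides *)
have regW a : `|a - w0| < eps -> pairing a E = 0 -> singular Phi a.
  move=> an aE; apply: contrapT => na.
  pose del := eps - `|a - w0|; have del0 : 0 < del by rewrite subr_gt0.
  pose t := del / (2 * (1 + `|p1 - a|)).
  have pa0 := normr_ge0 (p1 - a).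
  have tE : t * (2 * (1 + `|p1 - a|)) = del by rewrite divfK// gt_eqF// mulr_gt0//; lra.
  have t0 : 0 < t by rewrite divr_gt0// mulr_gt0//; lra.
  pose b := a - t *: (p1 - a).
  have bn : `|b - w0| < eps.
    rewrite /b addrAC (le_lt_trans (ler_normB _ _))// normrZ gtr0_norm//.
    move: tE t0; rewrite /del; move: (`|p1 - a|) (`|a - w0|) pa0 => x y x0 h1 h2; nra.
  have bE : pairing b E < 0.
    by rewrite pairingBl pairingZl pairingBl aE subr0 sub0r oppr_lt0 mulr_gt0.
  suff /c1pos : c1 b by rewrite ltNge (ltW bE).
  apply: (chamber_segment ch1 c1p1) => s s0 s1; split; first exact: full.
  case: (eqVneq (pairing (p1 + s *: (b - p1)) E) 0) => [h|h]; last first.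
    by apply: off => //; exact: ball_convex.
  suff -> : p1 + s *: (b - p1) = a by [].
  have bp : b - p1 = - (1 + t) *: (p1 - a).
    by apply/rowP => i; rewrite !mxE; ring.
  move: h; rewrite bp scalerA pairingDl pairingZl pairingBl aE subr0.
  move=> h; have {}h : s * (1 + t) = 1.
    apply: (mulIf (lt0r_neq0 p1E)); rewrite mul1r; move: h.
    by rewrite mulrN mulNr => /eqP; rewrite subr_eq0 => /eqP <-.
  by rewrite mulrN h scaleN1r opprB addrC subrK.
have in2 a : `|a - w0| < eps -> pairing a E < 0 -> c2 a.
  have p2E : pairing p2 E < 0.
    rewrite ltNge le_eqVlt; apply/negP => /orP[/eqP p20|p20].
      have [_] := chamber_sub ch2 c2p2; apply; apply: regW => //.
    apply: c12n; rewrite (chamber_component ch1 (in1 _ p2n p20)).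
    by rewrite (chamber_component ch2 c2p2).
  move=> an aE; apply: (chamber_segment ch2 c2p2) => t t0 t1; split; first exact: full.
  apply: off; first exact: ball_convex.
  rewrite levt lt_eqF//; move: p2E aE; move: (pairing p2 E) (pairing a E) => x y.
  by have [->|tn] := eqVneq t 0; nra.
have inW a : `|a - w0| < eps -> pairing a E = 0 -> closure c12 a.
  move=> an aE; have Wa : W a by rewrite WE.
  by apply: c12sub; split => //; apply: DW; split => //; exact: inD.
exists w0, eps; split => // ext.
have := inW _ w00 w0E; rewrite ext => cle.
have [a [sa nca] an] := closure_meets cle eps0.
have aE : pairing a E = 0.
  move: sa; rewrite /spanned /= mem_span_submx => /submxP[t ->].
  rewrite mulmx_mx_of_seq pairing_suml big1// => i _; rewrite pairingZl.
  have : Phi0`_i \in Phi0 by exact: mem_nth.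
  by rewrite mem_filter WE => /andP[]; rewrite inE => -> _; rewrite mulr0.
have [nu' sub' [[t t0 tE] h]] := sing a an (regW a an aE).
apply: nca; have sub0 : subseq nu' Phi0.
  rewrite subseq_filter sub' andbT; apply/allP => x xnu; rewrite WE inE.
  exact/h/memv_span.
have [X XE] := cone_subseq sub0 (ex_intro2 _ _ t t0 tE).
by exists X.
Qed.

End WallGeometry.

(** * Completing families of vectors *)

Section Assembly.
Variables (R : realType) (r : nat).
Notation V := ('rV[R]_r).
Implicit Types (Phi nu : seq V).

Lemma subseq_perm_cat nu Phi : subseq nu Phi -> exists mu, perm_eq Phi (mu ++ nu).
Proof.
elim: Phi nu => [|x Phi IH] [|y nu] //=; first by exists [::].
  by move=> _; exists (x :: Phi); rewrite cats0.
case: eqP => [-> /IH|_ /IH] [mu p].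
  by exists mu; rewrite perm_sym -cat1s perm_catCA cat1s perm_cons perm_sym.
by exists (x :: mu); rewrite /= perm_cons.
Qed.

Lemma subseq_insert nu Phi phi : subseq nu Phi -> phi \in Phi -> phi \notin nu ->
  exists2 mu, subseq mu Phi & perm_eq mu (phi :: nu).
Proof.
elim: Phi nu => [|x Phi IH] nu //; rewrite inE => sub.
have [-> _ xnu|xphi /= pPhi pnu] := eqVneq phi x.
  exists (x :: nu) => //=; rewrite eqxx.
  case: nu sub xnu => [|y nu] /=; first by rewrite sub0seq.
  by case: eqP => [->|//]; rewrite inE eqxx.
case: nu sub pnu => [|y nu] /= sub pnu.
  by have [mu sm pm] := IH [::] (sub0seq _) pPhi isT; exists mu => //;
    exact: subseq_trans sm (subseq_cons _ _).
move: sub; case: eqP => [-> sub|_ sub].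
  move: pnu; rewrite inE negb_or => /andP[_ pnu].
  have [mu sm pm] := IH nu sub pPhi pnu; exists (x :: mu) => /=; first by rewrite eqxx.
  by rewrite (perm_trans (_ : perm_eq _ (x :: phi :: nu)))// ?perm_cons// (perm_catCA [:: x] [:: phi] nu).
have [mu sm pm] := IH _ sub pPhi pnu; exists mu => //.
exact: subseq_trans sm (subseq_cons _ _).
Qed.

Lemma hyperplane_frame (E : 'cV[R]_r) : primitive E -> (0 < r)%N ->
  exists2 e0 : V, Zpoints e0 /\ pairing e0 E = 1 &
    forall Psi : seq V, (forall a : V, a \in << Psi >>%VS <-> pairing a E = 0) ->
      framed Psi.
Proof.
case: r E => [//|n] E pE _; have [e0 [B [Ze le fB BE ZB]]] := hyperplane_basis pE.
exists e0 => // Psi PsiE; apply: (framed_basis fB).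
  apply/eqmxP/andP; split; apply/rV_subP => a.
    by rewrite -mem_span_submx => /BE/PsiE.
  by rewrite -mem_span_submx => /PsiE/BE.
rewrite (_ : [set a | (a <= B)%MS] = [set a | pairing a E = 0])//.
by apply/seteqP; split => a /= /BE.
Qed.

(** A basis of the hyperplane completed by an off-wall vector is a lattice
    basis, so that a lattice vector of level 1 has an integral coordinate on
    this vector; that coordinate is the inverse of its level. *)
Lemma unimodular_unit_lev (E : 'cV[R]_r) Phi nu e0 phi :
  Zspan Phi = @Zpoints R r -> unimodular Phi -> dual_lattice E ->
  Zpoints e0 -> pairing e0 E = 1 ->
  subseq nu Phi -> free nu -> (forall a : V, a \in << nu >>%VS <-> pairing a E = 0) ->
  phi \in Phi -> pairing phi E != 0 -> unit_lev E phi.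
Proof.
move=> ZPhi uPhi dE Ze le sub fnu spn pPhi pE.
have pnu : phi \notin << nu >>%VS by apply/negP => /spn/eqP; exact/negP.
have [|mu smu pmu] := subseq_insert sub pPhi; first by apply: contra pnu => /memv_span.
have full a : a \in << mu >>%VS.
  rewrite (eq_span (perm_mem pmu)) -(subrK ((pairing a E / pairing phi E) *: phi) a).
  rewrite rpredD//; last by rewrite rpredZ// memv_span// mem_head.
  apply: span_cons_mem; apply/spn.
  by rewrite pairingBl pairingZl divfK// subrr.
have bmu : basis_of << Phi >>%VS mu.
  apply/andP; split; last by rewrite (perm_free pmu) free_cons pnu.
  by apply/eqP/vspaceP => a; rewrite full; symmetry; exact: span_full.
have [Zmu _] := uPhi mu smu bmu.
have : Zspan mu e0 by rewrite -Zmu ZPhi.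
move=> [c e0E]; have /intrP[n nE] : pairing phi E \is a Num.int.
  by apply: dE; rewrite -ZPhi; exact: mem_Zspan.
have : exists m : int, n * m = 1.
  exists (\sum_(i < size mu) if (in_tuple mu)`_i == phi then c i else 0).
  apply: (@intr_inj R); rewrite rmorphM /= -nE -[RHS]le e0E pairing_suml.
  rewrite rmorph_sum mulr_sumr; apply: eq_bigr => i _ /=.
  rewrite -[in RHS]scaler_int pairingZl; case: eqP => [->|ne]; first by rewrite mulrC.
  have : mu`_i \in phi :: nu by rewrite -(perm_mem pmu) mem_nth.
  rewrite inE => /orP[/eqP //|/memv_span/spn ->].
  by rewrite !mulr0.
move=> [m /(congr1 absz)]; rewrite abszM => /eqP; rewrite muln_eq1 => /andP[/eqP n1 _].
rewrite /unit_lev nE; case: n n1 {nE} => [[|[|k]]|[|k]]//= _; first by left.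
by right; rewrite NegzE mulrNz.
Qed.

End Assembly.

(** * Polynomials attached to chambers *)

Section ChamberPolynomials.
Variables (R : realType) (r : nat).
Notation V := ('rV[R]_r).

Lemma polytope_cone (Psi : seq V) a t : polytope Psi a t -> cone Psi a.
Proof. by move=> [t0 tE]; exists t. Qed.

(** In the exterior both sides vanish, the polytope being empty. *)
Lemma vol_polynomial_chamber (Psi : seq V) c f a : vol_polynomial Psi c f ->
  chamber Psi c -> c a -> (f a)%:E = vol Psi a.
Proof.
move=> [_ fext fint] ch ca; case: (pselect (c = exterior Psi)) => [cE|/fint]; last first.
  by apply; exact: subset_closure.
have [sa nca] : exterior Psi a by rewrite -cE.
by rewrite fext// vol_out// => t /polytope_cone.
Qed.

Lemma count_polynomial_chamber (Psi : seq V) c f a : count_polynomial Psi c f ->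
  chamber Psi c -> c a -> Zpoints a -> f a = (count_polytope Psi a)%:R.
Proof.
move=> [_ fext fint] ch ca Za; case: (pselect (c = exterior Psi)) => [cE|/fint]; last first.
  by apply=> //; exact: subset_closure.
have [sa nca] : exterior Psi a by rewrite -cE.
rewrite fext// count_polytope_mx (_ : int_fiber _ _ = set0) /card_pts.
  by rewrite fset_set0 cardfs0.
apply/seteqP; split=> // t [t0 tE _] /=; apply: nca; exact: (@polytope_cone _ _ t).
Qed.

Lemma polynomial_is_line_poly (Psi : seq V) f : (forall a : V, a \in << Psi >>%VS) ->
  polynomial_on (spanned Psi) f -> is_line_poly f.
Proof.
move=> full [p fp]; apply: is_line_poly_ext (is_line_poly_mpoly p) => a.
by rewrite fp//; exact: full.
Qed.

Lemma norm_rescale (w0 a : V) (L eps : R) : 0 < L -> `|a - L *: w0| < L * eps ->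
  `|L^-1 *: a - w0| < eps.
Proof.
move=> L0 h; have -> : L^-1 *: a - w0 = L^-1 *: (a - L *: w0).
  by rewrite scalerBr scalerA mulVf ?scale1r// gt_eqF.
by rewrite normrZ gtr0_norm ?invr_gt0// mulrC ltr_pdivrMr// mulrC.
Qed.

End ChamberPolynomials.

Theorem theorem1 (R : realType) (r : nat) (Phi : seq 'rV[R]_r)
    (W : set 'rV[R]_r) (E : 'cV[R]_r) (c1 c2 c12 : set 'rV[R]_r)
    (Phi_neq0 : forall phi, phi \in Phi -> phi != 0)
    (Phi_gen : Zspan Phi = @Zpoints R r)
    (Phi_half : exists x : 'cV[R]_r,
       forall phi, phi \in Phi -> 0 < pairing phi x)
    (W_wall : wall Phi W)
    (E_prim : primitive E)
    (W_E : W = [set a | pairing a E = 0])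
    (c1_chamber : chamber Phi c1)
    (c2_chamber : chamber Phi c2)
    (c1c2_adj : adjacent_along Phi W E c1 c2) :
  let Phi0 := [seq phi <- Phi | phi \in W] in
  chamber Phi0 c12 ->
  closure c1 `&` closure c2 `&` W `<=` closure c12 ->
  (forall (v1 v2 v12 : 'rV[R]_r -> R) (V12 : mpoly.mpoly r R),
     vol_polynomial Phi c1 v1 ->
     vol_polynomial Phi c2 v2 ->
     vol_polynomial Phi0 c12 v12 ->
     (forall a, W a -> mpoly_eval V12 a = v12 a) ->
     forall a : 'rV[R]_r,
       residue0
         (fun z : R => diffop V12
            (fun x : 'cV[R]_r => expR (pairing a (x + z *: E)) /
               \prod_(phi <- Phi | phi \notin W) pairing phi (x + z *: E)) 0)
         (v1 a - v2 a)) /\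
  (unimodular Phi ->
   forall (k1 k2 k12 : 'rV[R]_r -> R) (K12 : mpoly.mpoly r R),
     count_polynomial Phi c1 k1 ->
     count_polynomial Phi c2 k2 ->
     count_polynomial Phi0 c12 k12 ->
     (forall a, W a -> mpoly_eval K12 a = k12 a) ->
     forall a : 'rV[R]_r,
       residue0
         (fun z : R => diffop K12
            (fun x : 'cV[R]_r => expR (pairing a (x + z *: E)) /
               \prod_(phi <- Phi | phi \notin W)
                  (1 - expR (- pairing phi (x + z *: E)))) 0)
         (k1 a - k2 a)).
Proof.
move=> Phi0 c12_chamber c12_sub.
have full (a : 'rV[R]_r) : a \in << Phi >>%VS by exact: span_full.
have [lam pos] := Phi_half.
have [w0 [eps [w0E eps0 c12_int in1 [in2 in12]]]] :=
  wall_ball W_E W_wall full c1_chamber c2_chamber c1c2_adj c12_sub.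
have [nu [subnu sznu fnu Wnu]] := W_wall.
have spnu (a : 'rV[R]_r) : a \in << nu >>%VS <-> pairing a E = 0.
  have /seteqP[h1 h2] : spanned nu = [set a | pairing a E = 0] by rewrite -Wnu.
  by split; [exact: h1|exact: h2].
have dE : dual_lattice E by case: E_prim.
have r0 : (0 < r)%N by rewrite -sznu.
have [e0 [Ze le] frame] := hyperplane_frame E_prim r0.
have inW phi : (phi \in W) = (pairing phi E == 0).
  by apply/idP/eqP; rewrite W_E inE.
have sub0 : subseq nu Phi0.
  rewrite subseq_filter subnu andbT; apply/allP => x xnu.
  by rewrite inW; apply/eqP/spnu/memv_span.
have lev0 psi : psi \in Phi0 -> pairing psi E = 0.
  by rewrite mem_filter inW => /andP[/eqP].
have span0 (a : 'rV[R]_r) : a \in << Phi0 >>%VS <-> pairing a E = 0.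
  split=> [|/spnu]; last by apply/subvP/sub_span => x; exact: mem_subseq.
  rewrite mem_span_submx => /submxP[t ->].
  rewrite mulmx_mx_of_seq pairing_suml big1// => i _; rewrite pairingZl.
  by rewrite lev0 ?mulr0// mem_nth.
set s := [seq phi <- Phi | phi \notin W].
have perm_s : perm_eq Phi (s ++ Phi0) by rewrite perm_sym perm_catC perm_filterC.
have pos_s psi : psi \in s ++ Phi0 -> 0 < pairing psi lam.
  by rewrite -(perm_mem perm_s); exact: pos.
have pos0 psi : psi \in Phi0 -> 0 < pairing psi lam.
  by move=> h; rewrite pos_s// mem_cat h orbT.
have levs phi : phi \in s -> pairing phi E != 0.
  by rewrite mem_filter inW => /andP[].
have ZPhi phi : phi \in Phi -> Zpoints phi by rewrite -Phi_gen; exact: mem_Zspan.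
have sPhi phi : phi \in s -> phi \in Phi by rewrite mem_filter => /andP[].
have s_neq0 : s != [::].
  apply/eqP => s0; move: (full e0).
  rewrite (eq_span (perm_mem perm_s)) s0 => /span0; rewrite le.
  exact/eqP/oner_neq0.
(* chambers are cones, so that the ball around w0 may be scaled *)
have near1 (L : R) a : 0 < L -> `|a - L *: w0| < L * eps -> 0 < pairing a E -> c1 a.
  move=> L0 an aE; rewrite -[a]scale1r -(mulfV (lt0r_neq0 L0)) -scalerA.
  apply: (chamberZ c1_chamber L0); apply: in1; first exact: norm_rescale.
  by rewrite pairingZl mulr_gt0// invr_gt0.
have near2 (L : R) a : 0 < L -> `|a - L *: w0| < L * eps -> pairing a E < 0 -> c2 a.
  move=> L0 an aE; rewrite -[a]scale1r -(mulfV (lt0r_neq0 L0)) -scalerA.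
  apply: (chamberZ c2_chamber L0); apply: in2; first exact: norm_rescale.
  by rewrite pairingZl pmulr_rlt0// invr_gt0.
have near12 (L : R) a : 0 < L -> `|a - L *: w0| < L * eps -> pairing a E = 0 -> closure c12 a.
  move=> L0 an aE; rewrite -[a]scale1r -(mulfV (lt0r_neq0 L0)) -scalerA.
  apply: (closure_chamberZ c12_chamber L0); apply: in12; first exact: norm_rescale.
  by rewrite pairingZl aE mulr0.
split=> [v1 v2 v12 V12 hv1 hv2 hv12 hV12 a|uni k1 k2 k12 K12 hk1 hk2 hk12 hK12 a].
- have framed0 : framed Phi0 by exact: frame.
  have bounded0 : bounded_vol Phi0.
    (* start from a basis of the wall and add the other vectors of Phi0 *)
    have [mu pmu] := subseq_perm_cat sub0.
    have [||||f b] := @bounded_vol_cat _ _ lam mu nu.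
    + by move=> psi; rewrite -(perm_mem pmu); exact: pos0.
    + move=> phi pm; apply/spnu/lev0; rewrite (perm_mem pmu) mem_cat pm //.
    + exact: frame.
    + exact/bounded_vol_free/frame.
    move=> M; have [C [C0 hC]] := b M; exists C; split => // x xM.
    have [d [m [e [P [K D]]]]] := f.
    by rewrite (vol_perm _ pmu D) hC.
  pose F (u : seq 'rV[R]_r) (x : 'rV[R]_r) := fine (vol (u ++ Phi0) x).
  have volF x : vol Phi x = vol (s ++ Phi0) x.
    have [phi [s' sE]] : exists phi s', s = phi :: s'.
      by move: s_neq0; case: (s) => // phi s' _; exists phi, s'.
    have sub x' : x' \in phi :: s' -> x' \in s by rewrite -sE.
    have [f _ _] := @vol_cat_facts _ _ lam E e0 s Phi0 dE Ze le span0 pos_s levs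
      framed0 bounded0 phi s' sub.
    by rewrite sE; have [d [m [e [P [K D]]]]] := f; apply: vol_perm D; rewrite -cat_cons -sE.
  have off phi : phi \in s -> off_wall E phi.
    move=> ps; split; first exact/ZPhi/sPhi.
    have := levs _ ps; have /intrP[n ->] := dE _ (ZPhi _ (sPhi _ ps)).
    rewrite intr_eq0 -[X in X <= _ \/ _]/(n%:~R) => n0.
    have : (n <= -1) || (1 <= n) by lia.
    by move=> /orP[h|h]; [left|right]; rewrite -(ler_int R) in h.
  have -> : v1 a - v2 a = vol_residue E V12 s a.
    apply: (@vol_crossing _ _ E V12 F s v1 v2 w0 e0 eps) => //.
    + move=> h phi s'; exact: (vol_line_integrable dE Ze le span0 pos_s levs framed0 bounded0).
    + move=> h phi psi s' b; exact: (vol_step dE Ze le span0 pos_s levs framed0 bounded0).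
    + move=> phi b; exact: (vol_single dE Ze le span0 levs framed0 bounded0).
    + move=> L w L0 wE wn; rewrite hV12; last by rewrite W_E.
      have [_ _ /(_ c12_int) hc] := hv12.
      by rewrite /F /= -hc//; exact: near12 wn wE.
    + move=> L b L0 bn bE; rewrite /F -volF.
      by rewrite -(vol_polynomial_chamber hv1 c1_chamber (near1 _ _ L0 bn bE)).
    + move=> L b L0 bn bE; rewrite /F -volF.
      by rewrite -(vol_polynomial_chamber hv2 c2_chamber (near2 _ _ L0 bn bE)).
    + by case: hv1 => h _ _; exact: polynomial_is_line_poly h.
    + by case: hv2 => h _ _; exact: polynomial_is_line_poly h.
  have := @vol_residue0 _ _ E V12 a s levs; congr residue0.
  apply/funext => z; congr diffop; apply/funext => x.
  by rewrite /s big_filter.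
- pose F (u : seq 'rV[R]_r) (x : 'rV[R]_r) : R := (count_polytope (u ++ Phi0) x)%:R.
  have unit_s phi : phi \in s -> unit_lev E phi.
    move=> ps; exact: (unimodular_unit_lev Phi_gen uni dE Ze le subnu fnu spnu (sPhi _ ps) (levs _ ps)).
  have countF x : count_polytope Phi x = count_polytope (s ++ Phi0) x.
    exact: count_polytope_perm pos_s perm_s.
  have -> : k1 a - k2 a = count_residue E K12 s a.
    apply: (@count_crossing _ _ E K12 dE F s k1 k2 w0 e0 eps) => //.
    + by move=> phi ps; split; [exact/ZPhi/sPhi|exact: unit_s].
    + move=> phi s' b sub; rewrite /F (@count_polytope_step _ _ lam) ?natrD ?addrK//.
      move=> psi; rewrite -cat_cons mem_cat => /orP[/sub|] h; first exact/pos/sPhi.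
      exact: pos0.
    + move=> phi b ps; rewrite /F /= (@count_polytope_single _ _ lam E)//.
      * by case: ifP.
      * move=> psi; rewrite inE => /orP[/eqP ->|]; first exact/ZPhi/sPhi.
        by rewrite mem_filter => /andP[_]; exact: ZPhi.
      * exact: unit_s.
    + move=> L w L0 Zw wE wn; rewrite hK12; last by rewrite W_E.
      have [_ _ /(_ c12_int) hc] := hk12.
      by rewrite /F /= -hc//; exact: near12 wn wE.
    + move=> L b L0 Zb bn bE; rewrite /F -countF.
      by rewrite -(count_polynomial_chamber hk1 c1_chamber (near1 _ _ L0 bn bE)).
    + move=> L b L0 Zb bn bE; rewrite /F -countF.
      by rewrite -(count_polynomial_chamber hk2 c2_chamber (near2 _ _ L0 bn bE)).
    + by case: hk1 => h _ _; exact: polynomial_is_line_poly h.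
    + by case: hk2 => h _ _; exact: polynomial_is_line_poly h.
  have := @count_residue0 _ _ E K12 a s unit_s; congr residue0.
  apply/funext => z; congr diffop; apply/funext => x.
  by rewrite /s big_filter.
Qed.
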